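(* Let $n,d\ge1$ be integers, let $\Sigma$ be a symmetric positive definite $d\times d$ real matrix with eigenvalues $\lambda_1,\dots,\lambda_d$, let $\mathfrak W_n\sim\mathcal W_d(n,n^{-1}\Sigma)$, and let $W_n:=\mathrm{tr}(\mathfrak W_n)$. Let $$\nu_n:=n\,\frac{\mathrm{tr}(\Sigma)^2}{\mathrm{tr}(\Sigma^2)}$$ and let $U_n\sim\mathcal G_{\nu_n/2,\,2\,\mathrm{tr}(\Sigma)/\nu_n}$. For $r=1,2$, set $$\Delta_n^{(r)}:=\max_{1\le j\le d}\left\{\left|\frac{\lambda_j\,\mathrm{tr}(\Sigma)}{\mathrm{tr}(\Sigma^2)}-1\right|\left(\frac{\lambda_j}n\right)^r\right\}.$$ Then $$d_1(W_n,U_n)\le4\Delta_n^{(1)},\qquad d_2(W_n,U_n)\le8\Delta_n^{(2)}+2\,\mathrm{tr}(\Sigma)\,e_{\nu_n/2}\Delta_n^{(1)}.$$ If $\nu_n>2$, then $$d_{\mathrm{Kol}}(W_n,U_n)\le2\left(\frac{\mathrm{tr}(\Sigma)}{\mathrm{tr}(\Sigma^2)}\,\frac{n\Delta_n^{(1)}}{\sqrt{2\pi(\nu_n/2-1)}\,r_{\nu_n/2}}\right)^{1/2}.$$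
   Context: $\mathcal W_d(n,\Psi)$ denotes the $d$-dimensional Wishart distribution with $n$ degrees of freedom and scale matrix $\Psi$, i.e. the law of $\sum_{i=1}^nZ_iZ_i'$ with $Z_1,\dots,Z_n$ i.i.d. $N_d(0,\Psi)$. For $a,b>0$, $\mathcal G_{a,b}$ denotes the Gamma distribution with shape $a$ and scale $b$, with density $p_{a,b}(x)=\frac{1}{\Gamma(a)b^a}x^{a-1}e^{-x/b}\mathbf 1_{\{x>0\}}$. For $\alpha>1$, $r_\alpha:=\exp\left(\frac1{12\alpha-11}\right)$. Distances. $\mathcal Z_1$ is the class of continuously differentiable $h:(0,\infty)\to\mathbb R$ with $\|h'\|_\infty\le1$; $\mathcal Z_2$ is the class of twice continuously differentiable $h:(0,\infty)\to\mathbb R$ with $\|h''\|_\infty\le1$. For (almost surely) positive random variables $X,Y$ with finite moments of order $j\in\{1,2\}$, $d_j(X,Y):=\sup_{h\in\mathcal Z_j}|\mathbb E[h(X)]-\mathbb E[h(Y)]|$. Also $d_{\mathrm{Kol}}(X,Y):=\sup_{z\in\mathbb R}|\mathbb P[X\le z]-\mathbb P[Y\le z]|$. The constant $e_a$, $a>0$. Write $P_{a,1}(x)=\int_0^xp_{a,1}(u)\,du$, $\overline P_{a,1}(x)=\int_x^\infty p_{a,1}(u)\,du$, $\underline{\mathrm P}^1_{a,1}(x)=\int_0^xP_{a,1}(u)\,du$, $\overline{\mathrm P}^1_{a,1}(x)=\int_x^\infty\overline P_{a,1}(u)\,du$, $\underline M_{a,1}(y)=\frac{P_{a,1}(y)}{y\,p_{a,1}(y)}$,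 $\overline M_{a,1}(y)=\frac{\overline P_{a,1}(y)}{y\,p_{a,1}(y)}$ for $x,y>0$, and $$C_{a,1}^2(z)=\overline M_{a,1}''(z)\int_0^z\underline{\mathrm P}^1_{a,1}(x)\,dx+\underline M_{a,1}''(z)\int_z^\infty\overline{\mathrm P}^1_{a,1}(x)\,dx,\qquad z>0.$$ Then $e_a:=\sup_{z>0}C_{a,1}^2(z)$, which is finite. *)

(* Defs.v *)
From HB Require Import structures.
From mathcomp Require Import all_boot all_order all_algebra.
From mathcomp Require Import all_classical all_reals all_analysis.

Set Implicit Arguments.
Unset Strict Implicit.
Unset Printing Implicit Defensive.
Import Order.TTheory GRing.Theory Num.Theory.
Import numFieldNormedType.Exports.

Local Open Scope ring_scope.
Local Open Scope classical_set_scope.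

(* The Borel sigma-algebra of the space of real m x n matrices, as the
   sigma-algebra generated by the coordinate maps. *)
Definition mx_cylinder (R : realType) (m n : nat) : set_system 'M[R]_(m, n) :=
  [set C | exists (i : 'I_m) (j : 'I_n), exists2 B : set R,
     measurable B & C = (fun M : 'M[R]_(m, n) => M i j) @^-1` B].

Definition mx_display : measure_display.
Proof. exact: default_measure_display. Qed.

Section measurable_matrix.
Context (R : realType) (m n : nat).

Let mx0 : <<s @mx_cylinder R m n >> set0.
Proof. exact: sigma_algebra0. Qed.

Let mxC A : <<s @mx_cylinder R m n >> A -> <<s @mx_cylinder R m n >> (~` A).
Proof. exact: sigma_algebraC. Qed.

Let mx_bigcup (F : (set _)^nat) : (forall i, <<s @mx_cylinder R m n >> (F i)) ->
  <<s @mx_cylinder R m n >> (\bigcup_i (F i)).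
Proof. exact: sigma_algebra_bigcup. Qed.

HB.instance Definition _ := @isMeasurable.Build mx_display 'M[R]_(m, n)
  <<s @mx_cylinder R m n >> mx0 mxC mx_bigcup.

End measurable_matrix.

Lemma measurable_coord (R : realType) (m n : nat) (i : 'I_m) (j : 'I_n) :
  measurable_fun [set: 'M[R]_(m, n)] (fun M : 'M[R]_(m, n) => M i j).
Proof.
move=> _ B mB; rewrite setTI; apply: sub_sigma_algebra.
by exists i, j, B.
Qed.

Lemma measurable_mxtrace (R : realType) (n : nat) :
  measurable_fun [set: 'M[R]_n] (@mxtrace R n).
Proof.
by apply: measurable_sum => i; exact: measurable_coord.
Qed.

HB.instance Definition _ (R : realType) (n : nat) :=
  isMeasurableFun.Build _ _ _ _ (@mxtrace R n) (@measurable_mxtrace R n).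

(* Laws are only compared on measurable sets: on other sets the values of
   [distribution P X] are meaningless. *)
Definition same_law d (T : measurableType d) (R : realType)
    (mu nu : set T -> \bar R) : Prop :=
  forall A, measurable A -> mu A = nu A.

Definition independent_RVs d d' (T : measurableType d) (T' : measurableType d')
    (R : realType) (P : probability T R) (I : finType)
    (X : I -> {RV P >-> T'}) : Prop :=
  forall B : I -> set T', (forall i, measurable (B i)) ->
    P (\bigcap_(i in [set: I]) (X i @^-1` B i)) =
    (\prod_(i : I) P (X i @^-1` B i))%E.

(* Z ~ N_k(0, Psi): Z has the law of A G, where A A' = Psi and the k
   coordinates of G are i.i.d. standard normal. *)
Definition is_multinormal d (T : measurableType d) (R : realType)
    (P : probability T R) (k : nat) (Psi : 'M[R]_k)
    (Z : {RV P >-> 'cV[R]_k}) : Prop :=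
  exists A : 'M[R]_k, A *m A^T = Psi /\
  exists d' (T' : measurableType d') (Q : probability T' R)
         (G : 'I_k -> {RV Q >-> R}),
    [/\ independent_RVs G,
        forall i, same_law (distribution Q (G i)) (normal_prob 0 1) &
        same_law (distribution P Z)
                 (pushforward Q (fun w => A *m (\col_i G i w)))].

Definition is_wishart d (T : measurableType d) (R : realType)
    (P : probability T R) (k n : nat) (Psi : 'M[R]_k)
    (W : {RV P >-> 'M[R]_k}) : Prop :=
  exists d' (T' : measurableType d') (Q : probability T' R)
         (Z : 'I_n -> {RV Q >-> 'cV[R]_k}),
    [/\ independent_RVs Z,
        forall i, is_multinormal Psi (Z i) &
        same_law (distribution P W)
                 (pushforward Q (fun w => \sum_(i < n) Z i w *m (Z i w)^T))].

Definition Gamma_fun (R : realType) (a : R) : R :=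
  \int[@lebesgue_measure R]_(x in `]0%R, +oo[) (x `^ (a - 1) * expR (- x)).

Definition gamma_pdf (R : realType) (a b x : R) : R :=
  if 0 < x then (Gamma_fun a * b `^ a)^-1 * x `^ (a - 1) * expR (- x / b)
  else 0.

(* shape a, scale b *)
Definition gamma_prob (R : realType) (a b : R) (A : set R) : \bar R :=
  (\int[@lebesgue_measure R]_(x in A) (gamma_pdf a b x)%:E)%E.

Definition is_gamma d (T : measurableType d) (R : realType)
    (P : probability T R) (a b : R) (U : {RV P >-> R}) : Prop :=
  same_law (distribution P U) (gamma_prob a b).

(* A function on (0, +oo) is represented by a total function whose values
   outside (0, +oo) are never used. *)
Definition Zclass1 (R : realType) : set (R -> R) :=
  [set h : R -> R | forall x : R, 0 < x ->
     [/\ derivable h x 1, {for x, continuous h^`()} & `|h^`() x| <= 1]].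

Definition Zclass2 (R : realType) : set (R -> R) :=
  [set h : R -> R | forall x : R, 0 < x ->
     [/\ derivable h x 1, derivable h^`() x 1,
         {for x, continuous h^`(2)} & `|h^`(2) x| <= 1]].

(* E[h(X)] for h defined on (0, +oo) and X almost surely positive *)
Definition Epos d (T : measurableType d) (R : realType) (P : probability T R)
    (X : {RV P >-> R}) (h : R -> R) : \bar R :=
  (\int[P]_(w in X @^-1` `]0%R, +oo[) (h (X w))%:E)%E.

Section distances.
Context d1 (T1 : measurableType d1) d2 (T2 : measurableType d2) (R : realType)
  (P : probability T1 R) (Q : probability T2 R)
  (X : {RV P >-> R}) (Y : {RV Q >-> R}).

Definition dist_test (Z : set (R -> R)) : \bar R :=
  ereal_sup [set `|Epos X h - Epos Y h|%E | h in Z].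

Definition dist1 : \bar R := dist_test (@Zclass1 R).

Definition dist2 : \bar R := dist_test (@Zclass2 R).

Definition dist_Kol : \bar R :=
  ereal_sup [set `|cdf X z - cdf Y z|%E | z in [set: R]].

End distances.

Section e_constant.
Context (R : realType) (a : R).
Local Notation mu := (@lebesgue_measure R).
Local Notation p := (gamma_pdf a 1).

(* low / up: integration over (0, x) / (x, +oo), i.e. underlined / overlined
   quantities in the usual notation *)
Definition Plow (x : R) : R := \int[mu]_(u in `]0%R, x[) p u.
Definition Pup (x : R) : R := \int[mu]_(u in `]x, +oo[) p u.
Definition Plow1 (x : R) : R := \int[mu]_(u in `]0%R, x[) Plow u.
Definition Pup1 (x : R) : R := \int[mu]_(u in `]x, +oo[) Pup u.

Definition Mlow (y : R) : R := Plow y / (y * p y).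
Definition Mup (y : R) : R := Pup y / (y * p y).

Definition C2 (z : R) : R :=
  (Mup^`(2))%classic z * (\int[mu]_(x in `]0%R, z[) Plow1 x) +
  (Mlow^`(2))%classic z * (\int[mu]_(x in `]z, +oo[) Pup1 x).

(* Valued in the extended reals, so that no finiteness is presupposed. *)
Definition e_const : \bar R := ereal_sup [set (C2 z)%:E | z in `]0%R, +oo[].

End e_constant.

Definition posdefmx (R : realType) (k : nat) (S : 'M[R]_k) : Prop :=
  forall u : 'cV[R]_k, u != 0 -> 0 < (u^T *m S *m u) 0 0.

Definition nu_eff (R : realType) (k n : nat) (S : 'M[R]_k) : R :=
  n%:R * (\tr S ^+ 2 / \tr (S *m S)).

(* All terms are nonnegative, so 0 is a harmless default for the maximum. *)
Definition Delta (R : realType) (k n : nat) (S : 'M[R]_k) (lam : 'I_k -> R)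
    (r : nat) : R :=
  \big[Num.max/0]_(j < k)
    (`|lam j * \tr S / \tr (S *m S) - 1| * (lam j / n%:R) ^+ r).

Definition r_const (R : realType) (a : R) : R := expR ((12 * a - 11)^-1).

(* Main.v *)
From HB Require Import structures.
Require Import Defs.
From mathcomp Require Import all_boot all_order all_algebra.
From mathcomp Require Import all_classical all_reals all_analysis.
From mathcomp Require Import measurable_realfun zify ring lra.
From mathcomp Require spectral complex.

(** Stein's method. Write [S = Sigma / n], [W] for the sum of the [|Z_i|^2] and
    [q_M] for the sum of the [Z_i^T M Z_i]. Gaussian integration by parts gives
    [E(q_M f(W)) = n tr(M S) E(f(W)) + 2 E(q_(M S) f'(W))] for symmetric [M]. If
    [b] is the scale of the Gamma law then [M = b - 2 S] satisfies [tr(M S) = 0],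
    so the Gamma Stein operator [b x f' + (a b - x) f] evaluated at [W] has the
    mean of [2 q_(M S) f''(W)]. The spectral theorem bounds [q_(M S)] by
    [b Delta_1 W], and the solutions of the Stein equation satisfy
    [|x f''(x)| <= 2 / b] for test functions in [Zclass1]; for [Zclass2] one
    integrates by parts once more and [|f''|] is bounded by [C2]. The functions
    are evaluated at [W + r] with [r --> 0], which keeps them away from the
    singularity at the origin.

    For the Kolmogorov distance, half-line indicators are smoothed into ramps of
    width [e], at the cost of [e / 2] times the supremum of the Gamma density,
    which is attained at the mode and estimated by Robbins' form of Stirling's
    formula; then [e] is optimised. *)

Set Implicit Arguments.
Unset Strict Implicit.
Unset Printing Implicit Defensive.
Import Order.TTheory GRing.Theory Num.Theory.
Import numFieldNormedType.Exports.

Local Open Scope ring_scope.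
Local Open Scope classical_set_scope.

(** * Calculus on the half-line *)

(** The relations [a b = n tr S] and [b tr S = 2 tr(S S)] say that the two laws share mean and
    variance. Equal means cancel the term of order zero of the Stein operator at [W]; equal
    variances make tr(M S) vanish, so that only f'' survives.

    The bounds on f come from kernel formulas that integrate h' or h'' against tails of the Gamma
    law, on both sides of x. Where the two halves of the kernel have the same sign, the extremal
    test function is x or x^2 / 2, whose solution is explicit, and the bound is a pure number: in |x
    f''| <= 2 / b one unit comes from the kernel and one from a boundary term. For f'' and [Zclass2]
    the halves have opposite signs, nothing cancels, and the supremum of [C2] stays in the
    statement. As [e_const] is an extended real that is not known to be finite, the case Delta_1 = 0
    is treated apart.

    [W] is almost surely positive because Sigma is invertible, so nothing is lost as r --> 0; the
    bounds that degenerate in this limit serve integrability only. *)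

Section derive_rules.
Context {R : realType}.
Implicit Types (f g : R -> R) (x a b : R).

Lemma is_derive1_eq f x a b : is_derive x 1 f a -> a = b -> is_derive x 1 f b.
Proof. by move=> ? <-. Qed.

Lemma is_derive1D f g x a b : is_derive x 1 f a -> is_derive x 1 g b ->
  is_derive x 1 (fun y => f y + g y) (a + b).
Proof. by move=> *; apply: is_deriveD. Qed.

Lemma is_derive1B f g x a b : is_derive x 1 f a -> is_derive x 1 g b ->
  is_derive x 1 (fun y => f y - g y) (a - b).
Proof. by move=> *; apply: is_deriveB. Qed.

Lemma is_derive1N f x a : is_derive x 1 f a ->
  is_derive x 1 (fun y => - f y) (- a).
Proof. by move=> *; apply: is_deriveN. Qed.

Lemma is_derive1M f g x a b : is_derive x 1 f a -> is_derive x 1 g b ->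
  is_derive x 1 (fun y => f y * g y) (a * g x + f x * b).
Proof.
move=> fa gb; apply: (@is_derive_eq _ _ _ _ _ _ _ _ (is_deriveM fa gb)).
by rewrite addrC mulrC.
Qed.

Lemma is_derive1V f x a : f x != 0 -> is_derive x 1 f a ->
  is_derive x 1 (fun y => (f y)^-1) (- a / f x ^+ 2).
Proof.
move=> fx0 fa; apply: (@is_derive_eq _ _ _ _ _ _ _ _ (is_deriveV fx0 fa)).
by rewrite /GRing.scale/= mulrC mulNr mulrN.
Qed.

Lemma is_derive1_cst x a : is_derive x 1 (fun _ => a) 0.
Proof. exact: is_derive_cst. Qed.

Lemma is_derive1_id x : is_derive x 1 (fun y : R => y) 1.
Proof. exact: is_derive_id. Qed.

Lemma is_derive1_sqr f x a : is_derive x 1 f a ->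
  is_derive x 1 (fun y => f y ^+ 2) (2 * f x * a).
Proof.
move=> fa; have h := is_derive1M fa fa.
apply: (is_derive1_eq h); ring.
Qed.

Lemma is_derive1_chain f g x a b : is_derive (g x) 1 f a ->
  is_derive x 1 g b -> is_derive x 1 (fun y => f (g y)) (a * b).
Proof. exact: is_derive1_comp. Qed.

Lemma is_derive1_exp g x b : is_derive x 1 g b ->
  is_derive x 1 (fun y => expR (g y)) (expR (g x) * b).
Proof. by move=> h; apply: is_derive1_chain. Qed.

Lemma is_derive1_continuous f x a : is_derive x 1 f a -> {for x, continuous f}.
Proof. by move=> [fx _]; apply/differentiable_continuous/derivable1_diffP. Qed.

Lemma is_derive1E f x a : is_derive x 1 f a -> f^`() x = a.
Proof. by move=> [_ <-]; rewrite derive1E. Qed.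

Lemma derivable_is_derive1 f x : derivable f x 1 -> is_derive x 1 f (f^`() x).
Proof. by move=> /derivableP; rewrite derive1E. Qed.

Lemma near_is_derive1 f g x a : (\forall y \near x, f y = g y) ->
  is_derive x 1 f a -> is_derive x 1 g a.
Proof.
exact: near_eq_is_derive.
Qed.

Lemma near_pos x : 0 < x -> \forall y \near x, 0 < y.
Proof. by move=> x0; near=> y; near: y; exact: lt_nbhsr. Unshelve. all: by end_near. Qed.

End derive_rules.

Section halfline_calculus.
Context {R : realType}.
Implicit Types (f F : R -> R) (x y z : R).

Lemma within_cont f (A : set R) : (forall x, A x -> {for x, continuous f}) ->
  {within A, continuous f}.
Proof.
by move=> h; apply: continuous_in_subspaceT => x; rewrite inE; exact: h.
Qed.

Lemma MVT_pos f F x y : 0 < x -> x <= y ->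
  (forall z, 0 < z -> is_derive z 1 F (f z)) ->
  exists2 c, x <= c <= y & F y - F x = f c * (y - x).
Proof.
move=> x0 xy dF.
have [||c cxy ->] := @MVT_segment R F f x y xy.
- move=> z; rewrite in_itv/= => /andP[xz _]; apply: dF.
  exact: lt_trans x0 xz.
- apply: within_cont => z /=; rewrite in_itv/= => /andP[xz _].
  by apply: is_derive1_continuous; apply: dF; exact: lt_le_trans x0 xz.
- by exists c.
Qed.

Lemma ndecr_pos f F : (forall z, 0 < z -> is_derive z 1 F (f z)) ->
  (forall z, 0 < z -> 0 <= f z) ->
  forall x y, 0 < x -> x <= y -> F x <= F y.
Proof.
move=> dF f0 x y x0 xy; have [c /andP[xc _] e] := MVT_pos x0 xy dF.
rewrite -subr_ge0 e mulr_ge0 ?subr_ge0//; apply: f0; exact: lt_le_trans xc.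
Qed.

Lemma near0r : \forall y \near (0 : R)^'+, 0 < y.
Proof. exact: nbhs_right_gt. Qed.

(** Reads a sign off a derivative and a boundary value. With the counterpart at +oo it yields the
    signs of the numerators [N1], [N2], [N3] on which the bounds on Stein solutions rest. *)
Lemma ge0_of_cvg0 f F : (forall z, 0 < z -> is_derive z 1 F (f z)) ->
  (forall z, 0 < z -> 0 <= f z) -> F x @[x --> 0^'+] --> 0 ->
  forall x, 0 < x -> 0 <= F x.
Proof.
move=> dF f0 F0 x x0; apply: (cvgr_to_le F0).
near=> y; apply: (ndecr_pos dF f0); first by near: y; exact: near0r.
by near: y; exact: nbhs_right_le.
Unshelve. all: by end_near. Qed.

Lemma le0_of_cvgy f F : (forall z, 0 < z -> is_derive z 1 F (f z)) ->
  (forall z, 0 < z -> 0 <= f z) -> F x @[x --> +oo] --> 0 ->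
  forall x, 0 < x -> F x <= 0.
Proof.
move=> dF f0 F0 x x0; apply: (cvgr_to_ge F0).
near=> y; apply: (ndecr_pos dF f0 x0).
by near: y; apply: nbhs_pinfty_ge; exact: num_real.
Unshelve. all: by end_near. Qed.

End halfline_calculus.

(** * Fundamental theorem of calculus on open and unbounded intervals *)

Section ftc_open.
Context {R : realType}.
Local Notation mu := (@lebesgue_measure R).
Implicit Types (f F : R -> R) (a b : R).

Lemma FTC_segment f F a b : a < b ->
  (forall x, a <= x <= b -> is_derive x 1 F (f x)) ->
  (forall x, a <= x <= b -> {for x, continuous f}) ->
  (\int[mu]_(x in `[a, b]) (f x)%:E = (F b - F a)%:E)%E.
Proof.
move=> ab dF cf; rewrite (@continuous_FTC2 _ f F)//.
- by apply: within_cont => x /=; rewrite in_itv/=; exact: cf.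
- split.
  + by move=> x; rewrite in_itv/= => /andP[/ltW ax /ltW xb]; case: (dF x); rewrite ?ax.
  + by apply: cvg_at_right_filter; apply: is_derive1_continuous; apply: dF; rewrite lexx ltW.
  + by apply: cvg_at_left_filter; apply: is_derive1_continuous; apply: dF; rewrite lexx ltW.
- move=> x; rewrite in_itv/= => /andP[/ltW ax /ltW xb].
  by apply: is_derive1E; apply: dF; rewrite ax.
Qed.

Lemma seq_segment_mono (u v : R^nat) :
  {homo u : n m / (n <= m)%N >-> m <= n} -> {homo v : n m / (n <= m)%N >-> n <= m} ->
  {homo (fun n => `[u n, v n]%classic) : n m / (n <= m)%N >-> (n <= m)%O}.
Proof.
move=> hu hv n m nm; apply/subsetPset => x /=.
rewrite !in_itv/= => /andP[ux xv]; apply/andP; split.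
  exact: le_trans (hu _ _ nm) ux.
exact: le_trans xv (hv _ _ nm).
Qed.

Section exhaustion.
Variables (f F : R -> R) (u v : R^nat) (D : set R) (l L : R).
Hypothesis uv : forall n, u n < v n.
Hypothesis hu : {homo u : n m / (n <= m)%N >-> m <= n}.
Hypothesis hv : {homo v : n m / (n <= m)%N >-> n <= m}.
Hypothesis DE : D = \bigcup_n `[u n, v n]%classic.
Hypothesis dF : forall x, D x -> is_derive x 1 F (f x).
Hypothesis cf : forall x, D x -> {for x, continuous f}.
Hypothesis Fl : F (u n) @[n --> \oo] --> l.
Hypothesis FL : F (v n) @[n --> \oo] --> L.

Let sub n x : u n <= x <= v n -> D x.
Proof. by move=> h; rewrite DE; exists n => //=; rewrite in_itv. Qed.

Let mf n : measurable_fun `[u n, v n] f.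
Proof.
apply: subspace_continuous_measurable_fun => //; apply: within_cont => x /=.
by rewrite in_itv/= => h; apply: cf; exact: sub h.
Qed.

Let Fcvg : (\int[mu]_(x in `[u n, v n]) (f x)%:E)%E @[n --> \oo] --> (L - l)%:E.
Proof.
rewrite [X in X @ _ --> _](_ : _ = fun n => (F (v n) - F (u n))%:E); last first.
  apply/funext => n; apply: FTC_segment => // x h.
    by apply: dF; exact: sub h.
  by apply: cf; exact: sub h.
by apply: cvg_EFin; [exact: nearW|apply: cvgB].
Qed.

(** Monotone convergence along the segments [u n, v n], where the usual theorem applies. [f] may
    blow up at the ends of [D]; the limits of [F] stand for its boundary values. *)
Lemma ge0_FTC_exhaust : (forall x, D x -> 0 <= f x) ->
  (\int[mu]_(x in D) (f x)%:E = (L - l)%:E)%E.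
Proof.
move=> f0; apply: (cvg_unique (@ereal_hausdorff R) _ Fcvg) => /=; rewrite DE.
apply: (@ge0_nondecreasing_set_cvg_integral _ _ _ _ _ mu).
- exact: seq_segment_mono.
- by move=> n; exact: measurable_itv.
- by move=> n; apply/measurable_EFinP; exact: mf.
- by move=> n x /=; rewrite in_itv/= => h; rewrite lee_fin; apply: f0; exact: sub h.
Qed.

(** Monotone convergence is applied to the positive and to the negative part; integrability keeps
    the difference of the limits from being undetermined. *)
Lemma integrable_FTC_exhaust : mu.-integrable D (EFin \o f) ->
  (\int[mu]_(x in D) (f x)%:E = (L - l)%:E)%E.
Proof.
move=> fi.
have mD : measurable D by rewrite DE; apply: bigcup_measurable.
suff : (\int[mu]_(x in `[u n, v n]) (f x)%:E)%E @[n --> \oo] -->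
    (\int[mu]_(x in D) (f x)%:E)%E.
  by move=> h; exact: (cvg_unique (@ereal_hausdorff R) h Fcvg).
rewrite [X in X @ _ --> _](_ : _ = fun n =>
   (\int[mu]_(x in `[u n, v n]) ((EFin \o f)^\+ x) -
    \int[mu]_(x in `[u n, v n]) ((EFin \o f)^\- x))%E); last first.
  by apply/funext => n; rewrite integralE.
rewrite integralE; apply: cvgeB.
- apply: fin_num_adde_defl; rewrite fin_numN; exact: integrable_neg_fin_num.
- rewrite DE; apply: (@ge0_nondecreasing_set_cvg_integral _ _ _ _ _ mu) => //.
  + exact: seq_segment_mono.
  + by move=> n; apply: measurable_funepos; apply/measurable_EFinP; exact: mf.
- rewrite DE; apply: (@ge0_nondecreasing_set_cvg_integral _ _ _ _ _ mu) => //.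
  + exact: seq_segment_mono.
  + by move=> n; apply: measurable_funeneg; apply/measurable_EFinP; exact: mf.
Qed.

End exhaustion.
End ftc_open.

Section ftc_halfline.
Context {R : realType}.
Local Notation mu := (@lebesgue_measure R).
Implicit Types (f F : R -> R) (x y z : R).

Lemma cvg_harmonic_scale (c x : R) : x + c * (n.+1%:R)^-1 @[n --> \oo] --> x.
Proof.
rewrite -[X in _ --> X]addr0 -(mulr0 c).
apply: cvgD; first exact: cvg_cst.
apply: cvgM; first exact: cvg_cst.
exact: cvg_harmonic.
Qed.

Lemma invS_mono n m : (n <= m)%N -> (m.+1%:R)^-1 <= (n.+1%:R)^-1 :> R.
Proof. by move=> nm; rewrite lef_pV2 ?posrE ?ltr0n// ler_nat ltnS. Qed.

Lemma cvg_natr_shift : (n.+2%:R : R) @[n --> \oo] --> +oo.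
Proof.
apply/cvgryPge => A; have := @cvgr_idn R; move/cvgryPge => /(_ A) h.
by near=> n; apply: (@le_trans _ _ n%:R); [near: n|rewrite ler_nat; lia].
Unshelve. all: by end_near. Qed.

Lemma cvgy_natr F (L x : R) : F y @[y --> +oo] --> L ->
  F (x + n.+2%:R) @[n --> \oo] --> L.
Proof.
move/cvg_pinftyP; apply.
apply/cvgryPge => A; have := cvg_natr_shift; move/cvgryPge => /(_ (A - x)) h.
by near=> n; rewrite -lerBlDl; near: n.
Unshelve. all: by end_near.
Qed.

Lemma cvg0_invn F (l : R) : F y @[y --> 0^'+] --> l ->
  F ((n.+1%:R)^-1) @[n --> \oo] --> l.
Proof.
move/cvg_at_rightP; apply; split; first by move=> n; rewrite invr_gt0.
exact: cvg_harmonic.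
Qed.

Lemma lt_bound_nat (x : R) : exists n : nat, x <= n%:R.
Proof.
exists (Num.bound `|x|); apply: (le_trans (ler_norm x)); apply: ltW.
exact: archi_boundP.
Qed.

Lemma le_inv_bound (x : R) : 0 < x -> exists n : nat, n.+1%:R^-1 <= x.
Proof.
move=> x0; have [n hn] := lt_bound_nat x^-1; exists n.
rewrite -[leRHS]invrK lef_pV2 ?posrE ?invr_gt0//.
by apply: (le_trans hn); rewrite ler_nat.
Qed.

Lemma bigcup_0y : `]0, +oo[%classic = \bigcup_n `[(n.+1%:R)^-1, n.+2%:R : R]%classic.
Proof.
apply/seteqP; split => x /=; rewrite in_itv/= ?andbT => hx.
- have [n hn] := lt_bound_nat x; have [m hm] := le_inv_bound hx.
  exists (n + m)%N => //=; rewrite in_itv/=; apply/andP; split.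
    by apply: le_trans hm; apply: invS_mono; exact: leq_addl.
  apply: (le_trans hn); rewrite ler_nat; lia.
- case: hx => n _ /=; rewrite in_itv/= => /andP[h _].
  by apply: lt_le_trans h; rewrite invr_gt0.
Qed.

Lemma bigcup_xy x : `]x, +oo[%classic =
  \bigcup_n `[x + (n.+1%:R)^-1, x + n.+2%:R]%classic.
Proof.
have h y : x < y <-> 0 < y - x by rewrite subr_gt0.
apply/seteqP; split => y /=; rewrite in_itv/= ?andbT => hy.
- have : `]0, +oo[%classic (y - x) by rewrite /= in_itv/= andbT subr_gt0.
  rewrite bigcup_0y => -[n _ /=].
  rewrite in_itv/= => /andP[h1 h2]; exists n => //=; rewrite in_itv/=.
  by rewrite addrC -lerBrDr h1/= -lerBlDl.
- case: hy => n _ /=; rewrite in_itv/= => /andP[h1 _].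
  by apply: lt_le_trans h1; rewrite ltrDl invr_gt0.
Qed.

(** The margin x / 3 keeps the left end below the right end for every n: at n = 0 the segment is
    [x / 3, 2 x / 3]. *)
Lemma bigcup_0x x : 0 < x -> `]0, x[%classic =
  \bigcup_n `[0 + (x / 3) * (n.+1%:R)^-1, x + (- (x / 3)) * (n.+1%:R)^-1]%classic.
Proof.
move=> x0; have x3 : 0 < x / 3 by rewrite divr_gt0.
apply/seteqP; split => y /=; rewrite in_itv/= ?andbT.
- move=> /andP[y0 yx].
  have [n hn] := @le_inv_bound (y / (x / 3)) (divr_gt0 y0 x3).
  have [m hm] := @le_inv_bound ((x - y) / (x / 3)) (divr_gt0 (etrans (subr_gt0 y x) yx) x3).
  exists (n + m)%N => //=; rewrite in_itv/= add0r; apply/andP; split.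
    rewrite mulrC -ler_pdivlMr//; apply: le_trans hn; apply: invS_mono; exact: leq_addr.
  rewrite mulNr lerBrDr -lerBrDl mulrC -ler_pdivlMr//.
  apply: le_trans hm; apply: invS_mono; exact: leq_addl.
- case=> n _ /=; rewrite in_itv/= add0r => /andP[h1 h2].
  have i0 : 0 < (n.+1%:R)^-1 :> R by rewrite invr_gt0.
  rewrite (lt_le_trans _ h1) ?mulr_gt0//=; apply: (le_lt_trans h2).
  by rewrite mulNr gtrBl mulr_gt0.
Qed.

Variables (f F : R -> R).
Hypothesis dF : forall x : R, 0 < x -> is_derive x 1 F (f x).
Hypothesis cf : forall x : R, 0 < x -> {for x, continuous f}.

Let Fcont (c x : R) : 0 < x -> F (x + c * (n.+1%:R)^-1) @[n --> \oo] --> F x.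
Proof.
move=> x0; apply: (@cvg_comp _ _ _ (fun n => x + c * n.+1%:R^-1) F _ (nbhs x)).
  exact: cvg_harmonic_scale.
by apply: is_derive1_continuous; exact: dF.
Qed.

Section from0.
Variable l : R.
Hypothesis F0 : F x @[x --> 0^'+] --> l.

Let F0' (c : R) : 0 < c -> F (0 + c * (n.+1%:R)^-1) @[n --> \oo] --> l.
Proof.
move=> c0; move/cvg_at_rightP : F0; apply; split.
  by move=> n; rewrite add0r mulr_gt0// invr_gt0.
exact: cvg_harmonic_scale.
Qed.

Let mono_u (c x : R) : 0 < c -> {homo (fun n => x + c * (n.+1%:R)^-1) : n m / (n <= m)%N >-> m <= n}.
Proof. by move=> c0 n m nm; rewrite lerD2l ler_pM2l//; exact: invS_mono. Qed.

Let mono_v (c x : R) : 0 < c -> {homo (fun n => x + - c * (n.+1%:R)^-1) : n m / (n <= m)%N >-> n <= m}.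
Proof. by move=> c0 n m nm; rewrite lerD2l !mulNr lerN2 ler_pM2l//; exact: invS_mono. Qed.

Let uv0x x n : 0 < x -> 0 + (x / 3) * (n.+1%:R)^-1 < x + (- (x / 3)) * (n.+1%:R)^-1.
Proof.
move=> x0; have : (n.+1%:R)^-1 <= 1 :> R by rewrite invf_le1// ler1n.
by move: (_^-1) => t ht; nra.
Qed.

Let d0x x y : `]0, x[%classic y -> 0 < y.
Proof. by move=> /=; rewrite in_itv/= => /andP[]. Qed.

Lemma ge0_FTC0x x : 0 < x -> (forall y : R, 0 < y -> 0 <= f y) ->
  (\int[mu]_(y in `]0%R, x[) (f y)%:E = (F x - l)%:E)%E.
Proof.
move=> x0 f0; have x3 : 0 < x / 3 by rewrite divr_gt0.
apply: (@ge0_FTC_exhaust _ f F _ _ _ l (F x) _ _ _ (bigcup_0x x0)).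
- by move=> n; exact: uv0x.
- exact: mono_u.
- exact: mono_v.
- by move=> y /d0x; exact: dF.
- by move=> y /d0x; exact: cf.
- exact: F0'.
- exact: Fcont.
- by move=> y /d0x; exact: f0.
Qed.

Section toy.
Variable L : R.
Hypothesis Fy : F x @[x --> +oo] --> L.

Let uv n : (n.+1%:R)^-1 < n.+2%:R :> R.
Proof. by apply: (@le_lt_trans _ _ 1); rewrite ?invf_le1 ?ler1n ?ltr1n. Qed.

Let d0y y : `]0%R, +oo[%classic y -> 0 < y.
Proof. by move=> /=; rewrite in_itv/= andbT. Qed.

Let vy : F (n.+2%:R) @[n --> \oo] --> L.
Proof. by have := cvgy_natr 0 Fy; under eq_fun do rewrite add0r. Qed.

Lemma ge0_FTC0y : (forall y : R, 0 < y -> 0 <= f y) ->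
  (\int[mu]_(y in `]0%R, +oo[) (f y)%:E = (L - l)%:E)%E.
Proof.
move=> f0; apply: (@ge0_FTC_exhaust _ f F _ _ _ l L uv _ _ bigcup_0y).
- exact: invS_mono.
- by move=> n m nm; rewrite ler_nat.
- by move=> y /d0y; exact: dF.
- by move=> y /d0y; exact: cf.
- exact: cvg0_invn.
- exact: vy.
- by move=> y /d0y; exact: f0.
Qed.

Lemma integrable_FTC0y : mu.-integrable `]0%R, +oo[ (EFin \o f) ->
  (\int[mu]_(y in `]0%R, +oo[) (f y)%:E = (L - l)%:E)%E.
Proof.
move=> fi; apply: (@integrable_FTC_exhaust _ f F _ _ _ l L uv _ _ bigcup_0y).
- exact: invS_mono.
- by move=> n m nm; rewrite ler_nat.
- by move=> y /d0y; exact: dF.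
- by move=> y /d0y; exact: cf.
- exact: cvg0_invn.
- exact: vy.
- exact: fi.
Qed.

End toy.
End from0.

Lemma ge0_FTCxy x L : 0 < x -> F y @[y --> +oo] --> L ->
  (forall y : R, 0 < y -> 0 <= f y) ->
  (\int[mu]_(y in `]x, +oo[) (f y)%:E = (L - F x)%:E)%E.
Proof.
move=> x0 Fy f0.
have dxy y : `]x, +oo[%classic y -> 0 < y.
  by move=> /=; rewrite in_itv/= andbT => /(lt_trans x0).
apply: (@ge0_FTC_exhaust _ f F _ _ _ (F x) L _ _ _ (bigcup_xy x)).
- move=> n; rewrite ltrD2l; apply: (@le_lt_trans _ _ 1); rewrite ?invf_le1 ?ler1n ?ltr1n//.
- by move=> n m nm; rewrite lerD2l; exact: invS_mono.
- by move=> n m nm; rewrite lerD2l ler_nat.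
- by move=> y /dxy; exact: dF.
- by move=> y /dxy; exact: cf.
- by have := Fcont 1 x0; under eq_fun do rewrite mul1r.
- exact: cvgy_natr.
- by move=> y /dxy; exact: f0.
Qed.

End ftc_halfline.

(** * Integrals as functions of one endpoint *)

Section primitives.
Context {R : realType}.
Local Notation mu := (@lebesgue_measure R).
Implicit Types x y z : R.
Variable q : R -> R.
Hypothesis cq : forall x : R, 0 < x -> {for x, continuous q}.

Lemma measurable_pos : measurable_fun `]0 : R, +oo[%classic q.
Proof.
apply: open_continuous_measurable_fun => // x.
by rewrite inE/= in_itv/= andbT; exact: cq.
Qed.

Lemma is_derive_int_low x : 0 < x ->
  (forall u : R, mu.-integrable `]0%R, u[ (EFin \o q)) ->
  is_derive x 1 (fun y => \int[mu]_(t in `]0%R, y[) q t) (q x).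
Proof.
move=> x0 iq.
have mq (u : R) : measurable_fun `]0, u]%classic q.
  by apply: measurable_funS measurable_pos => //; exact: subset_itvl.
have iq' u : mu.-integrable `]0%R, u] (EFin \o q).
  apply: (integrableS _ _ _ (iq (u + 1))) => //.
  by apply: subset_itvl; rewrite bnd_simp ltrDl.
have [] := @continuous_FTC1 R q (BRight 0) x (x + 1) _ (iq' _) _ (cq x0).
- by rewrite ltrDl.
- exact: x0.
move=> dq qE; apply: (@near_is_derive1 _ (fun y => \int[mu]_(t in `]0%R, y]) q t)).
  by near=> y; rewrite Rintegral_itv_bndo_bndc.
by rewrite -qE; exact: derivable_is_derive1.
Unshelve. all: by end_near. Qed.

Lemma Rintegral_split_pos x : 0 < x -> mu.-integrable `]0%R, +oo[ (EFin \o q) ->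
  \int[mu]_(t in `]0%R, +oo[) q t =
  \int[mu]_(t in `]0%R, x[) q t + \int[mu]_(t in `]x, +oo[) q t.
Proof.
move=> x0 iq.
have xE : `]0, +oo[ = `]0, x] `|` `]x, +oo[ :> set R.
  by rewrite -itv_bndbnd_setU ?bnd_simp ?ltW.
rewrite xE Rintegral_setU//; last 2 first.
- by rewrite -xE.
- apply/disj_setPS => z /= []; rewrite !in_itv/= andbT => /andP[_ zy].
  by rewrite ltNge zy.
rewrite [in RHS]Rintegral_itv_bndo_bndc//.
by apply: (integrableS _ _ _ iq) => //; exact: subset_itvl.
Qed.

(** Near x the upper integral is the total integral minus the lower one. *)
Lemma is_derive_int_up x : 0 < x ->
  mu.-integrable `]0%R, +oo[ (EFin \o q) ->
  is_derive x 1 (fun y => \int[mu]_(t in `]y, +oo[) q t) (- q x).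
Proof.
move=> x0 iq.
have iq0 (u : R) : mu.-integrable `]0%R, u[ (EFin \o q).
  by apply: (integrableS _ _ _ iq) => //; exact: subset_itvl.
apply: (@near_is_derive1 _ (fun y => \int[mu]_(t in `]0%R, +oo[) q t -
   \int[mu]_(t in `]0%R, y[) q t)); last first.
  apply: (is_derive1_eq (is_derive1B (is_derive1_cst _ _) (is_derive_int_low x0 iq0))).
  by rewrite sub0r.
near=> y; have y0 : 0 < y by near: y; exact: near_pos.
by rewrite (Rintegral_split_pos y0 iq) addrAC subrr add0r.
Unshelve. all: by end_near. Qed.

End primitives.

(** * The Gamma density *)

Section pow_exp.
Context {R : realType}.
Local Notation mu := (@lebesgue_measure R).
Implicit Types (a b c x y : R) (f g : R -> R).

(** The exponential of (1 + x) / b dominates its Taylor term of order n + 1. The factor [expR b^-1]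
    pays for the passage from x to 1 + x, and the extra factor 1 + x >= 1 is dropped. *)
Lemma pow_exp_bound (n : nat) b : 0 < b ->
  exists2 K, 0 < K & forall x, 0 <= x -> (1 + x) ^+ n * expR (- x / b) <= K.
Proof.
move=> b0; exists (b ^+ n.+1 * n.+1`!%:R * expR b^-1).
  by rewrite !mulr_gt0 ?exprn_gt0 ?expR_gt0// ltr0n fact_gt0.
move=> x x0; have x1 : 0 < 1 + x by rewrite ltr_pwDl.
have h : ((1 + x) / b) ^+ n.+1 / (n.+1)`!%:R <= expR ((1 + x) / b).
  apply: le_trans (expR_ge1Dxn n _); first by rewrite lerDr.
  by rewrite divr_ge0// ltW.
have -> : - x / b = b^-1 - (1 + x) / b by field; rewrite gt_eqF.
rewrite expRD expRN mulrA ler_pdivrMr ?expR_gt0//.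
have f0 : 0 < (n.+1)`!%:R :> R by rewrite ltr0n fact_gt0.
rewrite -[leRHS]mulrA [expR b^-1 * _]mulrC mulrA ler_pM2r ?expR_gt0// [leRHS]mulrC.
apply: (@le_trans _ _ (expR ((1 + x) / b) * (b ^+ n.+1 * (n.+1)`!%:R))).
  rewrite mulrA -ler_pdivrMr// -ler_pdivrMr ?exprn_gt0//.
  apply: le_trans h; rewrite expr_div_n mulrAC ler_pM2r ?invr_gt0//.
  rewrite ler_pM2r ?invr_gt0 ?exprn_gt0// exprS ler_peMl ?exprn_ge0 ?lerDl ?(ltW x1)//.
by rewrite mulrC.
Qed.

Lemma cvgy0_bound f K : (forall x, 1 <= x -> (1 + x) * `|f x| <= K) ->
  f x @[x --> +oo] --> 0.
Proof.
move=> h; apply/cvgr0Pnorm_le => e e0; near=> x.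
have x1 : 1 <= x by near: x; apply: nbhs_pinfty_ge; rewrite num_real.
have x0 : 0 < 1 + x by rewrite ltr_pwDl// (le_trans _ x1).
rewrite -(ler_pM2l x0); apply: (le_trans (h _ x1)).
rewrite -ler_pdivrMr//; apply: (@le_trans _ _ x); last by rewrite lerDr.
by near: x; apply: nbhs_pinfty_ge; rewrite num_real.
Unshelve. all: by end_near. Qed.

Lemma is_derive_powR_pos c x : 0 < x -> is_derive x 1 (fun y => y `^ c) (c * x `^ (c - 1)).
Proof. by move=> x0; exact: is_derive1_powR. Qed.

(* The primitive [(x / (1 + x)) ^ c] of [c x^(c-1) / (1+x)^(c+1)] is bounded,
   which gives integrability at both ends at once. *)
Lemma gamma_kernel_dominated c b : 0 < c -> 0 < b ->
  exists2 K, 0 < K & forall x, 0 < x ->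
    x `^ (c - 1) * expR (- x / b) <= K * (c * (x / (1 + x)) `^ (c - 1) * (1 + x) ^- 2).
Proof.
(* Once x^(c - 1) is cancelled, what remains is a bound on (1 + x)^(c + 1) e^(-x / b), so any
   integer n >= c + 1 serves. *)
move=> c0 b0; have [n hn] := lt_bound_nat (c + 1).
have [K K0 hK] := pow_exp_bound n b0.
exists (K / c); first by rewrite divr_gt0.
move=> x x0; have x1 : 0 < 1 + x by rewrite addr_gt0.
have -> : (x / (1 + x)) `^ (c - 1) = x `^ (c - 1) / (1 + x) `^ (c - 1).
  rewrite powRM ?invr_ge0 ?ltW// -[(1 + x)^-1]powR_inv1 ?ltW// -powRrM mulN1r.
  by rewrite powRN.
have -> : K / c * (c * (x `^ (c - 1) / (1 + x) `^ (c - 1)) / (1 + x) ^+ 2) =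
   x `^ (c - 1) * (K / ((1 + x) `^ (c - 1) * (1 + x) ^+ 2)).
  by field; rewrite !gt_eqF// powR_gt0.
rewrite ler_pM2l ?powR_gt0//.
have -> : (1 + x) `^ (c - 1) * (1 + x) ^+ 2 = (1 + x) `^ (c + 1).
  rewrite -powR_mulrn ?ltW// -powRD; last by rewrite (gt_eqF x1) implybT.
  by congr (_ `^ _); ring.
rewrite ler_pdivlMr ?powR_gt0// mulrC; apply: le_trans (hK x (ltW x0)).
rewrite ler_pM2r ?expR_gt0// -powR_mulrn ?(ltW x1)//.
by apply: ler_powR => //; rewrite lerDl ltW.
Qed.

Lemma is_derive_dominating c x : 0 < x ->
  is_derive x 1 (fun y => (y / (1 + y)) `^ c) (c * (x / (1 + x)) `^ (c - 1) * (1 + x) ^- 2).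
Proof.
move=> x0; have x1 : 0 < 1 + x by rewrite addr_gt0.
have d1 : is_derive x 1 (fun y => y / (1 + y)) ((1 + x) ^- 2).
  apply: (is_derive1_eq (is_derive1M (is_derive1_id x) (is_derive1V _
    (is_derive1D (is_derive1_cst x 1) (is_derive1_id x))))); first by rewrite gt_eqF.
  by field; rewrite gt_eqF.
by apply: (is_derive1_chain (is_derive_powR_pos c _) d1); rewrite divr_gt0.
Qed.

Lemma cvg0_dominating c : 0 < c -> (x / (1 + x)) `^ c @[x --> (0 : R)^'+] --> 0.
Proof.
move=> c0; apply/cvg_at_rightP => u [u0 ul].
have := powR_cvg0 c0; move/cvg_at_rightP; apply; split.
  by move=> n; rewrite divr_gt0// addr_gt0.
rewrite -(mul0r (1 + 0)^-1); apply: cvgM => //.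
apply: cvgV; first by rewrite addr0 oner_neq0.
by apply: cvgD => //; exact: cvg_cst.
Qed.

Lemma cvgy_dominating c : (x / (1 + x)) `^ c @[x --> +oo] --> (1 : R).
Proof.
have h : (x / (1 + x)) @[x --> +oo] --> (1 : R).
  have -> : (fun x => x / (1 + x)) = (fun x => 1 - (1 - x / (1 + x))) by apply/funext=> x; ring.
  rewrite -[X in _ --> X]subr0; apply: cvgB; first exact: cvg_cst.
  apply: (@cvgy0_bound _ 1) => x x1; have x0 : 0 < 1 + x by rewrite addr_gt0// (lt_le_trans _ x1).
  have -> : 1 - x / (1 + x) = (1 + x)^-1 by field; rewrite gt_eqF.
  by rewrite ger0_norm ?invr_ge0 ?(ltW x0)// divff ?(gt_eqF x0).
apply: (@cvg_comp _ _ _ (fun x => x / (1 + x)) (fun y => y `^ c) _ (nbhs (1 : R))) => //.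
have := is_derive1_continuous (@is_derive_powR_pos c 1 ltr01).
by rewrite /prop_for /continuous_at/= powR1.
Qed.

Lemma continuous_dominating_deriv c x : 0 < x ->
  {for x, continuous (fun y => c * (y / (1 + y)) `^ (c - 1) * (1 + y) ^- 2)}.
Proof.
move=> x0; have x1 : 0 < 1 + x by rewrite addr_gt0.
have d1 := is_derive1_sqr (is_derive1D (is_derive1_cst x 1) (is_derive1_id x)).
have d2 := @is_derive1V _ (fun y => (1 + y) ^+ 2) x _ (lt0r_neq0 (exprn_gt0 2 x1)) d1.
exact: (is_derive1_continuous (is_derive1M
  (is_derive1M (is_derive1_cst x c) (is_derive_dominating (c - 1) x0)) d2)).
Qed.

Lemma integral_dominating c : 0 < c ->
  (\int[mu]_(x in `]0%R, +oo[) (c * (x / (1 + x)) `^ (c - 1) * (1 + x) ^- 2)%:E = 1)%E.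
Proof.
move=> c0; rewrite (@ge0_FTC0y _ _ (fun y => (y / (1 + y)) `^ c) _ _ 0 _ 1) ?subr0//.
- exact: is_derive_dominating.
- exact: continuous_dominating_deriv.
- exact: cvg0_dominating.
- exact: cvgy_dominating.
- by move=> x x0; rewrite mulr_ge0 ?invr_ge0 ?exprn_ge0 ?mulr_ge0 ?powR_ge0 ?addr_ge0 ?ltW.
Qed.

Lemma continuous_gamma_kernel c b x : 0 < x ->
  {for x, continuous (fun y => y `^ c * expR (- y / b))}.
Proof.
move=> x0; exact: (is_derive1_continuous (is_derive1M (is_derive_powR_pos c x0) (is_derive1_exp
  (is_derive1M (is_derive1N (is_derive1_id x)) (is_derive1_cst x b^-1))))).
Qed.

Lemma integrable_gamma_kernel c b : 0 < c -> 0 < b ->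
  mu.-integrable `]0%R, +oo[ (EFin \o (fun x => x `^ (c - 1) * expR (- x / b))).
Proof.
move=> c0 b0; have [K K0 hK] := gamma_kernel_dominated c0 b0.
have mD := @measurable_pos _ _ (@continuous_dominating_deriv c).
have iD : mu.-integrable `]0%R, +oo[
    (fun x => (K%:E * (EFin \o (fun x => (c * (x / (1 + x)) `^ (c - 1) * (1 + x) ^- 2)%R)) x)%E).
  apply: integrableZl => //; apply/integrableP; split; first exact/measurable_EFinP.
  under eq_integral.
    move=> x; rewrite inE/= in_itv/= andbT => x0.
    rewrite ger0_norm; last by rewrite mulr_ge0 ?invr_ge0 ?exprn_ge0 ?mulr_ge0 ?powR_ge0 ?addr_ge0 ?ltW.
    over.
  by rewrite integral_dominating// ltry.
apply: le_integrable iD => //.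
- by apply/measurable_EFinP; apply: measurable_pos; exact: continuous_gamma_kernel.
- move=> x /=; rewrite in_itv/= andbT => x0.
  rewrite lee_fin ger0_norm ?mulr_ge0 ?powR_ge0 ?expR_ge0//.
  by apply: (le_trans (hK x x0)); exact: ler_norm.
Qed.

End pow_exp.

Section gamma_density.
Context {R : realType}.
Local Notation mu := (@lebesgue_measure R).
Implicit Types (a b c x y : R) (f g : R -> R).

Lemma Gamma_fun_gt0 a : 0 < a -> 0 < Gamma_fun a.
Proof.
move=> a0.
have i1 : mu.-integrable `]0%R, +oo[ (EFin \o (fun x => x `^ (a - 1) * expR (- x))).
  have := @integrable_gamma_kernel R _ _ a0 ltr01.
  by under [X in _.-integrable _ (_ \o X)]eq_fun do rewrite divr1.
rewrite /Gamma_fun /Rintegral fine_gt0//; apply/andP; split; last first.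
  by rewrite ltey_eq integrable_fin_num.
have sub12 : `[1 : R, 2]%classic `<=` `]0 : R, +oo[%classic.
  by move=> x /=; rewrite !in_itv/= andbT => /andP[x1 _]; exact: lt_le_trans x1.
have m0y : measurable_fun `]0 : R, +oo[%classic (fun x => (x `^ (a - 1) * expR (- x))%:E).
  by case/integrableP : i1.
(* On [1, 2] the integrand is at least e^(-2) / 2, because x^a >= 1, 1 / x >= 1 / 2 and e^(-x) >=
   e^(-2). *)
apply: (@lt_le_trans _ _ (\int[mu]_(x in `[1%R, 2%R]) (2^-1 * expR (- 2))%:E)%E).
  rewrite integral_cst//= lebesgue_measure_itv/= lte_fin ltr1n -EFinD -EFinM lte_fin.
  have -> : (2 : R) - 1 = 1 by ring.
  by rewrite mulr1 mulr_gt0 ?invr_gt0 ?expR_gt0.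
apply: (@le_trans _ _ (\int[mu]_(x in `[1%R, 2%R]) (x `^ (a - 1) * expR (- x))%:E)%E).
- apply: ge0_le_integral => //.
  + exact: (measurable_funS _ sub12).
  + move=> x /=; rewrite in_itv/= => /andP[x1 x2]; have x0 : 0 < x by exact: lt_le_trans x1.
    rewrite lee_fin; apply: ler_pM; rewrite ?invr_ge0 ?expR_ge0 ?ler_expR ?lerN2//.
    rewrite powRD; last by rewrite (gt_eqF x0) implybT.
    rewrite powR_inv1 ?(ltW x0)// -[leLHS]mul1r; apply: ler_pM => //.
      by rewrite -(powRr0 x); apply: ler_powR => //; exact: ltW.
    by rewrite lef_pV2 ?posrE.
- apply: ge0_subset_integral => //.
  by move=> x _; rewrite lee_fin mulr_ge0 ?powR_ge0 ?expR_ge0.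
Qed.

Section scale.
Variables a b : R.
Hypotheses (a0 : 0 < a) (b0 : 0 < b).
Local Notation C := ((Gamma_fun a * b `^ a)^-1).
Local Notation p := (gamma_pdf a b).

Let C0 : 0 < C.
Proof. by rewrite invr_gt0 mulr_gt0 ?Gamma_fun_gt0 ?powR_gt0. Qed.

Lemma gamma_pdfE x : 0 < x -> p x = C * (x `^ (a - 1) * expR (- x / b)).
Proof. by move=> x0; rewrite /gamma_pdf x0 mulrA. Qed.

Lemma mul_gamma_pdf x : 0 < x -> x * p x = C * (x `^ a * expR (- x / b)).
Proof.
move=> x0; rewrite gamma_pdfE// mulrCA [x * _]mulrA.
by rewrite mulr_powRB1 ?ltW.
Qed.

Lemma gamma_pdf_gt0 x : 0 < x -> 0 < p x.
Proof. by move=> x0; rewrite gamma_pdfE// !mulr_gt0 ?powR_gt0 ?expR_gt0. Qed.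

Lemma gamma_pdf_ge0 x : 0 <= p x.
Proof.
by have [/gamma_pdf_gt0/ltW//|x0] := ltP 0 x; rewrite /gamma_pdf ltNge x0.
Qed.

(** This first-order equation characterises the Gamma law: it makes the derivative of x p f equal to
    p / b times the Stein operator b x f' + (a b - x) f. *)
Lemma is_derive_mul_gamma_pdf x : 0 < x ->
  is_derive x 1 (fun y => y * p y) ((a - x / b) * p x).
Proof.
move=> x0; apply: (@near_is_derive1 _ (fun y => C * (y `^ a * expR (- y / b)))).
  by near=> y; rewrite mul_gamma_pdf//; near: y; exact: near_pos.
apply: (is_derive1_eq (is_derive1M (is_derive1_cst x C) (is_derive1M
  (is_derive_powR_pos a x0) (is_derive1_exp
  (is_derive1M (is_derive1N (is_derive1_id x)) (is_derive1_cst x b^-1)))))).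
rewrite gamma_pdfE// -(@mulr_powRB1 _ x a) ?(ltW x0)//; ring.
Unshelve. all: by end_near. Qed.

Lemma continuous_gamma_pdf x : 0 < x -> {for x, continuous p}.
Proof.
move=> x0.
have d : is_derive x 1 (fun y => C * (y `^ (a - 1) * expR (- y / b))) _ :=
  is_derive1M (is_derive1_cst x C) (is_derive1M
  (is_derive_powR_pos (a - 1) x0) (is_derive1_exp
  (is_derive1M (is_derive1N (is_derive1_id x)) (is_derive1_cst x b^-1)))).
apply: is_derive1_continuous; apply: near_is_derive1 d.
by near=> y; rewrite gamma_pdfE//; near: y; exact: near_pos.
Unshelve. all: by end_near. Qed.

Lemma integrable_poly_gamma_pdf n :
  mu.-integrable `]0%R, +oo[ (EFin \o (fun x => (1 + x) ^+ n * p x)).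
Proof.
(* Half of the exponential absorbs the polynomial; the other half, of scale 2 b, stays
   integrable. *)
have b20 : 0 < b * 2 by rewrite mulr_gt0.
have [K K0 hK] := @pow_exp_bound R n _ b20.
have i2 := @integrableZl _ _ _ mu `]0%R, +oo[%classic (measurable_itv _) (C * K) _
  (@integrable_gamma_kernel R _ _ a0 b20).
apply: le_integrable i2 => //.
- apply/measurable_EFinP; apply: measurable_pos => x x0.
  apply: (@continuousM _ _ (fun x => (1 + x) ^+ n) p); last exact: continuous_gamma_pdf.
  apply: (@continuous_comp _ _ _ (fun x => 1 + x) (fun x => x ^+ n)).
    exact: (is_derive1_continuous (is_derive1D (is_derive1_cst x 1) (is_derive1_id x))).
  exact: exprn_continuous.
- move=> x /=; rewrite in_itv/= andbT => x0.
  have x1 : 0 < 1 + x by rewrite addr_gt0.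
  rewrite lee_fin !ger0_norm ?mulr_ge0 ?exprn_ge0 ?gamma_pdf_ge0 ?powR_ge0 ?expR_ge0 ?(ltW x1) ?(ltW K0) ?(ltW C0)//.
  rewrite gamma_pdfE// mulrCA -mulrA ler_pM2l// [(1 + x) ^+ n * _]mulrCA [leRHS]mulrCA.
  rewrite ler_pM2l ?powR_gt0//.
  have -> : - x / b = - x / (b * 2) + - x / (b * 2) by field; rewrite gt_eqF.
  rewrite expRD mulrA ler_pM2r ?expR_gt0//; exact: hK (ltW x0).
Qed.

Lemma gamma_pdf_bound n : exists2 K, 0 < K &
  forall x, 0 < x -> (1 + x) ^+ n * (x * p x) <= K * expR (- x / (b * 2)).
Proof.
(* An integer m >= a turns x^a into the power (1 + x)^m, after which the exponential is split into
   halves as before. *)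
have [m hm] := lt_bound_nat a.
have b20 : 0 < b * 2 by rewrite mulr_gt0.
have [K K0 hK] := @pow_exp_bound R (n + m) _ b20.
exists (C * K); first by rewrite mulr_gt0.
move=> x x0; have x1 : 0 < 1 + x by rewrite addr_gt0.
rewrite mul_gamma_pdf// mulrCA -mulrA ler_pM2l//.
have -> : - x / b = - x / (b * 2) + - x / (b * 2) by field; rewrite gt_eqF.
rewrite expRD !mulrA ler_pM2r ?expR_gt0//; apply: le_trans (hK x (ltW x0)).
rewrite ler_pM2r ?expR_gt0// exprD ler_pM2l ?exprn_gt0//.
apply: (@le_trans _ _ ((1 + x) `^ a)).
  by apply: ge0_ler_powR; rewrite ?nnegrE ?(ltW a0) ?(ltW x0) ?(ltW x1) ?lerDr.
by rewrite -powR_mulrn ?(ltW x1)//; apply: ler_powR => //; rewrite lerDl ltW.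
Qed.

Lemma cvg0_mul_gamma_pdf : x * p x @[x --> 0^'+] --> 0.
Proof.
have h : C * (x `^ a * expR (- x / b)) @[x --> 0^'+] --> 0.
  rewrite [X in _ --> X](_ : 0 = C * (0 * expR (- 0 / b))); last by rewrite mul0r mulr0.
  apply: cvgM; first exact: cvg_cst.
  apply: cvgM; first exact: powR_cvg0.
  apply: cvg_at_right_filter; exact: (is_derive1_continuous (is_derive1_exp
    (is_derive1M (is_derive1N (is_derive1_id 0)) (is_derive1_cst 0 b^-1)))).
apply: cvg_trans h; apply: near_eq_cvg; near=> x; rewrite mul_gamma_pdf//.
Unshelve. all: by end_near. Qed.

End scale.
End gamma_density.

(** * Tails of the Gamma law of scale 1 and their iterated integrals *)

Section rapid_decay.
Context {R : realType}.
Implicit Types (f g : R -> R).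

(** Decay faster than every power at infinity, with boundedness near 0. The class is stable under
    multiplication by polynomials, so the boundary values at +oo of all closed forms below are 0 at
    once. *)
Definition rapid f := forall n, exists K, forall x, 0 < x -> (1 + x) ^+ n * `|f x| <= K.

Lemma rapidD f g : rapid f -> rapid g -> rapid (fun x => f x + g x).
Proof.
move=> hf hg n; have [K hK] := hf n; have [L hL] := hg n; exists (K + L) => x x0.
apply: le_trans (lerD (hK x x0) (hL x x0)).
by rewrite -mulrDr ler_pM2l ?exprn_gt0 ?addr_gt0// ler_normD.
Qed.

Lemma rapidN f : rapid f -> rapid (fun x => - f x).
Proof. by move=> hf n; have [K hK] := hf n; exists K => x x0; rewrite normrN hK. Qed.

Lemma rapidB f g : rapid f -> rapid g -> rapid (fun x => f x - g x).
Proof. by move=> hf hg; apply: rapidD => //; exact: rapidN. Qed.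

Lemma rapidX f : rapid f -> rapid (fun x => x * f x).
Proof.
move=> hf n; have [K hK] := hf n.+1; exists K => x x0; apply: le_trans (hK x x0).
rewrite normrM exprSr -mulrA ler_pM2l ?exprn_gt0 ?addr_gt0//.
by rewrite ler_wpM2r// gtr0_norm// lerDr.
Qed.

Lemma rapidZ c f : rapid f -> rapid (fun x => c * f x).
Proof.
move=> hf n; have [K hK] := hf n; exists (`|c| * K) => x x0.
by rewrite normrM mulrCA ler_wpM2l// hK.
Qed.

Lemma rapid_cvgy f : rapid f -> f x @[x --> +oo] --> 0.
Proof.
move=> hf; have [K hK] := hf 1%N; apply: (@cvgy0_bound _ _ K) => x x1.
by have := hK x (lt_le_trans ltr01 x1); rewrite expr1.
Qed.

Lemma rapid_ext f g : (forall x, 0 < x -> f x = g x) -> rapid f -> rapid g.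
Proof. by move=> fg hf n; have [K hK] := hf n; exists K => x x0; rewrite -fg// hK. Qed.

End rapid_decay.

Section standard_gamma.
Context {R : realType}.
Local Notation mu := (@lebesgue_measure R).
Variable a : R.
Hypothesis a0 : 0 < a.
Implicit Types x y z : R.
Local Notation p := (gamma_pdf a 1).
Local Notation w := (fun x => x * p x).
Local Notation P := (Plow a).
Local Notation P' := (Pup a).

Lemma integrable_gamma_pdf1 : mu.-integrable `]0%R, +oo[ (EFin \o p).
Proof.
have := @integrable_poly_gamma_pdf R a 1 a0 ltr01 0.
by under [X in _.-integrable _ (_ \o X)]eq_fun do rewrite expr0 mul1r.
Qed.

Lemma Rintegral_gamma_pdf1 : \int[mu]_(x in `]0%R, +oo[) p x = 1.
Proof.
transitivity (\int[mu]_(x in `]0%R, +oo[) ((Gamma_fun a)^-1 * (x `^ (a - 1) * expR (- x)))); last first.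
  rewrite RintegralZl//; last first.
    have := @integrable_gamma_kernel R _ _ a0 ltr01.
    by under [X in _.-integrable _ (_ \o X)]eq_fun do rewrite divr1.
  by rewrite mulVf// gt_eqF// Gamma_fun_gt0.
apply: eq_Rintegral => x; rewrite inE/= in_itv/= andbT => x0.
by rewrite gamma_pdfE// powR1 mulr1 divr1.
Qed.

Lemma is_derive_w x : 0 < x -> is_derive x 1 w ((a - x) * p x).
Proof. by move=> x0; have := @is_derive_mul_gamma_pdf R a 1 a0 x x0; rewrite divr1. Qed.

Lemma w_gt0 x : 0 < x -> 0 < x * p x.
Proof. by move=> x0; rewrite mulr_gt0// gamma_pdf_gt0. Qed.

Lemma rapid_w : rapid w.
Proof.
move=> n; have [K K0 hK] := gamma_pdf_bound a0 (@ltr01 R) n; exists K => x x0.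
rewrite gtr0_norm ?w_gt0//; apply: (le_trans (hK x x0)).
rewrite ger_pMr//; rewrite -[leRHS]expR0 ler_expR mulNr oppr_le0 divr_ge0 ?ltW//.
Qed.

Lemma Plow_Pup x : 0 < x -> P x + P' x = 1.
Proof.
move=> x0; rewrite -Rintegral_gamma_pdf1 (@Rintegral_split_pos _ _ _ x0)//.
exact: integrable_gamma_pdf1.
Qed.

Lemma Plow_ge0 x : 0 <= P x.
Proof. by apply: Rintegral_ge0 => // y _; exact: gamma_pdf_ge0. Qed.

Lemma Pup_ge0 x : 0 <= P' x.
Proof. by apply: Rintegral_ge0 => // y _; exact: gamma_pdf_ge0. Qed.

Lemma Plow_le1 x : 0 < x -> P x <= 1.
Proof. by move=> x0; rewrite -(Plow_Pup x0) lerDl Pup_ge0. Qed.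

Lemma Pup_le1 x : 0 < x -> P' x <= 1.
Proof. by move=> x0; rewrite -(Plow_Pup x0) lerDr Plow_ge0. Qed.

Lemma is_derive_Plow x : 0 < x -> is_derive x 1 P (p x).
Proof.
move=> x0; apply: is_derive_int_low => //.
  by move=> y; exact: continuous_gamma_pdf.
move=> u; apply: (integrableS _ _ _ integrable_gamma_pdf1) => //.
exact: subset_itvl.
Qed.

Lemma is_derive_Pup x : 0 < x -> is_derive x 1 P' (- p x).
Proof.
move=> x0; apply: is_derive_int_up => //.
  by move=> y; exact: continuous_gamma_pdf.
exact: integrable_gamma_pdf1.
Qed.

(** For a < 1 the density is unbounded at 0, but its dominating function has the primitive (x / (1 +
    x))^a, which tends to 0 there. *)
Lemma cvg0_Plow : P x @[x --> 0^'+] --> 0.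
Proof.
have [K K0 hK] := @gamma_kernel_dominated R _ _ a0 ltr01.
have C0 : 0 < (Gamma_fun a * 1 `^ a)^-1 by rewrite powR1 mulr1 invr_gt0 Gamma_fun_gt0.
pose k := (Gamma_fun a * 1 `^ a)^-1 * K.
have k0 : 0 < k by rewrite mulr_gt0.
have d0 y : 0 < y -> 0 <= a * (y / (1 + y)) `^ (a - 1) * (1 + y) ^- 2.
  by move=> y0; rewrite mulr_ge0 ?invr_ge0 ?exprn_ge0 ?mulr_ge0 ?powR_ge0 ?addr_ge0 ?ltW.
have le x : 0 < x -> P x <= k * (x / (1 + x)) `^ a.
  move=> x0.
  have I := ge0_FTC0x (@is_derive_dominating R a) (@continuous_dominating_deriv R a)
     (cvg0_dominating a0) x0 d0.
  have mdom := @measurable_pos _ _ (@continuous_dominating_deriv R a).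
  have s0x : `]0, x[%classic `<=` `]0 : R, +oo[%classic by exact: subset_itvl.
  have idom : mu.-integrable `]0%R, x[ (EFin \o (fun y => a * (y / (1 + y)) `^ (a - 1) * (1 + y) ^- 2)).
    apply/integrableP; split; first by apply/measurable_EFinP; exact: measurable_funS mdom.
    under eq_integral.
      move=> y; rewrite inE/= in_itv/= => /andP[y0 _]; rewrite ger0_norm ?d0//.
      over.
    by rewrite I ltry.
  apply: (@le_trans _ _ (\int[mu]_(y in `]0%R, x[) (k * (a * (y / (1 + y)) `^ (a - 1) * (1 + y) ^- 2)))).
    apply: le_Rintegral => //.
    - by apply: (integrableS _ _ _ integrable_gamma_pdf1).
    - by apply: (@eq_integrable _ _ _ _ _ _ _ _ _ (@integrableZl _ _ _ mu _ (measurable_itv _) k _ idom)).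
    - move=> y /=; rewrite in_itv/= => /andP[y0 _].
      by rewrite gamma_pdfE// /k -mulrA ler_pM2l// hK.
  by rewrite RintegralZl// /Rintegral I/= subr0.
apply: (@squeeze_cvgr _ _ _ _ (fun=> 0) (fun x => k * (x / (1 + x)) `^ a)).
- by near=> x; rewrite Plow_ge0/= le//.
- exact: cvg_cst.
- rewrite -(mulr0 k); apply: cvgM; first exact: cvg_cst.
  by rewrite mulr0; exact: cvg0_dominating.
Unshelve. all: by end_near. Qed.

(** From 1 on, p(y) <= y p(y), which is at most a multiple of e^(-y / 2); this majorant is
    integrated explicitly. *)
Lemma Pup_exp_bound : exists2 K, 0 < K & forall x, 1 <= x -> P' x <= K * expR (- x / 2).
Proof.
have [K K0 hK] := gamma_pdf_bound a0 (@ltr01 R) 0.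
have d x : 0 < x -> is_derive x 1 (fun y => - 2 * K * expR (- y / 2)) (K * expR (- x / 2)).
  move=> x0; apply: (is_derive1_eq (is_derive1M (is_derive1_cst x (- 2 * K)) (is_derive1_exp
    (is_derive1M (is_derive1N (is_derive1_id x)) (is_derive1_cst x 2^-1))))).
  by field.
have c x : 0 < x -> {for x, continuous (fun y => K * expR (- y / 2))}.
  move=> x0; exact: (is_derive1_continuous (is_derive1M (is_derive1_cst x K) (is_derive1_exp
    (is_derive1M (is_derive1N (is_derive1_id x)) (is_derive1_cst x 2^-1))))).
have ly : - 2 * K * expR (- y / 2) @[y --> +oo] --> 0.
  have [L L0 hL] := @pow_exp_bound R 1 2 ltac:(by []).
  apply: (@cvgy0_bound _ _ (2 * K * L)) => x x1.
  rewrite normrM mulrCA normrM normrN !gtr0_norm ?expR_gt0// ler_pM2l ?mulr_gt0//.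
  by have := hL x (le_trans ler01 x1); rewrite expr1.
have nn x : 0 < x -> 0 <= K * expR (- x / 2) by rewrite mulr_ge0 ?expR_ge0 ?ltW.
exists (2 * K) => [|x x1]; first by rewrite mulr_gt0.
have x0 : 0 < x by exact: lt_le_trans x1.
have I := ge0_FTCxy d c x0 ly nn.
have sxy : `]x, +oo[%classic `<=` `]0 : R, +oo[%classic.
  by move=> y /=; rewrite !in_itv/= !andbT; exact: lt_trans.
have iI : mu.-integrable `]x, +oo[ (EFin \o (fun y => K * expR (- y / 2))).
  apply/integrableP; split.
    by apply/measurable_EFinP; apply: measurable_funS (measurable_pos c).
  under eq_integral.
    move=> y; rewrite inE/= in_itv/= andbT => xy; rewrite ger0_norm; last first.
      by rewrite nn// (lt_trans x0).
    over.
  by rewrite I ltry.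
apply: (@le_trans _ _ (\int[mu]_(y in `]x, +oo[) (K * expR (- y / 2)))).
  apply: le_Rintegral => //.
  - by apply: (integrableS _ _ _ integrable_gamma_pdf1).
  - move=> y /=; rewrite in_itv/= andbT => xy; have y0 : 0 < y by exact: lt_trans xy.
    have := hK y y0; rewrite expr0 !mul1r; apply: le_trans.
    by rewrite ler_peMl ?gamma_pdf_ge0// (le_trans x1)// ltW.
by rewrite /Rintegral I/= sub0r !mulNr opprK.
Qed.

Lemma rapid_Pup : rapid P'.
Proof.
have [K K0 hK] := Pup_exp_bound => n.
have [L L0 hL] := @pow_exp_bound R n 2 ltac:(by []).
exists (K * L + 2 ^+ n) => x x0; rewrite ger0_norm ?Pup_ge0//.
have [x1|x1] := leP 1 x.
  apply: (@le_trans _ _ (K * L)); last by rewrite lerDl exprn_ge0.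
  apply: (@le_trans _ _ (K * ((1 + x) ^+ n * expR (- x / 2)))).
    by rewrite mulrCA ler_pM2l ?exprn_gt0 ?addr_gt0 ?hK.
  by rewrite ler_pM2l// hL ?ltW.
apply: (@le_trans _ _ (2 ^+ n)); last by rewrite lerDr mulr_ge0 ?ltW.
rewrite -[leRHS]mulr1; apply: ler_pM; rewrite ?exprn_ge0 ?addr_ge0 ?Pup_ge0 ?Pup_le1 ?(ltW x0)//.
by apply: lerXn2r; rewrite ?nnegrE; lra.
Qed.

End standard_gamma.

Section iterated_tails.
Context {R : realType}.
Local Notation mu := (@lebesgue_measure R).
Variable a : R.
Hypothesis a0 : 0 < a.
Implicit Types x y z : R.
Local Notation p := (gamma_pdf a 1).
Local Notation w := (fun x => x * p x).
Local Notation P := (Plow a).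
Local Notation P' := (Pup a).

Lemma ge0_FTC0y_integrable (f F : R -> R) (l L : R) :
  (forall x, 0 < x -> is_derive x 1 F (f x)) ->
  (forall x, 0 < x -> {for x, continuous f}) ->
  F x @[x --> 0^'+] --> l -> F x @[x --> +oo] --> L ->
  (forall x, 0 < x -> 0 <= f x) ->
  mu.-integrable `]0%R, +oo[ (EFin \o f).
Proof.
move=> dF cf Fl FL f0; apply/integrableP; split.
  by apply/measurable_EFinP; exact: measurable_pos.
under eq_integral.
  move=> y; rewrite inE/= in_itv/= andbT => y0; rewrite ger0_norm ?f0//.
  over.
by rewrite (ge0_FTC0y dF cf Fl FL f0) ltry.
Qed.

Lemma cvg0_Pup : P' x @[x --> (0 : R)^'+] --> (1 : R).
Proof.
have h : 1 - P x @[x --> (0 : R)^'+] --> (1 : R).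
  by rewrite -[X in _ --> X]subr0; apply: cvgB; [exact: cvg_cst|exact: cvg0_Plow].
apply: cvg_trans h; apply: near_eq_cvg; near=> x.
by rewrite -(@Plow_Pup _ _ a0 x)// addrAC subrr add0r.
Unshelve. all: by end_near. Qed.

Lemma cvg0_id : x @[x --> (0 : R)^'+] --> (0 : R).
Proof. by apply: cvg_at_right_filter; exact: cvg_id. Qed.

Let cvg0_w : w x @[x --> 0^'+] --> 0.
Proof. exact: cvg0_mul_gamma_pdf. Qed.

(** First and second antiderivatives of a tail [T] with [T' = s p], found by integrating by parts
    with (x p)' = (a - x) p. The sign s = 1 stands for [Plow] and s = -1 for [Pup], so both tails
    share one computation. *)
Let closed1 (s : R) (T : R -> R) x := (x - a) * T x + s * (x * p x).
Let closed2 (s : R) (T : R -> R) x :=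
  (((x - a) * (x - a) + a) * T x + s * ((x - (a + 1)) * (x * p x))) / 2.

Let d_closed1 s T x : 0 < x -> is_derive x 1 T (s * p x) ->
  is_derive x 1 (closed1 s T) (T x).
Proof.
move=> x0 dT.
apply: (is_derive1_eq (is_derive1D (is_derive1M (is_derive1B (is_derive1_id x)
  (is_derive1_cst x a)) dT) (is_derive1M (is_derive1_cst x s) (is_derive_w a0 x0)))).
ring.
Qed.

Let d_closed2 s T x : 0 < x -> is_derive x 1 T (s * p x) ->
  is_derive x 1 (closed2 s T) (closed1 s T x).
Proof.
move=> x0 dT.
have dx c := is_derive1B (is_derive1_id x) (is_derive1_cst x c).
apply: (is_derive1_eq (is_derive1M (is_derive1D (is_derive1M (is_derive1D
  (is_derive1M (dx a) (dx a)) (is_derive1_cst x a)) dT)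
  (is_derive1M (is_derive1_cst x s) (is_derive1M (dx (a + 1)) (is_derive_w a0 x0))))
  (is_derive1_cst x 2^-1))).
by rewrite /closed1; field.
Qed.

Let cvg0_closed1 s T (t : R) : T x @[x --> 0^'+] --> t ->
  closed1 s T x @[x --> 0^'+] --> - a * t.
Proof.
move=> Tt; rewrite [X in _ --> X](_ : _ = (0 - a) * t + s * 0); last by rewrite mulr0 addr0 sub0r.
apply: cvgD; last by apply: cvgM; [exact: cvg_cst|exact: cvg0_w].
apply: cvgM => //; apply: cvgB; [exact: cvg0_id|exact: cvg_cst].
Qed.

Let cvg0_closed2 s T (t : R) : T x @[x --> 0^'+] --> t ->
  closed2 s T x @[x --> 0^'+] --> (a * a + a) * t / 2.
Proof.
move=> Tt.
have -> : (a * a + a) * t / 2 = (((0 - a) * (0 - a) + a) * t + s * ((0 - (a + 1)) * 0)) / 2 by field.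
have h (c : R) : x - c @[x --> (0 : R)^'+] --> 0 - c by apply: cvgB; [exact: cvg0_id|exact: cvg_cst].
apply: cvgM; last exact: cvg_cst.
apply: cvgD.
  by apply: cvgM => //; apply: cvgD; [exact: cvgM|exact: cvg_cst].
apply: cvgM; [exact: cvg_cst|apply: cvgM => //; exact: cvg0_w].
Qed.

Let rapid_closed1 s T : rapid T -> rapid (closed1 s T).
Proof.
move=> rT; apply: (@rapid_ext _ (fun x => x * T x - a * T x + s * (x * p x))).
  by move=> x _; rewrite /closed1; ring.
apply: rapidD; last by apply: rapidZ; exact: rapid_w.
by apply: rapidB; [exact: rapidX|exact: rapidZ].
Qed.

Let rapid_closed2 s T : rapid T -> rapid (closed2 s T).
Proof.
move=> rT; apply: (@rapid_ext _ (fun x => 2^-1 * ((x * (x * T x) - (2 * a) * (x * T x) +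
   (a * a + a) * T x) + s * (x * (x * p x) - (a + 1) * (x * p x))))).
  by move=> x _; rewrite /closed2; field.
have rw := rapid_w a0.
apply: rapidZ; apply: rapidD; last by apply: rapidZ; apply: rapidB; [exact: rapidX|exact: rapidZ].
apply: rapidD; last exact: rapidZ.
by apply: rapidB; [apply: rapidX; exact: rapidX|apply: rapidZ; exact: rapidX].
Qed.

Let dP x : 0 < x -> is_derive x 1 P (1 * p x).
Proof. by move=> x0; rewrite mul1r; exact: is_derive_Plow. Qed.

Let dP' x : 0 < x -> is_derive x 1 P' (-1 * p x).
Proof. by move=> x0; rewrite mulN1r; exact: is_derive_Pup. Qed.

Let cP x : 0 < x -> {for x, continuous P}.
Proof. by move=> /dP; exact: is_derive1_continuous. Qed.

Let cP' x : 0 < x -> {for x, continuous P'}.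
Proof. by move=> /dP'; exact: is_derive1_continuous. Qed.

Lemma Plow1E x : 0 < x -> Plow1 a x = (x - a) * P x + x * p x.
Proof.
move=> x0; rewrite /Plow1 /Rintegral.
rewrite (ge0_FTC0x (fun y yp => d_closed1 yp (dP yp)) cP (cvg0_closed1 1 (cvg0_Plow a0)) x0)//=.
  by rewrite /closed1; ring.
by move=> y _; exact: Plow_ge0.
Qed.

Let rapid_N (f : R -> R) : rapid f -> - f x @[x --> +oo] --> (0 : R).
Proof. by move=> h; rewrite -[X in _ --> X]oppr0; apply: cvgN; exact: rapid_cvgy. Qed.

Lemma Pup1E x : 0 < x -> Pup1 a x = (a - x) * P' x + x * p x.
Proof.
move=> x0; rewrite /Pup1 /Rintegral.
have y0 := rapid_cvgy (rapid_closed1 (-1) (rapid_Pup a0)).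
rewrite (ge0_FTCxy (fun y yp => d_closed1 yp (dP' yp)) cP' x0 y0)/=.
  by rewrite /closed1; ring.
by move=> y _; exact: Pup_ge0.
Qed.

Lemma integrable_Pup : mu.-integrable `]0%R, +oo[ (EFin \o P').
Proof.
have y0 := rapid_cvgy (rapid_closed1 (-1) (rapid_Pup a0)).
apply: (ge0_FTC0y_integrable (fun y yp => d_closed1 yp (dP' yp)) cP'
   (cvg0_closed1 (-1) cvg0_Pup) y0).
by move=> y _; exact: Pup_ge0.
Qed.

Lemma Plow1_ge0 x : 0 <= Plow1 a x.
Proof. by apply: Rintegral_ge0 => // y _; exact: Plow_ge0. Qed.

Lemma Pup1_ge0 x : 0 <= Pup1 a x.
Proof. by apply: Rintegral_ge0 => // y _; exact: Pup_ge0. Qed.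

Let closedlow x : 0 < x -> closed1 1 P x = Plow1 a x.
Proof. by move=> x0; rewrite Plow1E// /closed1 mul1r. Qed.

Let closedup x : 0 < x -> - closed1 (-1) P' x = Pup1 a x.
Proof. by move=> x0; rewrite Pup1E// /closed1; ring. Qed.

Lemma is_derive_Plow1 x : 0 < x -> is_derive x 1 (Plow1 a) (P x).
Proof.
move=> x0; apply: near_is_derive1 (d_closed1 x0 (dP x0)).
by near=> y; apply: closedlow; near: y; exact: near_pos.
Unshelve. all: by end_near. Qed.

Lemma is_derive_Pup1 x : 0 < x -> is_derive x 1 (Pup1 a) (- P' x).
Proof.
move=> x0; apply: near_is_derive1 (is_derive1N (d_closed1 x0 (dP' x0))).
by near=> y; apply: closedup; near: y; exact: near_pos.
Unshelve. all: by end_near. Qed.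

(** [Plow2] and [Pup2] are the two integrals that multiply the second derivatives in [C2]. *)
Definition Plow2 x := \int[mu]_(t in `]0%R, x[) Plow1 a t.
Definition Pup2 x := \int[mu]_(t in `]x, +oo[) Pup1 a t.

Let cP1 x : 0 < x -> {for x, continuous (Plow1 a)}.
Proof. by move=> /is_derive_Plow1; exact: is_derive1_continuous. Qed.

Let cP1' x : 0 < x -> {for x, continuous (Pup1 a)}.
Proof. by move=> /is_derive_Pup1; exact: is_derive1_continuous. Qed.

Let d2low x : 0 < x -> is_derive x 1 (closed2 1 P) (Plow1 a x).
Proof. by move=> x0; exact: (is_derive1_eq (d_closed2 x0 (dP x0)) (closedlow x0)). Qed.

Let d2up x : 0 < x -> is_derive x 1 (fun y => - closed2 (-1) P' y) (Pup1 a x).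
Proof. by move=> x0; exact: (is_derive1_eq (is_derive1N (d_closed2 x0 (dP' x0))) (closedup x0)). Qed.

Lemma Plow2E x : 0 < x ->
  Plow2 x = (((x - a) * (x - a) + a) * P x + (x - (a + 1)) * (x * p x)) / 2.
Proof.
move=> x0; rewrite /Plow2 /Rintegral.
rewrite (ge0_FTC0x d2low cP1 (cvg0_closed2 1 (cvg0_Plow a0)) x0)/=.
  by rewrite /closed2; field.
by move=> y _; exact: Plow1_ge0.
Qed.

Lemma Pup2E x : 0 < x ->
  Pup2 x = (((x - a) * (x - a) + a) * P' x - (x - (a + 1)) * (x * p x)) / 2.
Proof.
move=> x0; rewrite /Pup2 /Rintegral.
rewrite (ge0_FTCxy d2up cP1' x0 (rapid_N (rapid_closed2 (-1) (rapid_Pup a0))))/=.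
  by rewrite /closed2; field.
by move=> y _; exact: Pup1_ge0.
Qed.

Lemma integrable_Pup1 : mu.-integrable `]0%R, +oo[ (EFin \o (Pup1 a)).
Proof.
apply: (ge0_FTC0y_integrable d2up cP1' _ (rapid_N (rapid_closed2 (-1) (rapid_Pup a0)))).
- by apply: cvgN; exact: (cvg0_closed2 (-1) cvg0_Pup).
- by move=> y _; exact: Pup1_ge0.
Qed.

Lemma Plow1_le x : 0 < x -> Plow1 a x <= x.
Proof.
move=> x0; have dg y : 0 < y -> is_derive y 1 (fun y => y - Plow1 a y) (1 - P y).
  by move=> y0; exact: (is_derive1B (is_derive1_id y) (is_derive_Plow1 y0)).
rewrite -subr_ge0; apply: (ge0_of_cvg0 dg) => //.
  by move=> y y0; rewrite subr_ge0; exact: Plow_le1.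
have h : x - closed1 1 P x @[x --> 0^'+] --> 0.
  rewrite [X in _ --> X](_ : 0 = 0 - - a * 0); last by rewrite mulr0 subr0.
  by apply: cvgB; [exact: cvg0_id|exact: cvg0_closed1 (cvg0_Plow a0)].
apply: cvg_trans h; apply: near_eq_cvg; near=> y.
by rewrite closedlow.
Unshelve. all: by end_near. Qed.

(** For a Gamma variable X of scale 1, [Pup1] and [Plow1] at x are the means of the positive and
    negative parts of X - x, and X has mean a. *)
Lemma Pup1_Plow1 x : 0 < x -> Pup1 a x = Plow1 a x + (a - x).
Proof.
move=> x0; rewrite Pup1E// Plow1E//.
have -> : P' x = 1 - P x by rewrite -(Plow_Pup a0 x0); ring.
ring.
Qed.

Lemma Pup1_le x : 0 < x -> Pup1 a x <= a.
Proof. by move=> x0; rewrite Pup1_Plow1// addrCA gerDl subr_le0 Plow1_le. Qed.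

End iterated_tails.

(** * Signs of the derivatives of the ratios [Mlow] and [Mup] *)

Section ratio_derivatives.
Context {R : realType}.
Variable a : R.
Hypothesis a0 : 0 < a.
Implicit Types x y z : R.
Local Notation p := (gamma_pdf a 1).

Lemma is_derive1_div_id (N : R -> R) x n : x != 0 -> is_derive x 1 N n ->
  is_derive x 1 (fun y => N y / y) ((n - N x / x) / x).
Proof.
move=> x0 dN; apply: (is_derive1_eq (is_derive1M dN (is_derive1V x0 (is_derive1_id x)))).
by field.
Qed.

(* [M] solves [x M' + (a - x) M = s]; the successive derivatives follow by
   differentiating this equation. *)
Definition ratio1 (s : R) (M : R -> R) x := (s - (a - x) * M x) / x.
Definition ratio2 s M x := (M x - (a + 1 - x) * ratio1 s M x) / x.
Definition ratio3 s M x := (2 * ratio1 s M x - (a + 2 - x) * ratio2 s M x) / x.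

Section tail.
Variables (s : R) (T : R -> R).
Hypothesis dT : forall x, 0 < x -> is_derive x 1 T (s * p x).
Let M x := T x / (x * p x).

Lemma is_derive_ratio x : 0 < x -> is_derive x 1 M (ratio1 s M x).
Proof.
move=> x0; have w0 := w_gt0 a0 x0.
apply: (is_derive1_eq (is_derive1M (dT x0)
  (@is_derive1V _ (fun y => y * p y) x _ (lt0r_neq0 w0) (is_derive_w a0 x0)))).
have p0 : p x != 0 by rewrite gt_eqF// gamma_pdf_gt0.
by rewrite /ratio1 /M; field; rewrite p0 gt_eqF.
Qed.

Lemma is_derive_ratio1 x : 0 < x -> is_derive x 1 (ratio1 s M) (ratio2 s M x).
Proof.
move=> x0; have dM := is_derive_ratio x0.
apply: (is_derive1_eq (is_derive1_div_id (lt0r_neq0 x0) (is_derive1B (is_derive1_cst x s)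
  (is_derive1M (is_derive1B (is_derive1_cst x a) (is_derive1_id x)) dM)))).
by rewrite /ratio2 /ratio1; field; rewrite gt_eqF.
Qed.

Lemma is_derive_ratio2 x : 0 < x -> is_derive x 1 (ratio2 s M) (ratio3 s M x).
Proof.
move=> x0; have dM := is_derive_ratio x0; have dM1 := is_derive_ratio1 x0.
apply: (is_derive1_eq (is_derive1_div_id (lt0r_neq0 x0) (is_derive1B dM
  (is_derive1M (is_derive1B (is_derive1_cst x (a + 1)) (is_derive1_id x)) dM1)))).
by rewrite /ratio3 /ratio2; field; rewrite gt_eqF.
Qed.

(** Numerators of the derivatives of [M] over powers of x times x p(x). They satisfy N1' = T, N2' =
    2 N1 and N3' = 3 N2, so [N_k] is k! times a k-fold antiderivative of the tail: for the lower
    tail it is the mean of the k-th power of the positive part of x - X. *)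
Let N1 x := s * (x * p x) - (a - x) * T x.
Let N2 x := x * T x - (a + 1 - x) * N1 x.
Let N3 x := 2 * (x * N1 x) - (a + 2 - x) * N2 x.

Let dN1 x : 0 < x -> is_derive x 1 N1 (T x).
Proof.
move=> x0; apply: (is_derive1_eq (is_derive1B (is_derive1M (is_derive1_cst x s)
  (is_derive_w a0 x0)) (is_derive1M (is_derive1B (is_derive1_cst x a) (is_derive1_id x)) (dT x0)))).
ring.
Qed.

Let dN2 x : 0 < x -> is_derive x 1 N2 (2 * N1 x).
Proof.
move=> x0; apply: (is_derive1_eq (is_derive1B (is_derive1M (is_derive1_id x) (dT x0))
  (is_derive1M (is_derive1B (is_derive1_cst x (a + 1)) (is_derive1_id x)) (dN1 x0)))).
rewrite /N1; ring.
Qed.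

Let dN3 x : 0 < x -> is_derive x 1 N3 (3 * N2 x).
Proof.
move=> x0; apply: (is_derive1_eq (is_derive1B (is_derive1M (is_derive1_cst x 2)
  (is_derive1M (is_derive1_id x) (dN1 x0)))
  (is_derive1M (is_derive1B (is_derive1_cst x (a + 2)) (is_derive1_id x)) (dN2 x0)))).
rewrite /N2; ring.
Qed.

Let ratioE x : 0 < x -> [/\ ratio1 s M x = N1 x / (x * (x * p x)),
  ratio2 s M x = N2 x / (x * (x * (x * p x))) &
  ratio3 s M x = N3 x / (x * (x * (x * (x * p x))))].
Proof.
move=> x0; have p0 : p x != 0 by rewrite gt_eqF// gamma_pdf_gt0.
have x0' := lt0r_neq0 x0.
by split; rewrite /ratio3 /ratio2 /ratio1 /N3 /N2 /N1 /M; field; rewrite p0.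
Qed.

(** Starting from T >= 0, each numerator in turn has a nonnegative derivative and the limit 0 at
    0. *)
Lemma ratio_low_ge0 : (forall x, 0 < x -> 0 <= T x) -> T x @[x --> 0^'+] --> 0 ->
  forall x, 0 < x -> [/\ 0 <= ratio1 s M x, 0 <= ratio2 s M x & 0 <= ratio3 s M x].
Proof.
move=> T0 cT.
have c0 : x @[x --> (0 : R)^'+] --> 0 by exact: cvg0_id.
have cs c : c - x @[x --> (0 : R)^'+] --> c - 0 by apply: cvgB => //; exact: cvg_cst.
have cN1 : N1 x @[x --> 0^'+] --> 0.
  rewrite [X in _ --> X](_ : 0 = s * 0 - (a - 0) * 0); last by ring.
  apply: cvgB; first by apply: cvgM; [exact: cvg_cst|exact: cvg0_mul_gamma_pdf].
  by apply: cvgM.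
have cN2 : N2 x @[x --> 0^'+] --> 0.
  rewrite [X in _ --> X](_ : 0 = 0 * 0 - (a + 1 - 0) * 0); last by ring.
  by apply: cvgB; apply: cvgM.
have cN3 : N3 x @[x --> 0^'+] --> 0.
  rewrite [X in _ --> X](_ : 0 = 2 * (0 * 0) - (a + 2 - 0) * 0); last by ring.
  by apply: cvgB; apply: cvgM => //; [exact: cvg_cst|exact: cvgM].
have p1 := ge0_of_cvg0 dN1 T0 cN1.
have p2 := ge0_of_cvg0 dN2 (fun x xp => mulr_ge0 (ler0n _ _) (p1 x xp)) cN2.
have p3 := ge0_of_cvg0 dN3 (fun x xp => mulr_ge0 (ler0n _ _) (p2 x xp)) cN3.
move=> x x0; have [-> -> ->] := ratioE x0; have w0 := ltW (w_gt0 a0 x0).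
by split; rewrite divr_ge0 ?p1 ?p2 ?p3// !mulr_ge0// ?ltW// gamma_pdf_gt0.
Qed.

(** The same chain, integrated from +oo, where every antiderivative reverses the sign; hence the
    alternation. *)
Lemma ratio_up_sign : (forall x, 0 < x -> 0 <= T x) -> rapid T ->
  forall x, 0 < x -> [/\ ratio1 s M x <= 0, 0 <= ratio2 s M x & ratio3 s M x <= 0].
Proof.
move=> T0 rT; have rw := rapid_w a0.
have rN1 : rapid N1.
  apply: (@rapid_ext _ (fun x => s * (x * p x) + (x * T x - a * T x))).
    by move=> x _; rewrite /N1; ring.
  apply: rapidD; first exact: rapidZ.
  by apply: rapidB; [exact: rapidX|exact: rapidZ].
have rN2 : rapid N2.
  apply: (@rapid_ext _ (fun x => x * T x + (x * N1 x - (a + 1) * N1 x))).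
    by move=> x _; rewrite /N2; ring.
  apply: rapidD; first exact: rapidX.
  by apply: rapidB; [exact: rapidX|exact: rapidZ].
have rN3 : rapid N3.
  apply: (@rapid_ext _ (fun x => 2 * (x * N1 x) + (x * N2 x - (a + 2) * N2 x))).
    by move=> x _; rewrite /N3; ring.
  apply: rapidD; first by apply: rapidZ; exact: rapidX.
  by apply: rapidB; [exact: rapidX|exact: rapidZ].
have p1 := le0_of_cvgy dN1 T0 (rapid_cvgy rN1).
have p2 x : 0 < x -> 0 <= N2 x.
  have dN2' y (yp : 0 < y) := is_derive1N (dN2 yp).
  move=> x0; rewrite -oppr_le0; apply: (le0_of_cvgy dN2' _ (rapid_cvgy (rapidN rN2)) x0).
  by move=> y yp; rewrite oppr_ge0 pmulr_rle0 ?p1.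
have p3 := le0_of_cvgy dN3 (fun x xp => mulr_ge0 (ler0n _ _) (p2 x xp)) (rapid_cvgy rN3).
move=> x x0; have [-> -> ->] := ratioE x0; have w0 := w_gt0 a0 x0.
split.
- by rewrite pmulr_lle0 ?p1// invr_gt0 !mulr_gt0// gamma_pdf_gt0.
- by rewrite divr_ge0 ?p2// !mulr_ge0// ?ltW// gamma_pdf_gt0.
- by rewrite pmulr_lle0 ?p3// invr_gt0 !mulr_gt0// gamma_pdf_gt0.
Qed.

End tail.
End ratio_derivatives.

(** * The Stein equation of the Gamma law *)

Section weighted_primitives.
Context {R : realType}.
Local Notation mu := (@lebesgue_measure R).
Variables k q : R -> R.
Hypothesis ck : forall x : R, 0 < x -> {for x, continuous k}.
Hypothesis cq : forall x : R, 0 < x -> {for x, continuous q}.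
Hypothesis k0 : forall x : R, 0 < x -> 0 <= k x.
Hypothesis q1 : forall x : R, 0 < x -> `|q x| <= 1.
Implicit Types x y : R.

Lemma continuous_kq x : 0 < x -> {for x, continuous (fun y => k y * q y)}.
Proof. by move=> x0; apply: (@continuousM _ _ k q); [exact: ck|exact: cq]. Qed.

Lemma integrable_kq (A : set R) : measurable A -> A `<=` `]0, +oo[%classic ->
  mu.-integrable A (EFin \o k) -> mu.-integrable A (EFin \o (fun y => k y * q y)).
Proof.
move=> mA A0 ik; apply: le_integrable ik => //.
  apply/measurable_EFinP; apply: measurable_funS (measurable_pos continuous_kq) => //.
move=> x /A0 /=; rewrite in_itv/= andbT => x0.
by rewrite lee_fin normrM ler_piMr// q1.
Qed.

Lemma le_Rintegral_kq (A : set R) : measurable A -> A `<=` `]0, +oo[%classic ->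
  mu.-integrable A (EFin \o k) ->
  `|\int[mu]_(y in A) (k y * q y)| <= \int[mu]_(y in A) k y.
Proof.
move=> mA A0 ik; have ikq := integrable_kq mA A0 ik.
have /le_trans := @le_normr_Rintegral _ _ _ mu A _ mA ikq; apply.
apply: le_Rintegral => //.
  by move: (integrable_abse ikq).
move=> x /A0 /=; rewrite in_itv/= andbT => x0.
by rewrite normrM ger0_norm ?k0// ler_piMr ?k0 ?q1.
Qed.

Hypothesis ik : forall u : R, mu.-integrable `]0%R, u[ (EFin \o k).

Let s0 u : `]0, u[%classic `<=` `]0 : R, +oo[%classic.
Proof. exact: subset_itvl. Qed.

Lemma is_derive_kq_low x : 0 < x ->
  is_derive x 1 (fun y => \int[mu]_(t in `]0%R, y[) (k t * q t)) (k x * q x).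
Proof.
move=> x0; apply: (is_derive_int_low continuous_kq x0) => u.
exact: integrable_kq.
Qed.

Lemma le_kq_low x : `|\int[mu]_(t in `]0%R, x[) (k t * q t)| <= \int[mu]_(t in `]0%R, x[) k t.
Proof. exact: le_Rintegral_kq. Qed.

End weighted_primitives.

Section weighted_primitives_up.
Context {R : realType}.
Local Notation mu := (@lebesgue_measure R).
Variables k q : R -> R.
Hypothesis ck : forall x : R, 0 < x -> {for x, continuous k}.
Hypothesis cq : forall x : R, 0 < x -> {for x, continuous q}.
Hypothesis k0 : forall x : R, 0 < x -> 0 <= k x.
Hypothesis q1 : forall x : R, 0 < x -> `|q x| <= 1.
Hypothesis ik : mu.-integrable `]0%R, +oo[ (EFin \o k).
Implicit Types x y : R.

Lemma is_derive_kq_up x : 0 < x ->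
  is_derive x 1 (fun y => \int[mu]_(t in `]y, +oo[) (k t * q t)) (- (k x * q x)).
Proof.
move=> x0; apply: (is_derive_int_up (continuous_kq ck cq) x0).
exact: integrable_kq.
Qed.

Lemma le_kq_up x : 0 < x ->
  `|\int[mu]_(t in `]x, +oo[) (k t * q t)| <= \int[mu]_(t in `]x, +oo[) k t.
Proof.
move=> x0; have sx : `]x, +oo[%classic `<=` `]0 : R, +oo[%classic.
  by move=> y /=; rewrite !in_itv/= !andbT; exact: lt_trans.
by apply: (le_Rintegral_kq ck cq k0 q1 _ sx) => //; apply: (integrableS _ _ _ ik).
Qed.

End weighted_primitives_up.

(** Serves to see that h minus the Stein operator of the candidate is a constant, before that
    constant is known to be the mean of h. *)
Lemma derive0_cst (R : realType) (F : R -> R) :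
  (forall x : R, 0 < x -> is_derive x 1 F 0) -> forall x, 0 < x -> F x = F 1.
Proof.
move=> dF x x0; apply/eqP; rewrite -subr_eq0; apply/eqP.
have [x1|x1] := leP 1 x.
  by have [c _ ->] := MVT_pos ltr01 x1 (f := fun=> 0) dF; rewrite mul0r.
have [c _ h] := MVT_pos x0 (ltW x1) (f := fun=> 0) dF.
by rewrite -opprB h mul0r oppr0.
Qed.

Section stein_equation.
Context {R : realType}.
Local Notation mu := (@lebesgue_measure R).
Variable a : R.
Hypothesis a0 : 0 < a.
Implicit Types x y z : R.
Local Notation p := (gamma_pdf a 1).
Local Notation P := (Plow a).
Local Notation P' := (Pup a).
Local Notation Ml := (Mlow a).
Local Notation Mu := (Mup a).
Local Notation Ml1 := (ratio1 a 1 Ml).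
Local Notation Mu1 := (ratio1 a (-1) Mu).
Local Notation Ml2 := (ratio2 a 1 Ml).
Local Notation Mu2 := (ratio2 a (-1) Mu).
Local Notation Ml3 := (ratio3 a 1 Ml).
Local Notation Mu3 := (ratio3 a (-1) Mu).

Let dP x : 0 < x -> is_derive x 1 P (1 * p x).
Proof. by move=> x0; rewrite mul1r; exact: is_derive_Plow. Qed.

Let dP' x : 0 < x -> is_derive x 1 P' (-1 * p x).
Proof. by move=> x0; rewrite mulN1r; exact: is_derive_Pup. Qed.

Lemma is_derive_Mlow x : 0 < x -> is_derive x 1 Ml (Ml1 x).
Proof. exact: (is_derive_ratio a0 dP). Qed.
Lemma is_derive_Mlow1 x : 0 < x -> is_derive x 1 Ml1 (Ml2 x).
Proof. exact: (is_derive_ratio1 a0 dP). Qed.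
Lemma is_derive_Mlow2 x : 0 < x -> is_derive x 1 Ml2 (Ml3 x).
Proof. exact: (is_derive_ratio2 a0 dP). Qed.
Lemma is_derive_Mup x : 0 < x -> is_derive x 1 Mu (Mu1 x).
Proof. exact: (is_derive_ratio a0 dP'). Qed.
Lemma is_derive_Mup1 x : 0 < x -> is_derive x 1 Mu1 (Mu2 x).
Proof. exact: (is_derive_ratio1 a0 dP'). Qed.
Lemma is_derive_Mup2 x : 0 < x -> is_derive x 1 Mu2 (Mu3 x).
Proof. exact: (is_derive_ratio2 a0 dP'). Qed.

Lemma Mlow_derivs_ge0 x : 0 < x -> [/\ 0 <= Ml1 x, 0 <= Ml2 x & 0 <= Ml3 x].
Proof. by apply: (ratio_low_ge0 a0 dP) => [y _|]; [exact: Plow_ge0|exact: cvg0_Plow]. Qed.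

Lemma Mup_derivs_sign x : 0 < x -> [/\ Mu1 x <= 0, 0 <= Mu2 x & Mu3 x <= 0].
Proof. by apply: (ratio_up_sign a0 dP') => [y _|]; [exact: Pup_ge0|exact: rapid_Pup]. Qed.

Lemma Mlow_ge0 x : 0 < x -> 0 <= Ml x.
Proof. by move=> x0; rewrite divr_ge0 ?Plow_ge0 ?ltW ?w_gt0. Qed.

Lemma Mup_ge0 x : 0 < x -> 0 <= Mu x.
Proof. by move=> x0; rewrite divr_ge0 ?Pup_ge0 ?ltW ?w_gt0. Qed.

Let PupE x : 0 < x -> P' x = 1 - P x.
Proof. by move=> x0; rewrite -(Plow_Pup a0 x0); ring. Qed.

Let p0 x : 0 < x -> p x != 0.
Proof. by move=> x0; rewrite gt_eqF// gamma_pdf_gt0. Qed.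

(** These identities follow from P + P' = 1 and the closed forms. They encode explicit solutions:
    [M_P1], [M1_P1] and [M2_P1] say that h(x) = x has the solution g = -1 with g' = g'' = 0, while
    [M1_P2] and [M3_P2] say that for h(x) = x^2 / 2 one has g' = -1/2 and g''' = 0. [M_P] and [M1_P]
    collect the terms that come from differentiating the limits of integration. *)
Lemma M_P1 x : 0 < x -> Mu x * Plow1 a x + Ml x * Pup1 a x = 1.
Proof.
move=> x0; rewrite Plow1E// Pup1E// /Mlow /Mup PupE//; field.
by rewrite p0// gt_eqF.
Qed.

Lemma M1_P1 x : 0 < x -> Mu1 x * Plow1 a x + Ml1 x * Pup1 a x = 0.
Proof.
move=> x0; rewrite /ratio1 Plow1E// Pup1E// /Mlow /Mup PupE//; field.
by rewrite p0// gt_eqF.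
Qed.

Lemma M2_P1 x : 0 < x -> Mu2 x * Plow1 a x + Ml2 x * Pup1 a x = x^-1.
Proof.
move=> x0; rewrite /ratio2 /ratio1 Plow1E// Pup1E// /Mlow /Mup PupE//; field.
by rewrite p0// gt_eqF.
Qed.

Lemma M_P x : 0 < x -> Mu x * P x = Ml x * P' x.
Proof. by move=> x0; rewrite /Mlow /Mup; ring. Qed.

Lemma M1_P x : 0 < x -> Ml1 x * P' x - Mu1 x * P x = x^-1.
Proof.
move=> x0; rewrite /ratio1 /Mlow /Mup PupE//; field.
by rewrite p0// gt_eqF.
Qed.

Lemma M1_P2 x : 0 < x -> Ml1 x * Pup2 a x - Mu1 x * Plow2 a x = 2^-1.
Proof.
move=> x0; rewrite /ratio1 Plow2E// Pup2E// /Mlow /Mup PupE//; field.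
by rewrite p0// gt_eqF.
Qed.

Lemma M3_P2 x : 0 < x -> Ml3 x * Pup2 a x - Mu3 x * Plow2 a x = x^-1.
Proof.
move=> x0; rewrite /ratio3 /ratio2 /ratio1 Plow2E// Pup2E// /Mlow /Mup PupE//; field.
by rewrite p0// gt_eqF.
Qed.

Lemma Mequation_low x : 0 < x -> x * Ml1 x + (a - x) * Ml x = 1.
Proof. by move=> x0; rewrite /ratio1; field; rewrite gt_eqF. Qed.

Lemma Mequation_up x : 0 < x -> x * Mu1 x + (a - x) * Mu x = -1.
Proof. by move=> x0; rewrite /ratio1; field; rewrite gt_eqF. Qed.

Let cP x : 0 < x -> {for x, continuous P}.
Proof. by move=> /dP; exact: is_derive1_continuous. Qed.
Let cP' x : 0 < x -> {for x, continuous P'}.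
Proof. by move=> /dP'; exact: is_derive1_continuous. Qed.
Let cP1 x : 0 < x -> {for x, continuous (Plow1 a)}.
Proof. by move=> xp; exact: (is_derive1_continuous (is_derive_Plow1 a0 xp)). Qed.
Let cP1' x : 0 < x -> {for x, continuous (Pup1 a)}.
Proof. by move=> xp; exact: (is_derive1_continuous (is_derive_Pup1 a0 xp)). Qed.

Let bounded_int (k : R -> R) (u : R) : (forall x, 0 < x -> {for x, continuous k}) ->
  (forall x, 0 < x -> 0 <= k x <= 1 + x) -> mu.-integrable `]0%R, u[ (EFin \o k).
Proof.
move=> ck hk; have s0 : `]0, u[%classic `<=` `]0 : R, +oo[%classic by exact: subset_itvl.
apply: measurable_bounded_integrable => //.
- rewrite /= lebesgue_measure_itv/=; by case: ifP => _; rewrite ?ltry// -EFinD ltry.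
- exact: measurable_funS (measurable_pos ck).
- exists (1 + u); split; first exact: num_real.
  move=> M uM x /=; rewrite in_itv/= => /andP[xp xu].
  have /andP[h1 h2] := hk x xp; rewrite ger0_norm//; apply: (le_trans h2); lra.
Qed.

Let iP (u : R) : mu.-integrable `]0%R, u[ (EFin \o P).
Proof.
apply: bounded_int => // x xp; rewrite Plow_ge0//=.
by apply: (le_trans (Plow_le1 a0 xp)); rewrite lerDl ltW.
Qed.

Let iP1 (u : R) : mu.-integrable `]0%R, u[ (EFin \o (Plow1 a)).
Proof.
apply: bounded_int => // x xp; rewrite Plow1_ge0//=.
by apply: (le_trans (Plow1_le a0 xp)); rewrite lerDr.
Qed.

Section lipschitz.
Variables h h1 : R -> R.
Hypothesis dh : forall x, 0 < x -> is_derive x 1 h (h1 x).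
Hypothesis ch : forall x, 0 < x -> {for x, continuous h1}.
Hypothesis bh : forall x, 0 < x -> `|h1 x| <= 1.

Let I x := \int[mu]_(t in `]0%R, x[) (P t * h1 t).
Let J x := \int[mu]_(t in `]x, +oo[) (P' t * h1 t).

Let dI x : 0 < x -> is_derive x 1 I (P x * h1 x).
Proof. by apply: is_derive_kq_low => // y _; exact: Plow_ge0. Qed.

Let dJ x : 0 < x -> is_derive x 1 J (- (P' x * h1 x)).
Proof. by apply: is_derive_kq_up => //; exact: integrable_Pup. Qed.

Let leI x : 0 < x -> `|I x| <= Plow1 a x.
Proof. by move=> x0; apply: le_kq_low => // y _; exact: Plow_ge0. Qed.

Let leJ x : 0 < x -> `|J x| <= Pup1 a x.
Proof. by move=> x0; apply: le_kq_up => //; [move=> y _; exact: Pup_ge0|exact: integrable_Pup]. Qed.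

(** The classical solution is 1 / (x p(x)) times the integral of (h - E h) p over (0, x).
    Integration by parts brings it to this form, where only h' occurs, weighted by the lower tail
    left of x and by the upper tail right of x. *)
Let g x := - (Mu x * I x + Ml x * J x).
Let g1 x := - (Mu1 x * I x + Ml1 x * J x).
Let g2 x := - (Mu2 x * I x + Ml2 x * J x) + h1 x / x.

Let dg x : 0 < x -> is_derive x 1 g (g1 x).
Proof.
move=> x0; apply: (is_derive1_eq (is_derive1N (is_derive1D
  (is_derive1M (is_derive_Mup x0) (dI x0)) (is_derive1M (is_derive_Mlow x0) (dJ x0))))).
rewrite /g1; apply/eqP; rewrite -subr_eq0; apply/eqP.
transitivity (- h1 x * (Mu x * P x - Ml x * P' x)); first by ring.
by rewrite M_P// subrr mulr0.
Qed.

Let dg1 x : 0 < x -> is_derive x 1 g1 (g2 x).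
Proof.
move=> x0; apply: (is_derive1_eq (is_derive1N (is_derive1D
  (is_derive1M (is_derive_Mup1 x0) (dI x0)) (is_derive1M (is_derive_Mlow1 x0) (dJ x0))))).
rewrite /g2 -(M1_P x0).
by move: (I x) (J x) (P x) (P' x) (Mu1 x) (Mu2 x) (Ml1 x) (Ml2 x) (h1 x) => *; ring.
Qed.

Let cg2 x : 0 < x -> {for x, continuous g2}.
Proof.
move=> x0; apply: (@continuousD _ _ _ (fun x => - (Mu2 x * I x + Ml2 x * J x)) (fun x => h1 x / x)).
  exact: (is_derive1_continuous (is_derive1N (is_derive1D
    (is_derive1M (is_derive_Mup2 x0) (dI x0)) (is_derive1M (is_derive_Mlow2 x0) (dJ x0))))).
apply: (@continuousM _ _ h1 (fun x => x^-1)); first exact: ch.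
exact: (is_derive1_continuous (is_derive1V (lt0r_neq0 x0) (is_derive1_id x))).
Qed.

Let gIJ x : 0 < x -> x * g1 x + (a - x) * g x = I x - J x.
Proof.
move=> x0; rewrite /g1 /g.
transitivity (- ((x * Mu1 x + (a - x) * Mu x) * I x + (x * Ml1 x + (a - x) * Ml x) * J x)).
  by ring.
by rewrite Mequation_low// Mequation_up//; ring.
Qed.

Let le_comb (A B A' B' u v : R) : 0 <= A' -> 0 <= B' -> `|u| <= A -> `|v| <= B ->
  `|A' * u + B' * v| <= A' * A + B' * B.
Proof.
move=> hA hB hu hv; apply: (le_trans (ler_normD _ _)).
by rewrite !normrM (ger0_norm hA) (ger0_norm hB) lerD// ler_wpM2l.
Qed.

Lemma stein_solution1 : exists g g1 g2 : R -> R, exists c C : R,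
  [/\ (forall x, 0 < x -> [/\ is_derive x 1 g (g1 x), is_derive x 1 g1 (g2 x),
        {for x, continuous g2} & x * g1 x + (a - x) * g x = h x - c]),
      (forall x, 0 < x -> `|g x| <= 1),
      (forall x, 0 < x -> `|g1 x| <= C) &
      (forall x, 0 < x -> `|x * g2 x| <= 2)].
Proof.
have bg x : 0 < x -> `|g x| <= 1.
  move=> x0; rewrite normrN -(M_P1 x0).
  by apply: le_comb; [exact: Mup_ge0|exact: Mlow_ge0|exact: leI|exact: leJ].
(* For the first derivative the two halves of the kernel have opposite signs. By [M1_P1] their
   moduli add up to twice one of them, a function of x instead of a constant. *)
have bg1 x : 0 < x -> `|g1 x| <= 2 * (Ml1 x * Pup1 a x).
  move=> x0; have [l1 l2 _] := Mlow_derivs_ge0 x0; have [u1 u2 _] := Mup_derivs_sign x0.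
  rewrite /g1 normrN -[_ * I x]mulrNN.
  have u1' : 0 <= - Mu1 x by rewrite oppr_ge0.
  have lI : `|- I x| <= Plow1 a x by rewrite normrN leI.
  apply: (le_trans (le_comb u1' l1 lI (leJ x0))).
  by rewrite mulNr mulr_natl mulr2n lerD2r -subr_ge0 opprK addrC (M1_P1 x0).
(* The constant is the value at 1 of h - (I - J), which has zero derivative. The bound [C] on the
   first derivative will be multiplied by r --> 0, so only its finiteness matters. *)
exists g, g1, g2, (h 1 - (I 1 - J 1)), (2 * (Ml1 1 * a) + (2 * a + 2)); split.
- move=> x x0; split; [exact: dg|exact: dg1|exact: cg2|].
  have dc y : 0 < y -> is_derive y 1 (fun y => h y - (I y - J y)) 0.
    move=> yp; apply: (is_derive1_eq (is_derive1B (dh yp) (is_derive1B (dI yp) (dJ yp)))).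
    rewrite PupE//; ring.
  by rewrite gIJ// -(derive0_cst dc x0); ring.
- exact: bg.
- move=> x x0.
  have l11 : 0 <= Ml1 1 by have [] := Mlow_derivs_ge0 (@ltr01 R).
  (* Up to 1, [Ml1] is at most its value at 1 and [Pup1] is at most a. Beyond 1, the equation
     expresses x g' by I, J and (a - x) g, all of linear growth. *)
  have [x1|x1] := leP x 1.
    apply: (@le_trans _ _ (2 * (Ml1 1 * a))); last by rewrite lerDl addr_ge0// mulr_ge0// ltW.
    apply: (le_trans (bg1 _ x0)); rewrite ler_pM2l//.
    apply: ler_pM; rewrite ?Pup1_ge0 ?Pup1_le//; first by have [] := Mlow_derivs_ge0 x0.
    apply: (ndecr_pos is_derive_Mlow1) => // y yp; by have [] := Mlow_derivs_ge0 yp.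
  apply: (@le_trans _ _ (2 * a + 2)); last by rewrite lerDr; apply: mulr_ge0 => //; apply: mulr_ge0 => //; exact: ltW.
  have xg : `|x * g1 x| <= (2 * a + 2) * x.
    have -> : x * g1 x = (I x - J x) - (a - x) * g x by move: (gIJ x0); move: (g1 x) (g x) (I x - J x) => u v t <-; ring.
    have tri : `|(I x - J x) - (a - x) * g x| <= (x + a) + (a + x).
      apply: (le_trans (ler_normB _ _)); apply: lerD.
        apply: (le_trans (ler_normB _ _)); apply: lerD.
          exact: le_trans (leI x0) (Plow1_le a0 x0).
        exact: le_trans (leJ x0) (Pup1_le a0 x0).
      rewrite normrM -[leRHS]mulr1; apply: ler_pM => //; last exact: bg.
      by rewrite (le_trans (ler_normB _ _))// !gtr0_norm.
    apply: (le_trans tri); have : a <= a * x by rewrite ler_peMr// ltW.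
    have -> : (2 * a + 2) * x = 2 * (a * x) + 2 * x by ring.
    move: (a * x) => t at_; lra.
  by move: xg; rewrite normrM gtr0_norm// mulrC ler_pM2r.
(* One unit for the kernel, by [M2_P1], and one for the boundary term h'. *)
- move=> x x0; have [l1 l2 _] := Mlow_derivs_ge0 x0; have [u1 u2 _] := Mup_derivs_sign x0.
  have -> : x * g2 x = - (x * (Mu2 x * I x + Ml2 x * J x)) + h1 x.
    by rewrite /g2; field; rewrite gt_eqF.
  apply: (le_trans (ler_normD _ _)); rewrite (_ : 2 = 1 + 1)//.
  apply: lerD; last exact: bh.
  rewrite normrN normrM gtr0_norm// mulrC -ler_pdivlMr// mul1r -(M2_P1 x0).
  by apply: le_comb => //; [exact: leI|exact: leJ].
Qed.

End lipschitz.

Section smooth.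
Variables h h1 h2 : R -> R.
Hypothesis dh : forall x, 0 < x -> is_derive x 1 h (h1 x).
Hypothesis dh1 : forall x, 0 < x -> is_derive x 1 h1 (h2 x).
Hypothesis ch : forall x, 0 < x -> {for x, continuous h2}.
Hypothesis bh : forall x, 0 < x -> `|h2 x| <= 1.

Let I x := \int[mu]_(t in `]0%R, x[) (Plow1 a t * h2 t).
Let J x := \int[mu]_(t in `]x, +oo[) (Pup1 a t * h2 t).

Let dI x : 0 < x -> is_derive x 1 I (Plow1 a x * h2 x).
Proof. by apply: is_derive_kq_low => // y _; exact: Plow1_ge0. Qed.

Let dJ x : 0 < x -> is_derive x 1 J (- (Pup1 a x * h2 x)).
Proof. by apply: is_derive_kq_up => //; exact: integrable_Pup1. Qed.

Let leI x : 0 < x -> `|I x| <= Plow2 a x.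
Proof. by move=> x0; apply: le_kq_low => // y _; exact: Plow1_ge0. Qed.

Let leJ x : 0 < x -> `|J x| <= Pup2 a x.
Proof.
move=> x0; apply: (le_kq_up (k := Pup1 a)) x0; [|exact: ch| |exact: bh|exact: integrable_Pup1].
  by move=> y y0; exact: cP1'.
by move=> y _; exact: Pup1_ge0.
Qed.

(** The kernel formula of the Lipschitz case, integrated by parts once more so that h'' appears; by
    [M_P1] the boundary terms add up to - h'. *)
Let g x := - h1 x + (Mu x * I x - Ml x * J x).
Let g1 x := Mu1 x * I x - Ml1 x * J x.
Let g2 x := Mu2 x * I x - Ml2 x * J x.
Let g3 x := Mu3 x * I x - Ml3 x * J x + h2 x / x.

Let dg x : 0 < x -> is_derive x 1 g (g1 x).
Proof.
move=> x0; apply: (is_derive1_eq (is_derive1D (is_derive1N (dh1 x0)) (is_derive1B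
  (is_derive1M (is_derive_Mup x0) (dI x0)) (is_derive1M (is_derive_Mlow x0) (dJ x0))))).
rewrite /g1; apply/eqP; rewrite -subr_eq0; apply/eqP.
transitivity (h2 x * ((Mu x * Plow1 a x + Ml x * Pup1 a x) - 1)); first by ring.
by rewrite M_P1// subrr mulr0.
Qed.

Let dg1 x : 0 < x -> is_derive x 1 g1 (g2 x).
Proof.
move=> x0; apply: (is_derive1_eq (is_derive1B
  (is_derive1M (is_derive_Mup1 x0) (dI x0)) (is_derive1M (is_derive_Mlow1 x0) (dJ x0)))).
rewrite /g2; apply/eqP; rewrite -subr_eq0; apply/eqP.
transitivity (h2 x * (Mu1 x * Plow1 a x + Ml1 x * Pup1 a x)).
  by move: (I x) (J x) (Plow1 a x) (Pup1 a x) (Mu1 x) (Mu2 x) (Ml1 x) (Ml2 x) => *; ring.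
by rewrite M1_P1// mulr0.
Qed.

Let dg2 x : 0 < x -> is_derive x 1 g2 (g3 x).
Proof.
move=> x0; apply: (is_derive1_eq (is_derive1B
  (is_derive1M (is_derive_Mup2 x0) (dI x0)) (is_derive1M (is_derive_Mlow2 x0) (dJ x0)))).
rewrite /g3 -(M2_P1 x0).
by move: (I x) (J x) (Plow1 a x) (Pup1 a x) (Mu2 x) (Mu3 x) (Ml2 x) (Ml3 x) (h2 x) => *; ring.
Qed.

Let cdiv (f : R -> R) x : 0 < x -> {for x, continuous f} -> {for x, continuous (fun y => f y / y)}.
Proof.
move=> x0 cf; apply: (@continuousM _ _ f (fun x => x^-1)) => //.
exact: (is_derive1_continuous (is_derive1V (lt0r_neq0 x0) (is_derive1_id x))).
Qed.

Let cM3 s M x : 0 < x -> {for x, continuous (ratio1 a s M)} ->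
  {for x, continuous (ratio2 a s M)} -> {for x, continuous (ratio3 a s M)}.
Proof.
move=> x0 c1 c2; apply: cdiv => //.
apply: (@continuousB _ _ _ (fun y => 2 * ratio1 a s M y) (fun y => (a + 2 - y) * ratio2 a s M y)).
  apply: (@continuousM _ _ (fun=> 2) (ratio1 a s M)) => //; exact: cst_continuous.
apply: (@continuousM _ _ (fun y => a + 2 - y) (ratio2 a s M)) => //.
exact: (is_derive1_continuous (is_derive1B (is_derive1_cst x (a + 2)) (is_derive1_id x))).
Qed.

Let cg3 x : 0 < x -> {for x, continuous g3}.
Proof.
move=> x0; have cc (f : R -> R) d := @is_derive1_continuous R f x d.
apply: (@continuousD _ _ _ (fun x => Mu3 x * I x - Ml3 x * J x) (fun x => h2 x / x)); last first.
  by apply: cdiv => //; exact: ch.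
apply: (@continuousB _ _ _ (fun x => Mu3 x * I x) (fun x => Ml3 x * J x)).
  apply: (@continuousM _ _ Mu3 I); last exact: (cc _ _ (dI x0)).
  by apply: cM3 => //; [exact: (cc _ _ (is_derive_Mup1 x0))|exact: (cc _ _ (is_derive_Mup2 x0))].
apply: (@continuousM _ _ Ml3 J); last exact: (cc _ _ (dJ x0)).
by apply: cM3 => //; [exact: (cc _ _ (is_derive_Mlow1 x0))|exact: (cc _ _ (is_derive_Mlow2 x0))].
Qed.

Let gIJ x : 0 < x -> x * g1 x + (a - x) * g x = (x - a) * h1 x - I x - J x.
Proof.
move=> x0; rewrite /g1 /g.
transitivity ((x - a) * h1 x + (x * Mu1 x + (a - x) * Mu x) * I x -
   (x * Ml1 x + (a - x) * Ml x) * J x).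
  by ring.
by rewrite Mequation_low// Mequation_up//; ring.
Qed.

Let le_comb (A B A' B' u v : R) : 0 <= A' -> 0 <= B' -> `|u| <= A -> `|v| <= B ->
  `|A' * u - B' * v| <= A' * A + B' * B.
Proof.
move=> hA hB hu hv; apply: (le_trans (ler_normB _ _)).
by rewrite !normrM (ger0_norm hA) (ger0_norm hB) lerD// ler_wpM2l.
Qed.

Lemma Mup_derive2 z : 0 < z -> (Mu^`(2))%classic z = Mu2 z.
Proof.
move=> z0; rewrite derive1nS derive1n1; apply: is_derive1E.
apply: near_is_derive1 (is_derive_Mup1 z0); near=> y.
apply/esym/is_derive1E/is_derive_Mup; near: y; exact: near_pos.
Unshelve. all: by end_near. Qed.

Lemma Mlow_derive2 z : 0 < z -> (Ml^`(2))%classic z = Ml2 z.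
Proof.
move=> z0; rewrite derive1nS derive1n1; apply: is_derive1E.
apply: near_is_derive1 (is_derive_Mlow1 z0); near=> y.
apply/esym/is_derive1E/is_derive_Mlow; near: y; exact: near_pos.
Unshelve. all: by end_near. Qed.

(** For [g1] and [g3] the two halves of the kernel have the same sign, so the extremal test function
    is x^2 / 2 and [M1_P2], [M3_P2] give numbers. For [g2] the signs are opposite: the moduli add up
    without cancellation, and their sum is [C2]. *)
Lemma stein_solution2 : exists g g1 g2 g3 : R -> R, exists c : R,
  [/\ (forall x, 0 < x -> [/\ is_derive x 1 g (g1 x), is_derive x 1 g1 (g2 x),
        is_derive x 1 g2 (g3 x), {for x, continuous g3} &
        x * g1 x + (a - x) * g x = h x - c]),
      (forall x, 0 < x -> `|g1 x| <= 1),
      (forall x, 0 < x -> `|g2 x| <= C2 a x) &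
      (forall x, 0 < x -> `|x * g3 x| <= 2)].
Proof.
exists g, g1, g2, g3, (h 1 - ((1 - a) * h1 1 - I 1 - J 1)); split.
- move=> x x0; split; [exact: dg|exact: dg1|exact: dg2|exact: cg3|].
  have dc y : 0 < y -> is_derive y 1 (fun y => h y - ((y - a) * h1 y - I y - J y)) 0.
    move=> yp; apply: (is_derive1_eq (is_derive1B (dh yp) (is_derive1B (is_derive1B
      (is_derive1M (is_derive1B (is_derive1_id y) (is_derive1_cst y a)) (dh1 yp)) (dI yp)) (dJ yp)))).
    rewrite (Pup1_Plow1 a0 yp); ring.
  by rewrite gIJ// -(derive0_cst dc x0); ring.
- move=> x x0; have [l1 l2 _] := Mlow_derivs_ge0 x0; have [u1 u2 _] := Mup_derivs_sign x0.
  rewrite /g1 -[Mu1 x * I x]mulrNN.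
  have u1' : 0 <= - Mu1 x by rewrite oppr_ge0.
  have lI : `|- I x| <= Plow2 a x by rewrite normrN leI.
  apply: (le_trans (le_comb u1' l1 lI (leJ x0))).
  by rewrite mulNr addrC (M1_P2 x0) invf_le1 ?ler1n.
- move=> x x0; have [l1 l2 _] := Mlow_derivs_ge0 x0; have [u1 u2 _] := Mup_derivs_sign x0.
  rewrite /C2 Mup_derive2// Mlow_derive2//.
  by apply: le_comb => //; [exact: leI|exact: leJ].
- move=> x x0; have [l1 l2 l3] := Mlow_derivs_ge0 x0; have [u1 u2 u3] := Mup_derivs_sign x0.
  have -> : x * g3 x = (x * (Mu3 x * I x - Ml3 x * J x)) + h2 x.
    by rewrite /g3 mulrDr [x * (_ / x)]mulrC divfK// gt_eqF.
  apply: (le_trans (ler_normD _ _)); rewrite (_ : 2 = 1 + 1)//.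
  apply: lerD; last exact: bh.
  rewrite normrM gtr0_norm// mulrC -ler_pdivlMr// mul1r.
  rewrite -[Mu3 x * I x]mulrNN.
  have u3' : 0 <= - Mu3 x by rewrite oppr_ge0.
  have lI : `|- I x| <= Plow2 a x by rewrite normrN leI.
  apply: (le_trans (le_comb u3' l3 lI (leJ x0))).
  by rewrite mulNr addrC (M3_P2 x0).
Qed.

End smooth.
End stein_equation.

(** * Quadratic forms and spectra *)

Lemma conj_mulmx (F : fieldType) (n : nat) (U D D' : 'M[F]_n) : U \in unitmx ->
  (invmx U *m D *m U) *m (invmx U *m D' *m U) = invmx U *m (D *m D') *m U.
Proof. by move=> Uu; rewrite !mulmxA mulmxK. Qed.

Section spectral_quadratic_forms.
Import mathcomp.algebra.spectral mathcomp.real_closed.complex.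
Context {R : realType} {d : nat}.
Implicit Types (S M : 'M[R]_d) (u : 'cV[R]_d).

Definition qform M u : R := (u^T *m M *m u) 0 0.

Definition mxpow S k : 'M[R]_d := iter k (mulmx S) 1%:M.

Lemma symmetricmx_tr S : S \is symmetricmx -> S = S^T.
Proof. by move/is_hermitianmxP; rewrite expr0 scale1r map_mx_id. Qed.

Section in_closed_field.
Variables (C : numClosedFieldType) (toC : {rmorphism R -> C}) (ofC : C -> R).
Hypothesis toC_real : forall x, toC x \is Num.real.
Hypothesis toC_ge0 : forall x, 0 <= toC x -> 0 <= x.
Hypothesis ofCK : forall z, z \is Num.real -> toC (ofC z) = z.

(** The image of S in the closed field [C] is Hermitian, hence unitarily diagonalisable; the weights
    [c j] are the squared moduli of the coordinates of u in the eigenbasis and serve all powers k at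
    once. The map [s] only says that each diagonal entry is one of the lam, without matching
    multiplicities, which is enough for bounds uniform in j. *)
Lemma qform_spectral_in S (lam : 'I_d -> R) u : S \is symmetricmx ->
  char_poly S = \prod_(j < d) ('X - (lam j)%:P) ->
  exists (c : 'I_d -> R) (s : 'I_d -> 'I_d), (forall j, 0 <= c j) /\
    forall k, qform (mxpow S k) u = \sum_j lam (s j) ^+ k * c j.
Proof.
move=> Ssym cS; pose Sc : 'M[C]_d := map_mx toC S.
have Sc_herm : Sc \is hermsymmx.
  apply: realsym_hermsym.
    apply/is_hermitianmxP; rewrite expr0 scale1r map_mx_id//.
    by apply/matrixP => i j; rewrite !mxE [in LHS](symmetricmx_tr Ssym) mxE.
  by apply/mxOverP => i j; rewrite mxE; exact: toC_real.
have /orthomx_spectralP := hermitian_normalmx Sc_herm.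
set U := spectralmx Sc; set sp := spectral_diag Sc => ScE.
have Uunit : U \in unitmx by exact: spectral_unit.
have Uu : U \is unitarymx by exact: spectral_unitarymx.
clearbody U sp.
pose y := U *m map_mx toC u.
have spP j : exists i, sp 0 j = toC (lam i).
  have rsp : root (char_poly Sc) (sp 0 j).
    (* The rows of [U] are left eigenvectors; they do not vanish because [U] is invertible. *)
    rewrite -eigenvalue_root_char; apply/eigenvalueP; exists (row j U).
      rewrite -row_mul ScE !mulmxA mulmxV// mul1mx row_mul row_diag_mx.
      by rewrite -scalemxAl -rowE.
    apply/negP => /eqP rU0; have : (row j U *m invmx U) = 0 by rewrite rU0 mul0mx.
    rewrite -row_mul mulmxV// => /rowP/(_ j); rewrite !mxE eqxx => /eqP.
    by rewrite oner_eq0.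
  move: rsp; rewrite -map_char_poly cS rmorph_prod.
  rewrite (eq_bigr (fun i => 'X - (toC (lam i))%:P)); last first.
    by move=> i _; rewrite rmorphB/= map_polyX map_polyC.
  rewrite -[\prod_(i < d) _](big_map (fun i => toC (lam i)) predT (fun z => 'X - z%:P)).
  by rewrite root_prod_XsubC => /mapP[i _ ->]; exists i.
have [s sE] := choice spP.
pose c j := ofC (`|y j 0| ^+ 2).
have cE j : toC (c j) = `|y j 0| ^+ 2.
  by rewrite /c ofCK// ger0_real// exprn_ge0.
exists c, s; split=> [j|k].
  by apply: toC_ge0; rewrite cE exprn_ge0.
apply: (fmorph_inj toC).
have powE : map_mx toC (mxpow S k) = invmx U *m diag_mx (\row_j sp 0 j ^+ k) *m U.
  elim: k => [|k IH].
    rewrite map_mx1; under [X in diag_mx X]eq_mx do rewrite expr0.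
    rewrite (_ : diag_mx _ = 1%:M) ?mulmx1 ?mulVmx//.
    by apply/matrixP => i j; rewrite !mxE.
  rewrite /mxpow iterS map_mxM/= -/(mxpow S k) IH -/Sc ScE.
  rewrite conj_mulmx//; congr (_ *m _ *m _).
  rewrite mulmx_diag; congr diag_mx; apply/rowP => j.
  by rewrite !mxE exprS.
have uU : (map_mx toC u)^T *m invmx U = map_mx Num.conj y^T.
  rewrite invmx_unitary// /y trmx_mul map_mxM; congr (_ *m _).
  apply/matrixP => i j; rewrite !mxE; apply/esym/CrealP; exact: toC_real.
transitivity (((map_mx toC u)^T *m map_mx toC (mxpow S k) *m map_mx toC u) 0 0).
  by rewrite map_trmx -!map_mxM/= [in RHS]mxE.
rewrite powE !mulmxA uU -!mulmxA -/y mulmxA.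
rewrite mxE rmorph_sum/=; apply: eq_bigr => j _.
rewrite rmorphM rmorphXn/= cE -sE mul_mx_diag !mxE normCK.
by rewrite [_^* * _]mulrC -mulrA [X in _ * X]mulrC.
Qed.



End in_closed_field.

Lemma qform_spectral S (lam : 'I_d -> R) u : S \is symmetricmx ->
  char_poly S = \prod_(j < d) ('X - (lam j)%:P) ->
  exists (c : 'I_d -> R) (s : 'I_d -> 'I_d), (forall j, 0 <= c j) /\
    forall k, qform (mxpow S k) u = \sum_j lam (s j) ^+ k * c j.
Proof.
apply: (@qform_spectral_in _ (real_complex R) (@Re R)) => [x|x|z].
- by apply/complex_realP; exists x.
- by rewrite lecR.
- exact: RRe_real.
Qed.

End spectral_quadratic_forms.

(** On the spectrum the combination acts as the polynomial x t^k + y t^(k + 1), and the weights are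
    nonnegative with sum |u|^2. *)
Lemma qform_bound (R : realType) (d : nat) (S : 'M[R]_d) (lam : 'I_d -> R) (u : 'cV[R]_d)
    (x y m : R) (k : nat) : S \is symmetricmx ->
  char_poly S = \prod_(j < d) ('X - (lam j)%:P) ->
  (forall j, `|x * lam j ^+ k + y * lam j ^+ k.+1| <= m) ->
  `|x * qform (mxpow S k) u + y * qform (mxpow S k.+1) u| <= m * qform 1%:M u.
Proof.
move=> Ssym cS hm; have [c [s [c0 qE]]] := qform_spectral u Ssym cS.
have -> : qform 1%:M u = \sum_j c j.
  by rewrite -[1%:M]/(mxpow S 0) qE; apply: eq_bigr => j _; rewrite expr0 mul1r.
rewrite !qE !mulr_sumr -big_split/=; apply: (le_trans (ler_norm_sum _ _ _)).
apply: ler_sum => j _; rewrite !mulrA -mulrDl normrM (ger0_norm (c0 j)).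
by rewrite ler_wpM2r.
Qed.

(** * Gaussian integration by parts *)

Section density.
Context d (T : measurableType d) (R : realType).
Variables (mu nu : {measure set T -> \bar R}) (p : T -> R).
Hypothesis mp : measurable_fun [set: T] p.
Hypothesis p0 : forall x, 0 <= p x.
Hypothesis nuE : forall A, measurable A -> nu A = (\int[mu]_(x in A) (p x)%:E)%E.

Import HBNNSimple.

Let mEp : measurable_fun [set: T] (EFin \o p).
Proof. exact/measurable_EFinP. Qed.

Let indicE E : measurable E ->
  (\int[nu]_x (\1_E x)%:E = \int[mu]_x ((\1_E x)%:E * (p x)%:E))%E.
Proof.
move=> mE; rewrite integral_indic// setIT nuE// integral_mkcond; apply: eq_integral => x _.
rewrite patchE; case: ifPn => xE; rewrite numfun.indicE; first by rewrite xE mul1e.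
by rewrite (negbTE xE) mul0e.
Qed.

Let nnsfunE (f : {nnsfun T >-> R}) :
  (\int[nu]_x (f x)%:E = \int[mu]_x ((f x)%:E * (p x)%:E))%E.
Proof.
under [LHS]eq_integral do rewrite fimfunE -fsumEFin//.
rewrite [LHS]ge0_integral_fsum//; last 2 first.
  - by move=> r; exact/measurable_EFinP/measurableT_comp.
  - by move=> n x _; rewrite EFinM nnfun_muleindic_ge0.
under [RHS]eq_integral.
  move=> x xD; rewrite fimfunE -fsumEFin// ge0_mule_fsuml; last first.
    by move=> r; rewrite EFinM nnfun_muleindic_ge0.
  over.
rewrite [RHS]ge0_integral_fsum//; last 2 first.
  - move=> r; apply: emeasurable_funM => //.
    by apply/measurable_EFinP; exact: measurableT_comp.
  - move=> n x _; rewrite EFinM mule_ge0//; last by rewrite lee_fin.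
    by rewrite nnfun_muleindic_ge0.
apply: eq_fsbigr => r _; have [r0|r0] := ltP r 0.
  have fr : f @^-1` [set r] = set0.
    by apply/seteqP; split => // x /= fxr; move: r0; rewrite ltNge -fxr fun_ge0.
  by rewrite fr; under eq_integral do rewrite indic0 mulr0;
    under [RHS]eq_integral do rewrite indic0 mulr0 mul0e; rewrite !integral0.
under eq_integral do rewrite EFinM.
under [RHS]eq_integral do rewrite EFinM -muleA.
rewrite !ge0_integralZl//.
- by rewrite indicE.
- by apply: emeasurable_funM => //; exact/measurable_EFinP.
- by move=> x _; rewrite mule_ge0// lee_fin.
- exact/measurable_EFinP.
Qed.

(** The climb from indicators through simple functions to monotone limits. It translates integrals
    against the normal and Gamma laws into Lebesgue integrals. *)
Lemma ge0_integral_density (f : T -> \bar R) : measurable_fun setT f ->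
  (forall x, 0 <= f x)%E ->
  (\int[nu]_x f x = \int[mu]_x (f x * (p x)%:E))%E.
Proof.
move=> mf f0; pose f_ := nnsfun_approx measurableT mf.
transitivity (lim (\int[nu]_x (f_ n x)%:E @[n --> \oo])%E).
  rewrite -monotone_convergence//=.
  - apply: eq_integral => ? /[!inE] xD; apply/esym/cvg_lim => //=.
    exact: cvg_nnsfun_approx.
  - by move=> n; exact/measurable_EFinP/measurable_funTS.
  - by move=> n ? _; rewrite lee_fin.
  - by move=> ? _ ? ? mn; rewrite lee_fin; exact/lefP/nd_nnsfun_approx.
under eq_fun do rewrite nnsfunE.
rewrite -monotone_convergence//=.
- apply: eq_integral => x _; apply/cvg_lim => //.
  by apply: cvgeZr => //; exact: cvg_nnsfun_approx.
- by move=> n; apply: emeasurable_funM => //; exact/measurable_EFinP/measurable_funTS.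
- by move=> n ? _; rewrite mule_ge0// lee_fin.
- move=> x _ ? ? mn; apply: lee_wpmul2r; rewrite ?lee_fin//.
  exact/lefP/nd_nnsfun_approx.
Qed.

Lemma integrable_density (f : T -> R) : measurable_fun setT f ->
  mu.-integrable setT (EFin \o (fun x => f x * p x)) -> nu.-integrable setT (EFin \o f).
Proof.
move=> mf /integrableP[_ h]; apply/integrableP; split; first exact/measurable_EFinP.
rewrite ge0_integral_density//; last by apply: measurableT_comp => //; exact/measurable_EFinP.
apply: le_lt_trans h; apply: ge0_le_integral => //.
- by move=> x _; rewrite mule_ge0// lee_fin.
- apply: emeasurable_funM => //; apply: measurableT_comp => //; exact/measurable_EFinP.
- apply: measurableT_comp => //; apply/measurable_EFinP; exact: measurable_funM.
- by move=> x _ /=; rewrite lee_fin normrM (ger0_norm (p0 x)).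
Qed.

Lemma Rintegral_density (f : T -> R) : measurable_fun setT f ->
  mu.-integrable setT (EFin \o (fun x => f x * p x)) ->
  \int[nu]_x f x = \int[mu]_x (f x * p x).
Proof.
move=> mf ifp; rewrite /Rintegral; congr fine.
rewrite integralE [RHS]integralE; congr (_ - _)%E.
- rewrite ge0_integral_density//; last exact/measurable_funepos/measurable_EFinP.
  apply: eq_integral => x _; rewrite !funeposE -!EFin_max -EFinM maxr_pMl//.
  by rewrite mul0r.
- rewrite ge0_integral_density//; last exact/measurable_funeneg/measurable_EFinP.
  apply: eq_integral => x _; rewrite !funenegE -!EFinN -!EFin_max -EFinM maxr_pMl//.
  by rewrite mul0r mulNr.
Qed.

End density.

Section gaussian_ibp.
Context {R : realType}.
Local Notation mu := (@lebesgue_measure R).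
Local Notation phi := (@normal_pdf R 0 1).
Local Notation N := (@normal_prob R 0 1).
Implicit Types (f F : R -> R) (x : R).

Let phiE x : phi x = normal_peak (1 : R) * expR (- (x * x) / 2).
Proof.
rewrite /normal_pdf oner_eq0 /normal_fun subr0 expr1n expr2.
by [].
Qed.

Lemma is_derive_normal_pdf x : is_derive x 1 phi (- x * phi x).
Proof.
have -> : phi = (fun x => normal_peak (1 : R) * expR (- (x * x) / 2)) by apply/funext => y; exact: phiE.
apply: (is_derive1_eq (is_derive1M (is_derive1_cst x _) (is_derive1_exp
  (is_derive1M (is_derive1N (is_derive1M (is_derive1_id x) (is_derive1_id x))) (is_derive1_cst x 2^-1))))).
by field.
Qed.

Lemma normal_pdf_poly_bound n : exists2 K, 0 < K &
  forall x, (1 + x ^+ 2) ^+ n * phi x <= K * expR (- (x * x) / 4).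
Proof.
have [K K0 hK] := @pow_exp_bound R n 4 ltac:(by []).
have pk := @normal_peak_gt0 R 1 (oner_neq0 _).
exists (normal_peak (1 : R) * K); first by rewrite mulr_gt0.
move=> x; rewrite phiE mulrCA -mulrA ler_pM2l//.
have -> : - (x * x) / 2 = - (x * x) / 4 + - (x * x) / 4 by field.
rewrite expRD mulrA ler_pM2r ?expR_gt0// expr2; apply: hK.
by rewrite -expr2 sqr_ge0.
Qed.

Lemma integrable_normal_poly n : mu.-integrable setT (EFin \o (fun x => (1 + x ^+ 2) ^+ n * phi x)).
Proof.
have [K K0 hK] := normal_pdf_poly_bound n.
(* The remaining factor exp(-x^2 / 4) is a multiple of the normal density of standard deviation sqrt
   2, hence integrable. *)
have s20 : Num.sqrt 2 != 0 :> R by rewrite sqrtr_eq0 -ltNge.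
have pk := @normal_peak_gt0 R _ s20.
have i2 := @integrableZl _ _ _ mu setT measurableT (K / normal_peak (Num.sqrt 2)) _
  (@integrable_normal_pdf R 0 (Num.sqrt 2)).
apply: le_integrable i2 => //.
- apply/measurable_EFinP; apply: measurable_funM; last exact: measurable_normal_pdf.
  apply: measurable_funX; apply: measurable_funD => //; exact: measurable_funX.
- move=> x _ /=; rewrite lee_fin ger0_norm; last first.
    by rewrite mulr_ge0 ?normal_pdf_ge0// exprn_ge0// addr_ge0// sqr_ge0.
  apply: (le_trans (hK x)); apply: le_trans (ler_norm _).
  rewrite /normal_pdf (negbTE s20) /normal_fun subr0 sqr_sqrtr// -expr2 -[2 *+ 2]/(2 + 2 : R).
  have -> : 2 + 2 = 4 :> R by ring.
  by rewrite mulrA divfK// gt_eqF.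
Qed.

Lemma integrable_normal_bounded f K n : measurable_fun setT f ->
  (forall x, `|f x| <= K * (1 + x ^+ 2) ^+ n) ->
  mu.-integrable setT (EFin \o (fun x => f x * phi x)).
Proof.
move=> mf hf.
have i := @integrableZl _ _ _ mu setT measurableT K _ (integrable_normal_poly n).
apply: le_integrable i => //.
  by apply/measurable_EFinP; apply: measurable_funM => //; exact: measurable_normal_pdf.
move=> x _ /=; rewrite lee_fin; apply: le_trans (ler_norm _).
by rewrite normrM (ger0_norm (normal_pdf_ge0 _ _ _)) mulrA ler_wpM2r ?normal_pdf_ge0.
Qed.

Lemma bigcup_symmetric : [set: R] = \bigcup_n `[- (n.+1%:R), n.+1%:R : R]%classic.
Proof.
apply/esym; rewrite -subTset => x _; have [n hn] := lt_bound_nat `|x|.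
exists n => //=; rewrite in_itv/= -ler_norml; apply: (le_trans hn).
by rewrite ler_nat.
Qed.

Lemma cvg0_normal_bounded f K n (u : R^nat) : (forall x, `|f x| <= K * (1 + x ^+ 2) ^+ n) ->
  (forall k, u k ^+ 2 = (k.+1%:R) ^+ 2) -> f (u k) * phi (u k) @[k --> \oo] --> 0.
Proof.
move=> hf hu; have [L L0 hL] := normal_pdf_poly_bound n.
have K0 : 0 <= K.
  by have := le_trans (normr_ge0 _) (hf 0); rewrite expr0n/= addr0 expr1n mulr1.
apply/norm_cvg0P; apply: (@squeeze_cvgr _ _ _ _ (fun=> 0) (fun k => (K * L * 4) * k.+1%:R^-1)).
- near=> k; rewrite normr_ge0/= normrM (ger0_norm (normal_pdf_ge0 _ _ _)).
  apply: (@le_trans _ _ (K * (L * expR (- (u k * u k) / 4)))).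
    apply: (@le_trans _ _ (K * ((1 + u k ^+ 2) ^+ n * phi (u k)))).
      by rewrite mulrA ler_wpM2r ?normal_pdf_ge0.
    by rewrite ler_wpM2l.
  rewrite -!mulrA ler_wpM2l// ler_wpM2l ?(ltW L0)// -expr2 hu mulNr expRN.
  have k1 : 1 <= k.+1%:R :> R by rewrite ler1n.
  rewrite -[4 / _]invf_div lef_pV2 ?posrE ?expR_gt0 ?divr_gt0//.
  apply: le_trans (expR_ge1Dx _); rewrite -[leLHS]add0r; apply: lerD => //.
  by rewrite ler_pM2r// expr2 ler_peMr// (le_trans ler01).
- exact: cvg_cst.
- rewrite [X in _ --> X](_ : 0 = K * L * 4 * 0); last by rewrite mulr0.
  by apply: cvgM; [exact: cvg_cst|exact: cvg_harmonic].
Unshelve. all: by end_near. Qed.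

(** The function (F' - x F) phi is the derivative of F phi, which vanishes at both ends of the
    line. *)
Lemma normal_ibp F F' K n : (forall x, is_derive x 1 F (F' x)) ->
  (forall x, {for x, continuous F'}) ->
  (forall x, `|F x| <= K * (1 + x ^+ 2) ^+ n) ->
  (forall x, `|F' x| <= K * (1 + x ^+ 2) ^+ n) ->
  [/\ N.-integrable setT (EFin \o (fun x => x * F x)), N.-integrable setT (EFin \o F') &
   \int[N]_x (x * F x) = \int[N]_x F' x].
Proof.
move=> dF cF' bF bF'.
have K0 : 0 <= K.
  by have := le_trans (normr_ge0 _) (bF 0); rewrite expr0n/= addr0 expr1n mulr1.
have mF : measurable_fun setT F.
  by apply: continuous_measurable_fun => x; exact: is_derive1_continuous (dF x).
have mF' : measurable_fun setT F' by exact: continuous_measurable_fun.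
have mxF : measurable_fun setT (fun x => x * F x) by exact: measurable_funM.
have bxF x : `|x * F x| <= K * (1 + x ^+ 2) ^+ n.+1.
  rewrite normrM exprS mulrCA; apply: ler_pM => //.
  have -> : x ^+ 2 = `|x| ^+ 2 by rewrite real_normK ?num_real.
  have := normr_ge0 x; move: `|x| => t t0; nra.
have i1 := integrable_normal_bounded mxF bxF.
have i2 := integrable_normal_bounded mF' bF'.
have NE A : measurable A -> N A = (\int[mu]_(x in A) (phi x)%:E)%E by [].
have mphi := @measurable_normal_pdf R 0 1.
have phi0 := @normal_pdf_ge0 R 0 1.
have int := @integrable_density _ _ R mu N phi mphi phi0 NE.
have Rint := @Rintegral_density _ _ R mu N phi mphi phi0 NE.
split; [exact: int|exact: int|].
rewrite !Rint//.
apply/eqP; rewrite eq_sym -subr_eq0 -RintegralB//; apply/eqP.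
have dG x : is_derive x 1 (fun x => F x * phi x) (F' x * phi x - x * F x * phi x).
  by apply: (is_derive1_eq (is_derive1M (dF x) (is_derive_normal_pdf x))); ring.
rewrite /Rintegral.
have -> : (\int[mu]_x (F' x * phi x - x * F x * phi x)%:E = (0 - 0)%:E)%E.
  apply: (@integrable_FTC_exhaust _ _ (fun x => F x * phi x) _ _ _ 0 0 _ _ _ bigcup_symmetric).
  - by move=> k; rewrite (@lt_trans _ _ 0) ?oppr_lt0.
  - by move=> k m km; rewrite lerN2 ler_nat.
  - by move=> k m km; rewrite ler_nat.
  - move=> x _.
    have cphi := is_derive1_continuous (is_derive_normal_pdf x).
    apply: (@continuousB _ _ _ (fun x => F' x * phi x) (fun x => x * F x * phi x)).
      by apply: (@continuousM _ _ F' phi).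
    apply: (@continuousM _ _ (fun x => x * F x) phi) => //.
    exact: (is_derive1_continuous (is_derive1M (is_derive1_id x) (dF x))).
  - by apply: cvg0_normal_bounded bF _ => k; rewrite sqrrN.
  - exact: cvg0_normal_bounded bF _.
  - by apply: (integrableB measurableT i2 i1).
by rewrite subrr.
Qed.

End gaussian_ibp.

(** * Independence, product laws and measurability *)

Section independence.
Context d d' (T : measurableType d) (T' : measurableType d') (R : realType).
Variables (P : probability T R) (I : finType) (X : I -> {RV P >-> T'}).
Hypothesis indX : independent_RVs X.
Variable i : I.

(** A family closed under intersection that generates the sigma-algebra of all the variables except
    the i-th. *)
Definition others_cylinder : set_system T :=
  [set E | exists2 B : I -> set T', (forall j, measurable (B j)) &
     E = \bigcap_(j in [set j | j != i]) (X j @^-1` B j)].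

Lemma measurable_others_cylinder : others_cylinder `<=` measurable.
Proof.
move=> E [B mB ->]; apply: fin_bigcap_measurable.
  exact: finite_finset.
by move=> j _; rewrite -[X in measurable X]setTI; exact: measurable_funP.
Qed.

Lemma others_cylinder_preimage j (B : set T') : j != i -> measurable B ->
  others_cylinder (X j @^-1` B).
Proof.
move=> ji mB; exists (fun k => if k == j then B else setT).
  by move=> k; case: ifP.
apply/seteqP; split => [x xB k _|x]; first by rewrite /=; case: eqP => [->|].
by move=> /(_ j ji); rewrite /= eqxx.
Qed.

Let full_cylinder (B : I -> set T') (A : set T') :
  X i @^-1` A `&` \bigcap_(j in [set j | j != i]) (X j @^-1` B j) =
  \bigcap_(j in [set: I]) (X j @^-1` (if j == i then A else B j)).
Proof.
apply/seteqP; split => [x [xA h] j _|x h].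
  rewrite /=; case: eqP => [->//|/eqP ji]; exact: h.
split; first by have := h i Logic.I; rewrite /= eqxx.
by move=> j ji; have := h j Logic.I; rewrite /= (negbTE ji).
Qed.

Let prodE (B : I -> set T') (A : set T') : measurable A -> (forall j, measurable (B j)) ->
  P (X i @^-1` A `&` \bigcap_(j in [set j | j != i]) (X j @^-1` B j)) =
  (P (X i @^-1` A) * \prod_(j | j != i) P (X j @^-1` B j))%E.
Proof.
move=> mA mB; rewrite full_cylinder indX; last by move=> j; case: ifP.
rewrite (bigD1 i)//= eqxx; congr (_ * _)%E.
by apply: eq_bigr => j /negbTE ->.
Qed.

(** Both sides are finite measures in E that agree on the cylinders, so uniqueness of measures
    extends the product formula to the sigma-algebra they generate. *)
Lemma independent_others (A : set T') E : measurable A -> <<s others_cylinder >> E ->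
  P (X i @^-1` A `&` E) = (P (X i @^-1` A) * P E)%E.
Proof.
move=> mA sE.
have mXA : measurable (X i @^-1` A).
  by rewrite -[X in measurable X]setTI; exact: measurable_funP.
have r0 : 0 <= fine (P (X i @^-1` A)) by rewrite fine_ge0.
have PE : (fine (P (X i @^-1` A)))%:E = P (X i @^-1` A) by rewrite fineK// fin_num_measure.
have H := @g_sigma_algebra_measure_unique _ _ _ others_cylinder measurable_others_cylinder
  (fun=> setT) _ _ (mrestr P mXA) (mscale (NngNum r0) P) _ _ _ E sE.
have : mrestr P mXA E = mscale (NngNum r0) P E.
  apply: H.
  - move=> _; exists (fun=> setT) => //.
    by apply/seteqP; split.
  - by rewrite bigcup_const.
  - move=> E1 E2 [B1 mB1 ->] [B2 mB2 ->]; exists (fun j => B1 j `&` B2 j).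
      by move=> j; exact: measurableI.
    by rewrite -bigcapI.
  - move=> _ [B mB ->]; rewrite /= /mrestr /mscale/= PE setIC prodE//; congr (_ * _)%E.
    have := @prodE B setT measurableT mB.
    by rewrite preimage_setT setTI probability_setT mul1e => ->.
  - by move=> _; rewrite /= /mrestr setTI ltey_eq fin_num_measure.
by rewrite /= /mrestr /mscale/= PE setIC.
Qed.

End independence.

Section product_law.
Context d d1 d2 (T : measurableType d) (T1 : measurableType d1) (T2 : measurableType d2)
  (R : realType).
Variables (P : probability T R) (X : {RV P >-> T1}) (V : {RV P >-> T2}).
Hypothesis XV : forall A B, measurable A -> measurable B ->
  P (X @^-1` A `&` V @^-1` B) = (P (X @^-1` A) * P (V @^-1` B))%E.

Let Z w := (X w, V w).

Let mZ : measurable_fun setT Z.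
Proof. by apply/measurable_fun_pairP; split; exact: measurable_funP. Qed.

Lemma product_law C : measurable C ->
  (distribution P X \x distribution P V)%E C = pushforward P Z C.
Proof.
move=> mC; pose Zmf := isMeasurableFun.Build _ _ _ _ Z mZ.
pose Zp : {mfun T >-> (T1 * T2)%type} := HB.pack Z Zmf.
rewrite (@product_measure_unique _ _ _ _ _ (distribution P X) (distribution P V)
  (distribution P Zp))//.
Qed.

(** Fubini for the joint law, with [X] innermost: [V] will carry everything that stays frozen while
    [X] is integrated by parts. *)
Lemma integral_product_law (F : T1 * T2 -> R) : measurable_fun setT F ->
  P.-integrable setT (EFin \o (fun w => F (X w, V w))) ->
  (\int[P]_w (F (X w, V w))%:E =
   \int[distribution P V]_v \int[distribution P X]_x (F (x, v))%:E)%E.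
Proof.
move=> mF iF; have mEF : measurable_fun setT (EFin \o F) by exact/measurable_EFinP.
pose Zmf := isMeasurableFun.Build _ _ _ _ Z mZ.
pose Zp : {mfun T >-> (T1 * T2)%type} := HB.pack Z Zmf.
have i1 : (distribution P Zp).-integrable setT (EFin \o F).
  by apply: (integrable_pushforward mZ mEF) => //; rewrite preimage_setT.
have E C : measurable C -> C `<=` setT ->
    (distribution P X \x distribution P V)%E C = distribution P Zp C.
  by move=> mC _; exact: product_law.
have i2 : (distribution P X \x distribution P V)%E.-integrable setT (EFin \o F).
  apply/integrableP; split=> //; move/integrableP : i1 => [_].
  by rewrite -(eq_measure_integral _ E).
transitivity (\int[distribution P Zp]_z (F z)%:E)%E.
  by rewrite (integral_pushforward mZ mEF)// preimage_setT.
rewrite -(eq_measure_integral _ E) -integral21_prod_meas1//.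
Qed.

End product_law.

Section measurable_matrices.
Context (R : realType) (m n : nat).

Lemma measurable_mx d (T : measurableType d) (f : T -> 'M[R]_(m, n)) :
  (forall i j, measurable_fun setT (fun w => f w i j)) -> measurable_fun setT f.
Proof.
move=> mf; apply: (@measurability _ _ _ _ _ _ (@mx_cylinder R m n)) => //.
move=> _ [_ [i [j [B mB ->]]] <-].
exact: mf.
Qed.

Lemma measurable_coordinates d (T : measurableType d) (f : T -> 'M[R]_(m, n)) i j :
  measurable_fun setT f -> measurable_fun setT (fun w => f w i j).
Proof. by move=> mf; exact: (measurableT_comp (measurable_coord i j) mf). Qed.

End measurable_matrices.

Section power_mean.
Context {R : realType}.

(** The base on the left is at most |I| times 1 plus the largest term; the leading 1 on the right
    covers an empty index set. The lemma reduces moments of a sum to moments of its terms. *)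
Lemma power_mean_bound (I : finType) (x : I -> R) (m : nat) : (forall i, 0 <= x i) ->
  (1 + \sum_i x i) ^+ m <= 1 + #|I|%:R ^+ m * \sum_i (1 + x i) ^+ m.
Proof.
move=> x0; have [I0|I0] := posnP #|I|.
  rewrite !big_pred0; last 2 first.
  - by move=> i; have := card0_eq I0 i; rewrite !inE.
  - by move=> i; have := card0_eq I0 i; rewrite !inE.
  by rewrite addr0 expr1n mulr0 addr0.
have [i0 _] : exists i : I, i \in I by apply/card_gt0P.
pose k := [arg max_(i > i0) x i]%O.
have hk i : x i <= x k by rewrite /k; case: arg_maxP => // j _ h; exact: h.
have N0 : 1 <= #|I|%:R :> R by rewrite ler1n.
have h1 : 1 + \sum_i x i <= #|I|%:R * (1 + x k).
  rewrite mulrDr mulr1; apply: lerD => //.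
  apply: (@le_trans _ _ (\sum_(i : I) x k)); first by apply: ler_sum => i _; exact: hk.
  by rewrite sumr_const mulr_natl.
apply: (@le_trans _ _ ((#|I|%:R * (1 + x k)) ^+ m)).
  apply: lerXn2r; rewrite ?nnegrE ?addr_ge0 ?sumr_ge0 ?mulr_ge0 ?addr_ge0//.
rewrite exprMn -[leLHS]add0r; apply: lerD => //.
rewrite ler_wpM2l ?exprn_ge0// (bigD1 k)//= lerDl sumr_ge0// => i _.
by rewrite exprn_ge0// addr_ge0.
Qed.

End power_mean.

(** [measurableTypeR R] has the same measurable sets as [R] but is another structure, the one that
    carries the Lebesgue and normal measures. *)
Lemma measurable_toR d (T : measurableType d) (R : realType) (f : T -> R) :
  measurable_fun setT f -> measurable_fun setT (f : T -> measurableTypeR R).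
Proof. by move=> mf _ B mB; exact: mf. Qed.

Lemma integral_same_law dQ (T : measurableType dQ) (R : realType) (Q : probability T R)
    (X : {RV Q >-> R}) (N : {measure set (measurableTypeR R) -> \bar R}) (f : R -> \bar R) :
  measurable_fun setT f -> same_law (distribution Q X) N ->
  (\int[distribution Q X]_y f y = \int[N]_y f y)%E.
Proof.
move=> mf l.
have mX : measurable_fun setT (X : T -> measurableTypeR R).
  by apply: measurable_toR; exact: measurable_funP.
have E (g : R -> \bar R) : measurable_fun setT g -> (forall x, 0 <= g x)%E ->
    (\int[distribution Q X]_y g y = \int[N]_y g y)%E.
  move=> mg g0; rewrite ge0_integral_distribution//.
  have mg' : measurable_fun setT (g : measurableTypeR R -> \bar R).
    by move=> _ B mB; exact: mg.
  have := @ge0_integral_pushforward _ _ _ (measurableTypeR R) R X mX Q setT g measurableT mg' (fun y _ => g0 y).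
  rewrite preimage_setT => <-.
  by apply: eq_measure_integral => A mA _; rewrite -l.
rewrite integralE [RHS]integralE; congr (_ - _)%E; apply: E.
- exact: measurable_funepos.
- exact: funepos_ge0.
- exact: measurable_funeneg.
- exact: funeneg_ge0.
Qed.

(** * Functions of polynomial growth *)

Section poly_bounded.
Context {R : realType} {d : nat}.
Implicit Types (f : 'cV[R]_d -> R) (g v : 'cV[R]_d).

Definition sqn g : R := \sum_i g i 0 ^+ 2.

Lemma sqn_ge0 g : 0 <= sqn g.
Proof. by apply: sumr_ge0 => i _; exact: sqr_ge0. Qed.

Definition polyb f := exists K n, forall g, `|f g| <= K * (1 + sqn g) ^+ n.

Lemma polyb_const_ge0 f K n : (forall g, `|f g| <= K * (1 + sqn g) ^+ n) -> 0 <= K.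
Proof.
move=> h; have := le_trans (normr_ge0 _) (h 0).
rewrite /sqn big1 ?addr0 ?expr1n ?mulr1// => i _; rewrite mxE expr0n//.
Qed.

Let base_ge1 g : 1 <= 1 + sqn g.
Proof. by rewrite lerDl sqn_ge0. Qed.

Lemma polyb_le f1 f2 : (forall g, `|f1 g| <= `|f2 g|) -> polyb f2 -> polyb f1.
Proof. by move=> h [K [n hK]]; exists K, n => g; exact: le_trans (hK g). Qed.

Lemma polyb_cst c : polyb (fun=> c).
Proof. by exists `|c|, 0%N => g; rewrite expr0 mulr1. Qed.

Lemma polybD f1 f2 : polyb f1 -> polyb f2 -> polyb (fun g => f1 g + f2 g).
Proof.
move=> [K1 [n1 h1]] [K2 [n2 h2]]; exists (K1 + K2), (n1 + n2)%N => g.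
have k1 := polyb_const_ge0 h1; have k2 := polyb_const_ge0 h2.
apply: (le_trans (ler_normD _ _)); rewrite mulrDl; apply: lerD.
  apply: (le_trans (h1 g)); rewrite ler_wpM2l//; apply: ler_weXn2l => //; exact: leq_addr.
apply: (le_trans (h2 g)); rewrite ler_wpM2l//; apply: ler_weXn2l => //; exact: leq_addl.
Qed.

Lemma polybM f1 f2 : polyb f1 -> polyb f2 -> polyb (fun g => f1 g * f2 g).
Proof.
move=> [K1 [n1 h1]] [K2 [n2 h2]]; exists (K1 * K2), (n1 + n2)%N => g.
by rewrite normrM exprD mulrACA; apply: ler_pM.
Qed.

Lemma polyb_sum (I : finType) (F : I -> 'cV[R]_d -> R) : (forall i, polyb (F i)) ->
  polyb (fun g => \sum_i F i g).
Proof.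
move=> h; have -> : (fun g => \sum_i F i g) = \sum_i F i.
  by apply/funext => g; rewrite fct_sumE.
elim/big_ind : _ => //; [exact: polyb_cst|exact: polybD].
Qed.

Lemma polyb_coord i : polyb (fun g => g i 0).
Proof.
exists 1, 1%N => g; rewrite mul1r expr1.
have h : `|g i 0| ^+ 2 <= sqn g.
  by rewrite real_normK ?num_real// /sqn (bigD1 i)//= lerDl sumr_ge0// => j _; rewrite sqr_ge0.
have := normr_ge0 (g i 0); move: `|g i 0| h => t h t0; nra.
Qed.

Lemma polyb_linear (L : 'M[R]_d) k : polyb (fun g => (L *m g) k 0).
Proof.
have -> : (fun g => (L *m g) k 0) = (fun g => \sum_j L k j * g j 0) by apply/funext => g; rewrite mxE.
by apply: polyb_sum => j; apply: polybM; [exact: polyb_cst|exact: polyb_coord].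
Qed.

Lemma qformE (M : 'M[R]_d) g : qform M g = \sum_k g k 0 * (M *m g) k 0.
Proof.
rewrite /qform -mulmxA mxE; apply: eq_bigr => k _; by rewrite mxE.
Qed.

Lemma polyb_qform M : polyb (qform M).
Proof.
have -> : qform M = (fun g => \sum_k g k 0 * (M *m g) k 0) by apply/funext => g; rewrite qformE.
by apply: polyb_sum => k; apply: polybM; [exact: polyb_coord|exact: polyb_linear].
Qed.

Lemma sqnE g : sqn g = qform 1%:M g.
Proof. by rewrite qformE; apply: eq_bigr => k _; rewrite mul1mx expr2. Qed.

Lemma measurable_qform M : measurable_fun setT (qform M : 'cV[R]_d -> R).
Proof.
have -> : qform M = (fun g => \sum_k g k 0 * \sum_j (M k j * g j 0)).
  by apply/funext => g; rewrite qformE; apply: eq_bigr => k _; rewrite mxE.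
apply: measurable_sum => k; apply: measurable_funM; first exact: measurable_coord.
apply: measurable_sum => j; apply: measurable_funM => //; exact: measurable_coord.
Qed.

Lemma measurable_sqn : measurable_fun setT (sqn : 'cV[R]_d -> R).
Proof.
have -> : sqn = qform 1%:M by apply/funext => g; rewrite sqnE.
exact: measurable_qform.
Qed.

Definition basis_cV k : 'cV[R]_d := delta_mx k 0.

Lemma sqn_shift v t k : sqn (v + t *: basis_cV k) <= 2 * sqn v + 2 * t ^+ 2.
Proof.
have -> : t ^+ 2 = \sum_i (t * (i == k)%:R) ^+ 2.
  rewrite (bigD1 k)//= eqxx mulr1 big1 ?addr0// => i /negbTE ->.
  by rewrite mulr0 expr0n.
rewrite !mulr_sumr -big_split/=; apply: ler_sum => i _.
rewrite !mxE eqxx andbT; move: (v i 0) (t * _) => x y; have := sqr_ge0 (x - y).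
rewrite !expr2; lra.
Qed.

Lemma is_derive_linear_line (L : 'M[R]_d) i k v (t : R) :
  is_derive t 1 (fun t : R => (L *m (v + t *: basis_cV k)) i 0) (L i k).
Proof.
have -> : (fun t => (L *m (v + t *: basis_cV k)) i 0) = (fun t => (L *m v) i 0 + t * L i k).
  by apply/funext => u; rewrite mulmxDr -scalemxAr -colE !mxE.
apply: (is_derive1_eq (is_derive1D (is_derive1_cst t _) (is_derive1M (is_derive1_id t) (is_derive1_cst t _)))).
by ring.
Qed.

Lemma is_derive_qform_line (B : 'M[R]_d) k v (t : R) : B^T = B ->
  is_derive t 1 (fun t : R => qform B (v + t *: basis_cV k)) (2 * (B *m (v + t *: basis_cV k)) k 0).
Proof.
move=> Bs.
have e1 u : (u^T *m (B *m basis_cV k)) 0 0 = (B *m u) k 0.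
  have -> : u^T *m (B *m basis_cV k) = (B *m u)^T *m basis_cV k.
    by rewrite mulmxA trmx_mul Bs.
  by rewrite -colE !mxE.
have -> : (fun t => qform B (v + t *: basis_cV k)) =
    (fun t => qform B v + t * (2 * (B *m v) k 0) + t * t * B k k).
  apply/funext => u; rewrite /qform -!mulmxA linearD/= linearZ/= mulmxDl !mulmxDr.
  rewrite -!scalemxAr -!scalemxAl.
  have e2 : ((basis_cV k)^T *m (B *m v)) 0 0 = (B *m v) k 0.
    by rewrite trmx_delta -rowE mxE.
  have e3 : ((basis_cV k)^T *m (B *m basis_cV k)) 0 0 = B k k.
    by rewrite e1 -colE mxE.
  have e4 : 2 * (B *m v) k 0 = (v^T *m (B *m basis_cV k)) 0 0 + ((basis_cV k)^T *m (B *m v)) 0 0.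
    by rewrite e1 e2 mulr_natl mulr2n.
  rewrite e4 -e3.
  move: (_ *m _) (_^T *m _) (_^T *m _) (_ *m (B *m basis_cV k)) => X1 X2 X3 X4.
  by rewrite !mxE; ring.
apply: (is_derive1_eq (is_derive1D (is_derive1D (is_derive1_cst t _) (is_derive1M (is_derive1_id t) (is_derive1_cst t _)))
  (is_derive1M (is_derive1M (is_derive1_id t) (is_derive1_id t)) (is_derive1_cst t _)))).
by rewrite mulmxDr -scalemxAr -colE !mxE; ring.
Qed.

End poly_bounded.

Lemma measurable_comp_pos d (T : measurableType d) (R : realType) (phi : R -> R) (h : T -> R) :
  (forall x, 0 < x -> {for x, continuous phi}) -> measurable_fun setT h -> (forall w, 0 < h w) ->
  measurable_fun setT (fun w => phi (h w)).
Proof.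
move=> cphi mh h0; apply: (@measurable_comp _ _ _ _ _ _ `]0 : R, +oo[%classic phi setT h) => //.
- by move=> _ [w _ <-] /=; rewrite in_itv/= andbT.
- exact: measurable_pos.
Qed.

Lemma Rintegral_sum d (T : measurableType d) (R : realType) (mu : {measure set T -> \bar R})
    (I : finType) (F : I -> T -> R) : (forall i, mu.-integrable setT (EFin \o F i)) ->
  mu.-integrable setT (EFin \o (fun w => \sum_i F i w)) /\
  \int[mu]_w (\sum_i F i w) = \sum_i \int[mu]_w F i w.
Proof.
move=> iF; have key (s : seq I) : mu.-integrable setT (EFin \o (fun w => \sum_(i <- s) F i w)) /\
    \int[mu]_w (\sum_(i <- s) F i w) = \sum_(i <- s) \int[mu]_w F i w.
  elim: s => [|i s [IH1 IH2]].
    split; first by under [X in _.-integrable _ (_ \o X)]eq_fun do rewrite big_nil; exact: integrable0.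
    rewrite big_nil; under eq_Rintegral do rewrite big_nil.
    by rewrite /Rintegral integral0.
  under [X in _.-integrable _ (_ \o X)]eq_fun do rewrite big_cons.
  split.
    by apply: (integrableD measurableT (iF i) IH1).
  under eq_Rintegral do rewrite big_cons.
  by rewrite RintegralD// big_cons IH2.
exact: key.
Qed.

(** * Integration by parts for Gaussian vectors and samples *)

Section gaussian_vector.
Context dQ (T : measurableType dQ) (R : realType) (Q : probability T R) (d : nat).
Variable G : 'I_d -> {RV Q >-> R}.
Hypothesis indG : independent_RVs G.
Hypothesis lawG : forall i, same_law (distribution Q (G i)) (normal_prob 0 1).

Definition gvec w : 'cV[R]_d := \col_i G i w.

Lemma measurable_gvec : measurable_fun setT gvec.
Proof.
apply: measurable_mx => i j; under eq_fun do rewrite mxE.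
exact: measurable_funP.
Qed.

Lemma integrable_normal_law i (f : R -> R) : measurable_fun setT f ->
  (normal_prob 0 1).-integrable setT (EFin \o f) -> Q.-integrable setT (EFin \o (f \o G i)).
Proof.
move=> mf /integrableP[_ h]; apply/integrableP; split.
  by apply/measurable_EFinP; exact: measurableT_comp.
have mabs : measurable_fun setT (fun x => `|(f x)%:E|%E).
  by apply: measurableT_comp => //; exact/measurable_EFinP.
have /= <- := ge0_integral_distribution (G i) mabs (fun x => abse_ge0 _).
by rewrite (integral_same_law mabs (lawG i)).
Qed.

Lemma integrable_polyb (F : 'cV[R]_d -> R) : measurable_fun setT F -> polyb F ->
  Q.-integrable setT (EFin \o (F \o gvec)).
Proof.
move=> mF [K [n hF]]; have K0 := polyb_const_ge0 hF.
pose f (x : R) := (1 + x ^+ 2) ^+ n.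
have mf : measurable_fun setT f.
  by apply: measurable_funX; apply: measurable_funD => //; exact: measurable_funX.
have iN : (normal_prob 0 1).-integrable setT (EFin \o f).
  apply: (@integrable_density _ _ R lebesgue_measure (normal_prob 0 1) (normal_pdf 0 1)) => //.
  - exact: measurable_normal_pdf.
  - exact: normal_pdf_ge0.
  - exact: integrable_normal_poly.
have iG i := integrable_normal_law i mf iN.
have [iS _] := Rintegral_sum iG.
have i1 := @integrableZl _ _ _ Q setT measurableT K _ (integrableD measurableT
   (finite_measure_integrable_cst Q 1 measurableT) (@integrableZl _ _ _ Q setT measurableT
     (#|'I_d|%:R ^+ n) _ iS)).
apply: le_integrable i1 => //.
  by apply/measurable_EFinP; apply: measurableT_comp => //; exact: measurable_gvec.
move=> w _ /=; rewrite lee_fin; apply: le_trans (ler_norm _).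
apply: (le_trans (hF _)); rewrite ler_wpM2l//.
have := @power_mean_bound R 'I_d (fun i => G i w ^+ 2) n (fun i => sqr_ge0 _).
have -> : sqn (gvec w) = \sum_i G i w ^+ 2 by apply: eq_bigr => i _; rewrite mxE.
by [].
Qed.

Let rest k w : 'cV[R]_d := \col_i (if i == k then 0 else G i w).

Let restE k w : gvec w = rest k w + G k w *: basis_cV k.
Proof.
apply/matrixP => i j; rewrite !mxE ord1 eqxx andbT; case: eqP => [->|_].
  by rewrite mulr1 add0r.
by rewrite mulr0 addr0.
Qed.

Let mrest k : measurable_fun setT (rest k).
Proof.
apply: measurable_mx => i j; under eq_fun do rewrite mxE.
by case: (i == k); [exact: measurable_cst|exact: measurable_funP].
Qed.

Let mrest_others k B : measurable B -> <<s others_cylinder G k >> (rest k @^-1` B).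
Proof.
move=> mB.
have : measurable_fun (setT : set (g_sigma_algebraType (others_cylinder G k))) (rest k).
  apply: measurable_mx => i j; under eq_fun do rewrite mxE.
  case: (eqVneq i k) => [_|ik]; first exact: measurable_cst.
  move=> _ C mC; rewrite setTI; apply: sub_sigma_algebra.
  exact: others_cylinder_preimage.
by move=> /(_ measurableT B mB); rewrite setTI.
Qed.

(** The vector is [rest k], a function of the other coordinates, plus an independent multiple of a
    basis vector. Fubini freezes [rest k] at v, and the one-dimensional formula applies along the
    line through v. *)
Lemma gaussian_ibp_coord k (F DF : 'cV[R]_d -> R) : measurable_fun setT F ->
  measurable_fun setT DF -> polyb F -> polyb DF ->
  (forall v (t : R), is_derive t 1 (fun t : R => F (v + t *: basis_cV k)) (DF (v + t *: basis_cV k))) ->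
  (forall v (t : R), {for t, continuous (fun t : R => DF (v + t *: basis_cV k))}) ->
  \int[Q]_w (G k w * F (gvec w)) = \int[Q]_w (DF (gvec w)).
Proof.
move=> mF mDF pF pDF dF cDF.
pose Vmf := isMeasurableFun.Build _ _ _ _ (rest k) (mrest k).
pose V : {RV Q >-> 'cV[R]_d} := HB.pack (rest k) Vmf.
have XV A B : measurable A -> measurable B ->
    Q (G k @^-1` A `&` V @^-1` B) = (Q (G k @^-1` A) * Q (V @^-1` B))%E.
  by move=> mA mB; apply: (independent_others indG mA); exact: mrest_others.
have mshift : measurable_fun setT (fun z : R * 'cV[R]_d => z.2 + z.1 *: basis_cV k).
  apply: measurable_mx => i j; under eq_fun do rewrite !mxE.
  apply: measurable_funD; last by apply: measurable_funM => //; exact: measurable_fst.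
  by apply: measurable_coordinates; exact: measurable_snd.
have mF1 : measurable_fun setT (fun z : R * 'cV[R]_d => z.1 * F (z.2 + z.1 *: basis_cV k)).
  by apply: measurable_funM; [exact: measurable_fst|exact: (measurableT_comp mF mshift)].
have mF2 : measurable_fun setT (fun z : R * 'cV[R]_d => DF (z.2 + z.1 *: basis_cV k)).
  exact: (measurableT_comp mDF mshift).
have i1 : Q.-integrable setT (EFin \o (fun w => G k w * F (gvec w))).
  have m1 : measurable_fun setT (fun g : 'cV[R]_d => g k 0 * F g).
    by apply: measurable_funM => //; exact: measurable_coord.
  have := integrable_polyb m1 (polybM (polyb_coord k) pF).
  by under [X in _.-integrable _ (_ \o X) -> _]eq_fun do rewrite /= mxE.
have i2 := integrable_polyb mDF pDF.
rewrite /Rintegral; congr fine.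
have E1 : (\int[Q]_w (G k w * F (gvec w))%:E =
   \int[Q]_w ((fun z : R * 'cV[R]_d => z.1 * F (z.2 + z.1 *: basis_cV k)) (G k w, V w))%:E)%E.
  by apply: eq_integral => w _ /=; rewrite -restE.
have E2 : (\int[Q]_w (DF (gvec w))%:E =
   \int[Q]_w ((fun z : R * 'cV[R]_d => DF (z.2 + z.1 *: basis_cV k)) (G k w, V w))%:E)%E.
  by apply: eq_integral => w _ /=; rewrite -restE.
rewrite E1 E2 (integral_product_law XV mF1); last first.
  by move: i1; under [X in _.-integrable _ (_ \o X) -> _]eq_fun do rewrite /= (restE k).
rewrite (integral_product_law XV mF2); last first.
  by move: i2; under [X in _.-integrable _ (_ \o X) -> _]eq_fun do rewrite /= (restE k).
apply: eq_integral => v _ /=.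
rewrite (@integral_same_law _ _ _ _ _ (normal_prob 0 1) _ _ (lawG k)); last first.
  by apply/measurable_EFinP; exact: (measurable_fun_pair1 v mF1).
rewrite (@integral_same_law _ _ _ _ _ (normal_prob 0 1) _ _ (lawG k)); last first.
  by apply/measurable_EFinP; exact: (measurable_fun_pair1 v mF2).
have [K1 [n1 h1]] := pF; have [K2 [n2 h2]] := pDF.
have k1 := polyb_const_ge0 h1; have k2 := polyb_const_ge0 h2.
have vb : 1 <= 2 + 2 * sqn v by have := sqn_ge0 v; lra.
pose K := (K1 + K2) * (2 + 2 * sqn v) ^+ (n1 + n2).
have bnd (L : R) m x : 0 <= L <= K1 + K2 -> (m <= n1 + n2)%N ->
    L * (1 + sqn (v + x *: basis_cV k)) ^+ m <= K * (1 + x ^+ 2) ^+ (n1 + n2).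
  move=> /andP[L0 LK] mn; rewrite /K -mulrA -exprMn; apply: ler_pM => //.
    by rewrite exprn_ge0// addr_ge0// sqn_ge0.
  have b1 : 1 <= 1 + sqn (v + x *: basis_cV k) by rewrite lerDl sqn_ge0.
  apply: (@le_trans _ _ ((1 + sqn (v + x *: basis_cV k)) ^+ (n1 + n2))).
    exact: ler_weXn2l.
  have le1 : 1 + sqn (v + x *: basis_cV k) <= (2 + 2 * sqn v) * (1 + x ^+ 2).
    have := sqn_shift v x k; have := sqr_ge0 x; have := sqn_ge0 v; nra.
  have b0 := le_trans ler01 b1.
  by apply: lerXn2r => //; rewrite nnegrE (le_trans b0).
have [] := @normal_ibp R _ _ K (n1 + n2) (dF v) (cDF v).
- move=> x; apply: (le_trans (h1 _)); apply: bnd; last exact: leq_addr.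
  by rewrite k1 lerDl.
- move=> x; apply: (le_trans (h2 _)); apply: bnd; last exact: leq_addl.
  by rewrite k2 lerDr.
move=> j1 j2 j3; rewrite -[LHS]fineK; last exact: (integrable_fin_num measurableT j1).
rewrite -[RHS]fineK; last exact: (integrable_fin_num measurableT j2).
by congr EFin.
Qed.

End gaussian_vector.

Lemma integral_law d d1 d' (T : measurableType d) (T1 : measurableType d1) (T' : measurableType d')
    (R : realType) (P : probability T R) (Q : probability T1 R) (X : {RV P >-> T'}) (Y : T1 -> T')
    (f : T' -> \bar R) : measurable_fun setT Y -> measurable_fun setT f ->
  same_law (distribution P X) (pushforward Q Y) ->
  (\int[distribution P X]_x f x = \int[Q]_w f (Y w))%E.
Proof.
move=> mY mf l.
have E (g : T' -> \bar R) : measurable_fun setT g -> (forall x, 0 <= g x)%E ->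
    (\int[distribution P X]_x g x = \int[Q]_w g (Y w))%E.
  move=> mg g0.
  have := @ge0_integral_pushforward _ _ _ _ R Y mY Q setT g measurableT mg (fun y _ => g0 y).
  rewrite preimage_setT => <-.
  by apply: eq_measure_integral => A mA _; exact: l.
rewrite integralE [RHS]integralE; congr (_ - _)%E.
- transitivity (\int[Q]_w f^\+ (Y w))%E; first by apply: E => //; exact: measurable_funepos.
  by apply: eq_integral => w _; rewrite !funeposE.
- transitivity (\int[Q]_w f^\- (Y w))%E; first by apply: E => //; exact: measurable_funeneg.
  by apply: eq_integral => w _; rewrite !funenegE.
Qed.

Lemma integral_distr d d' (T : measurableType d) (T' : measurableType d')
    (R : realType) (P : probability T R) (X : {RV P >-> T'}) (f : T' -> \bar R) :
  measurable_fun setT f -> (\int[distribution P X]_x f x = \int[P]_w f (X w))%E.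
Proof. by move=> mf; apply: integral_law => //; exact: measurable_funP. Qed.

Lemma integrable_law d d1 d' (T : measurableType d) (T1 : measurableType d1) (T' : measurableType d')
    (R : realType) (P : probability T R) (Q : probability T1 R) (X : {RV P >-> T'}) (Y : T1 -> T')
    (f : T' -> R) : measurable_fun setT Y -> measurable_fun setT f ->
  same_law (distribution P X) (pushforward Q Y) ->
  Q.-integrable setT (EFin \o (f \o Y)) -> P.-integrable setT (EFin \o (f \o X)).
Proof.
move=> mY mf l /integrableP[_ i1]; apply/integrableP; split.
  by apply/measurable_EFinP; apply: measurableT_comp => //; exact: measurable_funP.
have mg : measurable_fun setT (fun x => `|(f x)%:E|%E).
  by apply: measurableT_comp => //; exact/measurable_EFinP.
by rewrite -(integral_distr X mg) (integral_law mY mg l).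
Qed.

Section multinormal.
Context dP (T : measurableType dP) (R : realType) (P : probability T R) (d : nat).
Variables (S : 'M[R]_d) (Z : {RV P >-> 'cV[R]_d}).
Hypothesis SZ : is_multinormal S Z.

Lemma polybX (f : 'cV[R]_d -> R) n : polyb f -> polyb (fun g => f g ^+ n).
Proof.
move=> pf; elim: n => [|n IH]; first by under eq_fun do rewrite expr0; exact: polyb_cst.
by under eq_fun do rewrite exprS; exact: polybM.
Qed.

Lemma polyb_mulmx (A : 'M[R]_d) (f : 'cV[R]_d -> R) : polyb f -> polyb (fun g => f (A *m g)).
Proof.
move=> [K [n hK]].
apply: (@polyb_le _ _ _ (fun g => K * (1 + sqn (A *m g)) ^+ n)).
  by move=> g; rewrite (le_trans (hK _))// ler_norm.
apply: polybM; first exact: polyb_cst.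
apply: polybX; apply: polybD; first exact: polyb_cst.
by apply: polyb_sum => i; apply: polybX; exact: polyb_linear.
Qed.

Let measurable_Agvec dQ (T' : measurableType dQ) (Q : probability T' R) (G : 'I_d -> {RV Q >-> R})
    (A : 'M[R]_d) : measurable_fun setT (fun w => A *m gvec G w).
Proof.
apply: measurable_mx => i j; under eq_fun do rewrite mxE.
apply: measurable_sum => k; apply: measurable_funM => //.
by apply: measurable_coordinates; exact: measurable_gvec.
Qed.

Lemma integrable_multinormal (F : 'cV[R]_d -> R) : measurable_fun setT F -> polyb F ->
  P.-integrable setT (EFin \o (F \o Z)).
Proof.
move=> mF pF; have [A [_ [dQ [T' [Q [G [indG lawG lawZ]]]]]]] := SZ.
have mA := measurable_Agvec G A.
apply: (integrable_law mA mF lawZ).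
have mFA : measurable_fun setT (fun g => F (A *m g)).
  apply: (measurableT_comp mF).
  apply: measurable_mx => i j; under eq_fun do rewrite mxE.
  by apply: measurable_sum => k; apply: measurable_funM => //; exact: measurable_coord.
have h := integrable_polyb lawG mFA (polyb_mulmx A pF).
exact: h.
Qed.

Lemma polyb_linear_growth (phi : R -> R) r (h : 'cV[R]_d -> R) K :
  (forall x, r <= x -> `|phi x| <= K * (1 + x)) -> polyb h -> (forall g, 0 <= h g) ->
  polyb (fun g => phi (h g + r)).
Proof.
move=> hphi ph h0.
apply: (@polyb_le _ _ _ (fun g => K * (1 + (h g + r)))).
  by move=> g; rewrite (le_trans (hphi _ _)) ?lerDr// ler_norm.
by apply: polybM; [exact: polyb_cst|apply: polybD; [exact: polyb_cst|apply: polybD => //; exact: polyb_cst]].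
Qed.

(** With Z = A G and A A^T = S, put L = A^T M A and B = A^T A. The one-coordinate formula is applied
    to (L g)_k phi(g^T B g + r) and summed over k: the divergence has trace part tr L = tr(M S), and
    its gradient part pairs L g with 2 B g, where L B = A^T (M S) A. *)
Lemma multinormal_ibp (M : 'M[R]_d) (phi dphi : R -> R) r K : M^T = M -> 0 < r ->
  (forall x : R, 0 < x -> is_derive x 1 phi (dphi x)) ->
  (forall x : R, 0 < x -> {for x, continuous dphi}) ->
  (forall x, r <= x -> `|phi x| <= K * (1 + x)) ->
  (forall x, r <= x -> `|dphi x| <= K * (1 + x)) ->
  (\int[distribution P Z]_z (qform M z * phi (sqn z + r))%:E =
   \int[distribution P Z]_z (\tr (M *m S) * phi (sqn z + r) +
      2 * qform (M *m S) z * dphi (sqn z + r))%:E)%E.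
Proof.
move=> Ms r0 dph cdph bph bdph.
have cph x : 0 < x -> {for x, continuous phi} by move=> /dph/is_derive1_continuous.
have [A [AS [dQ [T' [Q [G [indG lawG lawZ]]]]]]] := SZ.
have mA := measurable_Agvec G A.
have sr0 (z : 'cV[R]_d) : 0 < sqn z + r by rewrite ltr_wpDl// sqn_ge0.
have msr : measurable_fun setT (fun z : 'cV[R]_d => sqn z + r).
  by apply: measurable_funD => //; exact: measurable_sqn.
have mph : measurable_fun setT (fun z : 'cV[R]_d => phi (sqn z + r)).
  exact: measurable_comp_pos.
have mdph : measurable_fun setT (fun z : 'cV[R]_d => dphi (sqn z + r)).
  exact: measurable_comp_pos.
rewrite !(integral_law mA _ lawZ); last 2 first.
- apply/measurable_EFinP; apply: measurable_funD; first by apply: measurable_funM.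
  by apply: measurable_funM => //; apply: measurable_funM => //; exact: measurable_qform.
- by apply/measurable_EFinP; apply: measurable_funM => //; exact: measurable_qform.
pose L := A^T *m M *m A; pose B := A^T *m A.
have Ls : L^T = L by rewrite /L !trmx_mul trmxK Ms mulmxA.
have Bs : B^T = B by rewrite /B trmx_mul trmxK.
have qA (N : 'M[R]_d) g : qform N (A *m g) = qform (A^T *m N *m A) g.
  by rewrite /qform trmx_mul !mulmxA.
have sqA g : sqn (A *m g) = qform B g by rewrite sqnE qA mulmx1.
have B0 g : 0 <= qform B g by rewrite -sqA sqn_ge0.
have Br0 g : 0 < qform B g + r by rewrite ltr_wpDl.
pose F k g := (L *m g) k 0 * phi (qform B g + r).
pose DF k g := L k k * phi (qform B g + r) +
  (L *m g) k 0 * (dphi (qform B g + r) * (2 * (B *m g) k 0)).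
have mlin (N : 'M[R]_d) k : measurable_fun setT (fun g : 'cV[R]_d => (N *m g) k 0).
  under eq_fun do rewrite mxE.
  by apply: measurable_sum => j; apply: measurable_funM => //; exact: measurable_coord.
have mB : measurable_fun setT (fun g : 'cV[R]_d => qform B g + r).
  by apply: measurable_funD => //; exact: measurable_qform.
have mphB : measurable_fun setT (fun g : 'cV[R]_d => phi (qform B g + r)).
  exact: measurable_comp_pos.
have mdphB : measurable_fun setT (fun g : 'cV[R]_d => dphi (qform B g + r)).
  exact: measurable_comp_pos.
have mF k : measurable_fun setT (F k) by apply: measurable_funM.
have mDF k : measurable_fun setT (DF k).
  by apply: measurable_funD; apply: measurable_funM => //; apply: measurable_funM => //;
    apply: measurable_funM.
have pph := polyb_linear_growth bph (polyb_qform B) B0.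
have pdph := polyb_linear_growth bdph (polyb_qform B) B0.
have pF k : polyb (F k) by apply: polybM => //; exact: polyb_linear.
have pDF k : polyb (DF k).
  apply: polybD; apply: polybM => //; [exact: polyb_cst|exact: polyb_linear|].
  by apply: polybM => //; apply: polybM; [exact: polyb_cst|exact: polyb_linear].
have dline k (v : 'cV[R]_d) (t : R) : is_derive t 1 (fun t : R => qform B (v + t *: basis_cV k) + r)
    (2 * (B *m (v + t *: basis_cV k)) k 0).
  apply: (is_derive1_eq (is_derive1D (is_derive_qform_line k v t Bs) (is_derive1_cst t r))).
  by rewrite addr0.
have dF k (v : 'cV[R]_d) (t : R) : is_derive t 1 (fun t : R => F k (v + t *: basis_cV k))
    (DF k (v + t *: basis_cV k)).
  pose q (t : R) := qform B (v + t *: basis_cV k) + r.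
  have dc : is_derive t 1 (fun t : R => phi (q t)) (dphi (q t) * (2 * (B *m (v + t *: basis_cV k)) k 0)).
    exact: (@is_derive1_chain R phi q t _ _ (dph (q t) (Br0 _)) (dline k v t)).
  apply: (is_derive1_eq (is_derive1M (is_derive_linear_line L k k v t) dc)).
  rewrite /DF; ring.
have clin (N : 'M[R]_d) k v (t : R) :
    {for t, continuous (fun t : R => (N *m (v + t *: basis_cV k)) k 0)}.
  exact: (is_derive1_continuous (is_derive_linear_line N k k v t)).
have cB k v (t : R) := is_derive1_continuous (dline k v t).
have cDF k v (t : R) : {for t, continuous (fun t : R => DF k (v + t *: basis_cV k))}.
  have c1 : {for t, continuous (fun t : R => phi (qform B (v + t *: basis_cV k) + r))}.
    by apply: (@continuous_comp _ _ _ _ phi); [exact: cB|exact: cph].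
  have c2 : {for t, continuous (fun t : R => dphi (qform B (v + t *: basis_cV k) + r))}.
    by apply: (@continuous_comp _ _ _ _ dphi); [exact: cB|exact: cdph].
  apply: cvgD; first by apply: cvgM => //; exact: cvg_cst.
  apply: cvgM; first exact: clin.
  by apply: cvgM => //; apply: cvgM; [exact: cvg_cst|exact: clin].
have ibp k := gaussian_ibp_coord indG lawG (mF k) (mDF k) (pF k) (pDF k) (@dF k) (@cDF k).
have iF k : Q.-integrable setT (EFin \o (fun w => G k w * F k (gvec G w))).
  have m1 : measurable_fun setT (fun g : 'cV[R]_d => g k 0 * F k g).
    by apply: measurable_funM => //; exact: measurable_coord.
  have := integrable_polyb lawG m1 (polybM (polyb_coord k) (pF k)).
  by under [X in _.-integrable _ (_ \o X) -> _]eq_fun do rewrite /= mxE.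
have iDF k := integrable_polyb lawG (mDF k) (pDF k).
have [i1 s1] := Rintegral_sum iF.
have [i2 s2] := Rintegral_sum iDF.
have s12 : (\int[Q]_w (\sum_k G k w * F k (gvec G w))%:E = \int[Q]_w (\sum_k DF k (gvec G w))%:E)%E.
  rewrite -[LHS]fineK; last exact: (integrable_fin_num measurableT i1).
  rewrite -[RHS]fineK; last exact: (integrable_fin_num measurableT i2).
  congr EFin; transitivity (\sum_k \int[Q]_w (G k w * F k (gvec G w))); first exact: s1.
  by under eq_bigr do rewrite ibp; exact: esym s2.
transitivity (\int[Q]_w (\sum_k G k w * F k (gvec G w))%:E)%E.
  apply: eq_integral => w _ /=; rewrite qA sqA qformE mulr_suml; congr EFin.
  by apply: eq_bigr => k _; rewrite /F mulrA mxE.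
rewrite s12; apply: eq_integral => w _ /=; congr EFin.
move: (gvec G w) => g; rewrite big_split/= -mulr_suml; rewrite addrC [RHS]addrC; congr (_ + _ * _).
rewrite sqA qA -AS.
have -> : A^T *m (M *m (A *m A^T)) *m A = L^T *m B by rewrite Ls /L /B !mulmxA.
have -> : qform (L^T *m B) g = \sum_k (L *m g) k 0 * (B *m g) k 0.
  rewrite /qform mulmxA -trmx_mul -mulmxA mxE; by apply: eq_bigr => k _; rewrite mxE.
rewrite mulr_sumr mulr_suml; apply: eq_bigr => k _; ring.
  by transitivity (\tr L) => //; rewrite /L [LHS]mxtrace_mulC mulmxA AS [LHS]mxtrace_mulC.
by rewrite sqA.
Qed.

End multinormal.

Section gaussian_sample.
Context dP (T : measurableType dP) (R : realType) (P : probability T R) (d n : nat).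
Variables (S : 'M[R]_d) (Z : 'I_n -> {RV P >-> 'cV[R]_d}).
Hypothesis indZ : independent_RVs Z.
Hypothesis SZ : forall i, is_multinormal S (Z i).

Definition sample_form (M : 'M[R]_d) w : R := \sum_i qform M (Z i w).

Definition sample_norm w : R := \sum_i sqn (Z i w).

Local Notation q := sample_form.
Local Notation W := sample_norm.

Lemma sample_form1 w : q 1%:M w = W w.
Proof. by apply: eq_bigr => i _; rewrite sqnE. Qed.

Lemma sample_norm_ge0 w : 0 <= W w.
Proof. by apply: sumr_ge0 => i _; exact: sqn_ge0. Qed.

Let mqi M i : measurable_fun setT (fun w => qform M (Z i w)).
Proof. by apply: (measurableT_comp (measurable_qform M)); exact: measurable_funP. Qed.

Let msi i : measurable_fun setT (fun w => sqn (Z i w)).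
Proof. by apply: (measurableT_comp (@measurable_sqn R d)); exact: measurable_funP. Qed.

Lemma measurable_sample_norm : measurable_fun setT W.
Proof. by apply: measurable_sum => i; exact: msi. Qed.

Lemma integrable_sample_norm_bound (f : T -> R) K m : measurable_fun setT f ->
  (forall w, `|f w| <= K * (1 + W w) ^+ m) -> P.-integrable setT (EFin \o f).
Proof.
move=> mf hf.
(* A point of [T] is used to deduce K >= 0; on an empty [T] integrability is trivial. *)
have [w0|noT] := pselect (exists w : T, True); last first.
  apply: (eq_integrable measurableT (fun=> 0%E)); last exact: integrable0.
  by move=> w _; exfalso; apply: noT; exists w.
have K0 : 0 <= K.
  have [w _] := w0; have h := le_trans (normr_ge0 _) (hf w).
  have p0 : 0 < (1 + W w) ^+ m by rewrite exprn_gt0// ltr_pwDl// sample_norm_ge0.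
  by rewrite (pmulr_lge0 _ p0) in h.
have i0 i : P.-integrable setT (EFin \o ((fun g => (1 + sqn g) ^+ m) \o Z i)).
  apply: (integrable_multinormal (SZ i)).
    apply: measurable_funX; apply: measurable_funD => //; exact: measurable_sqn.
  by exists 1, m => g; rewrite mul1r ger0_norm// exprn_ge0// addr_ge0// sqn_ge0.
have [iS _] := Rintegral_sum i0.
have i1 := @integrableZl _ _ _ P setT measurableT K _ (integrableD measurableT
   (finite_measure_integrable_cst P 1 measurableT) (@integrableZl _ _ _ P setT measurableT
     (#|'I_n|%:R ^+ m) _ iS)).
apply: le_integrable i1 => //; first exact/measurable_EFinP.
move=> w _ /=; rewrite lee_fin; apply: le_trans (ler_norm _).
apply: (le_trans (hf _)); rewrite ler_wpM2l//.
exact: (@power_mean_bound R 'I_n (fun i => sqn (Z i w)) m (fun i => sqn_ge0 _)).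
Qed.

Let le1W i w : 1 + sqn (Z i w) <= 1 + W w.
Proof. by rewrite lerD2l /W (bigD1 i)//= lerDl sumr_ge0// => j _; exact: sqn_ge0. Qed.

Section test_function.
Variables (phi : R -> R) (r K : R).
Hypothesis r0 : 0 < r.
Hypothesis cphi : forall x : R, 0 < x -> {for x, continuous phi}.
Hypothesis bphi : forall x, r <= x -> `|phi x| <= K * (1 + x).

Let Wr w : 0 < W w + r. Proof. by rewrite ltr_wpDl// sample_norm_ge0. Qed.

Lemma measurable_sample_test : measurable_fun setT (fun w => phi (W w + r)).
Proof.
apply: measurable_comp_pos => //.
by apply: measurable_funD => //; exact: measurable_sample_norm.
Qed.

Lemma integrable_sample_form_test_coord M i :
  P.-integrable setT (EFin \o (fun w => qform M (Z i w) * phi (W w + r))).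
Proof.
have [K1 [m hm]] := polyb_qform M; have k1 := polyb_const_ge0 hm.
apply: (@integrable_sample_norm_bound _ (K1 * (`|K| * (1 + r))) m.+1).
  by apply: measurable_funM => //; exact: measurable_sample_test.
move=> w; rewrite normrM exprSr mulrACA; apply: ler_pM => //.
  apply: (le_trans (hm _)); rewrite ler_wpM2l//; apply: lerXn2r => //.
    by rewrite nnegrE addr_ge0// sqn_ge0.
  by rewrite nnegrE addr_ge0// sample_norm_ge0.
apply: (le_trans (bphi _)); first by rewrite lerDr sample_norm_ge0.
apply: (@le_trans _ _ (`|K| * (1 + (W w + r)))).
  by rewrite ler_wpM2r ?ler_norm// addr_ge0// ltW.
rewrite -mulrA ler_wpM2l//; have := sample_norm_ge0 w; have := ltW r0; nra.
Qed.

Lemma integrable_sample_form_test M :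
  P.-integrable setT (EFin \o (fun w => q M w * phi (W w + r))).
Proof.
have [h _] := Rintegral_sum (integrable_sample_form_test_coord M).
apply: eq_integrable h => // w _ /=; by rewrite /q mulr_suml.
Qed.

Lemma integrable_sample_test : P.-integrable setT (EFin \o (fun w => phi (W w + r))).
Proof.
apply: (@integrable_sample_norm_bound _ (`|K| * (1 + r)) 1); first exact: measurable_sample_test.
move=> w; apply: (le_trans (bphi _)); first by rewrite lerDr sample_norm_ge0.
apply: (@le_trans _ _ (`|K| * (1 + (W w + r)))).
  by rewrite ler_wpM2r ?ler_norm// addr_ge0// ltW.
rewrite -mulrA ler_wpM2l//; have := sample_norm_ge0 w; have := ltW r0; nra.
Qed.

End test_function.

Let others i w : R := \sum_j (if j == i then 0 else sqn (Z j w)).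

Let mothers i : measurable_fun setT (others i).
Proof. by apply: measurable_sum => j; case: (j == i). Qed.

Let others_sigma i B : measurable B -> <<s others_cylinder Z i >> (others i @^-1` B).
Proof.
move=> mB.
have : measurable_fun (setT : set (g_sigma_algebraType (others_cylinder Z i))) (others i).
  apply: measurable_sum => j; case: (eqVneq j i) => [_|ji]; first exact: measurable_cst.
  apply: (measurableT_comp (@measurable_sqn R d)).
  move=> _ C mC; rewrite setTI; apply: sub_sigma_algebra.
  exact: others_cylinder_preimage.
by move=> /(_ measurableT B mB); rewrite setTI.
Qed.

Let sample_normE i w : W w = sqn (Z i w) + `|others i w|.
Proof.
rewrite ger0_norm; last first.
  by apply: sumr_ge0 => j _; case: ifP => // _; exact: sqn_ge0.
have -> : others i w = \sum_(j | j != i) sqn (Z j w).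
  rewrite /others (bigD1 i)//= eqxx add0r.
  by apply: eq_bigr => j /negbTE ->.
by rewrite /W (bigD1 i).
Qed.

(** Each summand is treated with the other vectors frozen. Their squared norms add to r in the
    argument of phi, which is why [multinormal_ibp] allows an arbitrary positive shift; the n trace
    terms then add up. *)
Lemma sample_form_ibp (M : 'M[R]_d) (phi dphi : R -> R) r K : M^T = M -> 0 < r ->
  (forall x : R, 0 < x -> is_derive x 1 phi (dphi x)) ->
  (forall x : R, 0 < x -> {for x, continuous dphi}) ->
  (forall x, r <= x -> `|phi x| <= K * (1 + x)) ->
  (forall x, r <= x -> `|dphi x| <= K * (1 + x)) ->
  \int[P]_w (q M w * phi (W w + r)) =
  n%:R * \tr (M *m S) * \int[P]_w (phi (W w + r)) +
    2 * \int[P]_w (q (M *m S) w * dphi (W w + r)).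
Proof.
move=> Ms r0 dph cdph bph bdph.
have cph x : 0 < x -> {for x, continuous phi} by move=> /dph/is_derive1_continuous.
have i1 := integrable_sample_form_test_coord r0 cph bph M.
have i2 := integrable_sample_form_test_coord r0 cdph bdph (M *m S).
have i3 := integrable_sample_test r0 cph bph.
have i4 : P.-integrable setT (EFin \o (fun w => \tr (M *m S) * phi (W w + r))).
  exact: (@integrableZl _ _ _ P setT measurableT (\tr (M *m S)) _ i3).
have i5 i : P.-integrable setT (EFin \o (fun w => 2 * (qform (M *m S) (Z i w) * dphi (W w + r)))).
  exact: (@integrableZl _ _ _ P setT measurableT 2 _ (i2 i)).
have E i : \int[P]_w (qform M (Z i w) * phi (W w + r)) =
    \tr (M *m S) * \int[P]_w (phi (W w + r)) +
    2 * \int[P]_w (qform (M *m S) (Z i w) * dphi (W w + r)).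
  rewrite -!RintegralZl// -RintegralD//.
  pose Vmf := isMeasurableFun.Build _ _ _ _ (others i) (mothers i).
  pose V : {RV P >-> R} := HB.pack (others i) Vmf.
  have XV A B : measurable A -> measurable B ->
      P (Z i @^-1` A `&` V @^-1` B) = (P (Z i @^-1` A) * P (V @^-1` B))%E.
    by move=> mA mB; apply: (independent_others indZ mA); exact: others_sigma.
  (* Under the product law the second coordinate runs over all of R. The absolute value keeps the
     argument of phi positive and changes nothing on the sample, where that coordinate is a sum of
     squares. *)
  pose h (z : 'cV[R]_d * R) := sqn z.1 + (`|z.2| + r).
  have h0 z : 0 < h z by rewrite ltr_wpDl ?sqn_ge0// ltr_wpDl.
  have mh : measurable_fun setT h.
    apply: measurable_funD; first by apply: (measurableT_comp (@measurable_sqn R d)); exact: measurable_fst.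
    by apply: measurable_funD => //; apply: measurableT_comp => //; exact: measurable_snd.
  have mq N : measurable_fun setT (fun z : 'cV[R]_d * R => qform N z.1).
    by apply: (measurableT_comp (measurable_qform N)); exact: measurable_fst.
  pose F1 z := qform M z.1 * phi (h z).
  pose F2 z := \tr (M *m S) * phi (h z) + 2 * qform (M *m S) z.1 * dphi (h z).
  have mF1 : measurable_fun setT F1 by apply: measurable_funM => //; exact: measurable_comp_pos.
  have mF2 : measurable_fun setT F2.
    apply: measurable_funD; apply: measurable_funM => //; try exact: measurable_comp_pos.
    exact: measurable_funM.
  have hW w : h (Z i w, V w) = W w + r by rewrite /h/= addrA -sample_normE.
  have e1 w : F1 (Z i w, V w) = qform M (Z i w) * phi (W w + r) by rewrite /F1 hW.
  have e2 w : F2 (Z i w, V w) =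
      \tr (M *m S) * phi (W w + r) + 2 * (qform (M *m S) (Z i w) * dphi (W w + r)).
    by rewrite /F2 hW mulrA.
  rewrite /Rintegral; congr fine.
  transitivity (\int[P]_w (F1 (Z i w, V w))%:E)%E; first by apply: eq_integral => w _; rewrite e1.
  transitivity (\int[P]_w (F2 (Z i w, V w))%:E)%E; last by apply: eq_integral => w _; rewrite e2.
  rewrite (integral_product_law XV mF1); last first.
    by apply: eq_integrable (i1 i) => // w _ /=; rewrite e1.
  rewrite (integral_product_law XV mF2); last first.
    by apply: eq_integrable (integrableD measurableT i4 (i5 i)) => // w _ /=; rewrite e2.
  apply: eq_integral => v _.
  have vr : r <= `|v| + r by rewrite lerDr.
  have v0 : 0 < `|v| + r by exact: lt_le_trans vr.
  exact: (multinormal_ibp (SZ i) Ms v0 dph cdph (fun x xv => bph x (le_trans vr xv))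
    (fun x xv => bdph x (le_trans vr xv))).
have [_ s1] := Rintegral_sum i1; have [_ s2] := Rintegral_sum i2.
transitivity (\sum_i \int[P]_w (qform M (Z i w) * phi (W w + r))).
  by rewrite -s1; apply: eq_Rintegral => w _; rewrite /q mulr_suml.
under eq_bigr do rewrite E.
rewrite big_split/= sumr_const card_ord -[_ *+ n]mulr_natl mulrA; congr (_ + _).
rewrite -mulr_sumr -s2; congr (_ * _).
by apply: eq_Rintegral => w _; rewrite /q mulr_suml.
Qed.

End gaussian_sample.

(** * The Stein operator applied to the trace *)

Section gamma_side.
Context {R : realType}.
Local Notation mu := (@lebesgue_measure R).
Variables a b : R.
Hypothesis a0 : 0 < a.
Hypothesis b0 : 0 < b.
Local Notation p := (gamma_pdf a b).

(** The integrand is b times the derivative of x p(x) f(x), which tends to 0 at both ends since f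
    grows at most linearly. *)
Lemma gamma_stein (f f1 k : R -> R) K :
  (forall x : R, 0 < x -> is_derive x 1 f (f1 x)) -> (forall x : R, 0 < x -> {for x, continuous k}) ->
  (forall x, 0 < x -> `|f x| <= K * (1 + x)) ->
  (forall x, 0 < x -> b * x * f1 x + (a * b - x) * f x = k x) ->
  mu.-integrable `]0%R, +oo[ (EFin \o (fun x => k x * p x)) ->
  \int[mu]_(x in `]0%R, +oo[) (k x * p x) = 0.
Proof.
move=> df ck bf E ik.
have K0 : 0 <= K by have := le_trans (normr_ge0 _) (bf 1 ltr01); lra.
pose H x := x * p x * f x.
have dH (x : R) : 0 < x -> is_derive x 1 H (b^-1 * (k x * p x)).
  move=> x0; apply: (is_derive1_eq (is_derive1M (is_derive_mul_gamma_pdf b a0 x0) (df _ x0))).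
  by rewrite -E//; field; rewrite gt_eqF.
have cH (x : R) : 0 < x -> {for x, continuous (fun x => b^-1 * (k x * p x))}.
  move=> x0; apply: cvgM; first exact: cvg_cst.
  by apply: cvgM; [exact: ck|exact: continuous_gamma_pdf].
have H0 : H x @[x --> 0^'+] --> 0.
  apply/norm_cvg0P; apply: (@squeeze_cvgr _ _ _ _ (fun=> 0) (fun x => x * p x * (2 * K))).
  - near=> x; have x0 : 0 < x by near: x; exact: nbhs_right_gt.
    have x1 : x <= 1 by near: x; exact: nbhs_right_le.
    rewrite normr_ge0/= normrM ger0_norm ?mulr_ge0 ?gamma_pdf_ge0 ?(ltW x0)//.
    rewrite ler_wpM2l ?mulr_ge0 ?gamma_pdf_ge0 ?(ltW x0)//.
    by apply: (le_trans (bf _ x0)); nra.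
  - exact: cvg_cst.
  - rewrite [X in _ --> X](_ : 0 = 0 * (2 * K)); last by rewrite mul0r.
    by apply: cvgM; [exact: cvg0_mul_gamma_pdf|exact: cvg_cst].
have Hy : H x @[x --> +oo] --> 0.
  have [K2 K20 hK] := gamma_pdf_bound a0 b0 2.
  apply: (@cvgy0_bound _ _ (K * K2)) => x x1; have x0 : 0 < x by lra.
  have px := gamma_pdf_ge0 a0 b0 x.
  rewrite /H normrM ger0_norm ?mulr_ge0 ?(ltW x0)//.
  apply: (@le_trans _ _ ((1 + x) * (x * p x * (K * (1 + x))))).
    rewrite ler_wpM2l//; first by lra.
    by rewrite ler_wpM2l ?mulr_ge0 ?(ltW x0)// bf.
  have -> : (1 + x) * (x * p x * (K * (1 + x))) = K * ((1 + x) ^+ 2 * (x * p x)) by ring.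
  rewrite ler_wpM2l//; apply: (le_trans (hK _ x0)).
  rewrite -[leRHS]mulr1 ler_wpM2l ?(ltW K20)// -expR0 ler_expR.
  by rewrite mulNr oppr_le0 divr_ge0 ?mulr_ge0// ltW.
have ik' : mu.-integrable `]0%R, +oo[ (EFin \o (fun x => b^-1 * (k x * p x))).
  by apply: (@integrableZl _ _ _ mu _ _ b^-1 _ ik).
have := integrable_FTC0y dH cH H0 Hy ik'; rewrite subrr => /(congr1 fine)/= e.
have : b^-1 * \int[mu]_(x in `]0%R, +oo[) (k x * p x) = 0.
  by rewrite -RintegralZl.
by move/eqP; rewrite mulf_eq0 invr_eq0 gt_eqF//= => /eqP.
Unshelve. all: by end_near. Qed.

Lemma integrable_gamma_growth (k : R -> R) K n :
  (forall x : R, 0 < x -> {for x, continuous k}) ->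
  (forall x, 0 < x -> `|k x| <= K * (1 + x) ^+ n) ->
  mu.-integrable `]0%R, +oo[ (EFin \o (fun x => k x * p x)).
Proof.
move=> ck bk.
have i1 := @integrableZl _ _ _ mu `]0 : R, +oo[%classic (measurable_itv _) K _ (integrable_poly_gamma_pdf a0 b0 n).
apply: le_integrable i1 => //.
  apply/measurable_EFinP; apply: measurable_pos => x x0.
  by apply: cvgM; [exact: ck|exact: continuous_gamma_pdf].
move=> x; rewrite /= in_itv/= andbT => x0; rewrite lee_fin; apply: le_trans (ler_norm _).
rewrite mulrA normrM [`|p x|]ger0_norm ?gamma_pdf_ge0//.
by rewrite ler_wpM2r ?gamma_pdf_ge0// bk.
Qed.

Lemma measurable_gamma_pdf : measurable_fun setT p.
Proof.
have -> : p = p \_ `]0 : R, +oo[%classic.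
  apply/funext => x; rewrite patchE; have [x0|x0] := ltP 0 x.
    by rewrite mem_set//= in_itv/= x0.
  by rewrite memNset/= ?in_itv/= ?andbT ?ltNge ?x0// /gamma_pdf ltNge x0.
apply/(measurable_restrictT _ (measurable_itv _)).
by apply: measurable_pos => x; exact: continuous_gamma_pdf.
Qed.

End gamma_side.

Section probability_bound.
Context d (T : measurableType d) (R : realType) (P : probability T R).

Lemma normr_Rintegral_le (f g : T -> R) : P.-integrable setT (EFin \o f) ->
  P.-integrable setT (EFin \o g) -> (forall w, `|f w| <= g w) ->
  `|\int[P]_w f w| <= \int[P]_w g w.
Proof.
move=> fi gi fg; apply: (le_trans (le_normr_Rintegral measurableT fi)).
apply: le_Rintegral => //; exact: (integrable_abse fi).
Qed.

Lemma Rintegral_prob_cst c : \int[P]_w c = c.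
Proof. by rewrite /Rintegral/= integral_cst//= probability_setT mule1. Qed.

Lemma normr_Rintegral_prob_le (f : T -> R) c : P.-integrable setT (EFin \o f) ->
  (forall w, `|f w| <= c) -> `|\int[P]_w f w| <= c.
Proof.
move=> fi fc; rewrite -[leRHS]Rintegral_prob_cst; apply: normr_Rintegral_le => //.
exact: finite_measure_integrable_cst.
Qed.

End probability_bound.

Section stein_operator.
Context dP (T : measurableType dP) (R : realType) (P : probability T R) (d n : nat).
Variables (S : 'M[R]_d) (Z : 'I_n -> {RV P >-> 'cV[R]_d}).
Hypothesis indZ : independent_RVs Z.
Hypothesis SZ : forall i, is_multinormal S (Z i).
Hypothesis Ssym : S \is symmetricmx.
Variable lam : 'I_d -> R.
Hypothesis lamE : char_poly S = \prod_(j < d) ('X - (lam j)%:P).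
Hypothesis n0 : (0 < n)%N.
Variables b m1 m2 : R.
Hypothesis bS : b * \tr S = 2 * \tr (S *m S).
Hypothesis lam1 : forall j, `|b * lam j - 2 * lam j ^+ 2| <= m1.
Hypothesis lam2 : forall j, `|b * lam j ^+ 2 - 2 * lam j ^+ 3| <= m2.

Local Notation q := (sample_form Z).
Local Notation W := (sample_norm Z).
Local Notation M := (b%:M - 2 *: S).

Let St : S^T = S. Proof. by rewrite -symmetricmx_tr. Qed.

Let MS : M *m S = b *: S - 2 *: (S *m S).
Proof. by rewrite mulmxBl mul_scalar_mx scalemxAl. Qed.

Let MSS : M *m S *m S = b *: (S *m S) - 2 *: (S *m S *m S).
Proof. by rewrite MS mulmxBl -!scalemxAl. Qed.

Let Mt : M^T = M.
Proof. by rewrite linearB/= tr_scalar_mx linearZ/= St. Qed.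

Let MSt : (M *m S)^T = M *m S.
Proof. by rewrite MS linearB/= !linearZ/= trmx_mul St. Qed.

Let trMS : \tr (M *m S) = 0.
Proof. by rewrite MS raddfB/= !mxtraceZ bS subrr. Qed.

Lemma qformD A B (u : 'cV[R]_d) : qform (A + B) u = qform A u + qform B u.
Proof. by rewrite /qform mulmxDr mulmxDl mxE. Qed.

Lemma qformZ c A (u : 'cV[R]_d) : qform (c *: A) u = c * qform A u.
Proof. by rewrite /qform -scalemxAr -scalemxAl mxE. Qed.

Lemma qform_MS_bound u : `|qform (M *m S) u| <= m1 * sqn u.
Proof.
have h j : `|b * lam j ^+ 1 + (- 2) * lam j ^+ 2| <= m1 by rewrite expr1 mulNr.
have := qform_bound u Ssym lamE h; rewrite /mxpow/= mulmx1 -sqnE; apply: le_trans.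
by rewrite MS qformD -scaleNr !qformZ.
Qed.

Lemma qform_MSS_bound u : `|qform (M *m S *m S) u| <= m2 * sqn u.
Proof.
have h j : `|b * lam j ^+ 2 + (- 2) * lam j ^+ 3| <= m2 by rewrite mulNr.
have := qform_bound u Ssym lamE h; rewrite /mxpow/= mulmx1 -sqnE; apply: le_trans.
by rewrite MSS qformD -scaleNr !qformZ !mulmxA.
Qed.

Lemma sample_form_bound N m w : (forall u, `|qform N u| <= m * sqn u) -> `|q N w| <= m * W w.
Proof.
move=> h; apply: (le_trans (ler_norm_sum _ _ _)); rewrite mulr_sumr.
by apply: ler_sum => i _; exact: h.
Qed.

(** With S = A A^T, the trace of N S is the sum of the quadratic form of N over the columns of A.
    The bound on the form of M S thus passes to the trace, and the squared norms of the columns add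
    up to tr S. *)
Lemma trace_MSS_bound : `|\tr (M *m S *m S)| <= m1 * \tr S.
Proof.
have [A [AS _]] := SZ (Ordinal n0).
have trE N : \tr (N *m S) = \sum_k qform N (col k A).
  rewrite -AS mulmxA mxtrace_mulC mulmxA; apply: eq_bigr => k _.
  rewrite /qform !mxE; apply: eq_bigr => j _; rewrite !mxE; congr (_ * _).
  by apply: eq_bigr => i _; rewrite !mxE.
rewrite trE -[S in leRHS]mul1mx trE mulr_sumr.
apply: (le_trans (ler_norm_sum _ _ _)); apply: ler_sum => k _.
by rewrite -sqnE; exact: qform_MS_bound.
Qed.

(** Integration by parts with the identity matrix turns W f into n tr S f + 2 q_S f', so at r = 0
    the operator becomes q_M f'. A second application, with M, leaves 2 q_(M S) f'' because tr(M S)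
    = 0. The last term gathers the effect of the shift r. *)
Lemma stein_residual (f f1 f2 : R -> R) r K : 0 < r ->
  (forall x : R, 0 < x -> [/\ is_derive x 1 f (f1 x), is_derive x 1 f1 (f2 x) & {for x, continuous f2}]) ->
  (forall x, r <= x -> [/\ `|f x| <= K * (1 + x), `|f1 x| <= K * (1 + x) & `|f2 x| <= K * (1 + x)]) ->
  \int[P]_w (b * (W w + r) * f1 (W w + r) + (n%:R * \tr S - (W w + r)) * f (W w + r)) =
  2 * \int[P]_w (q (M *m S) w * f2 (W w + r)) +
  r * \int[P]_w (b * f1 (W w + r) - f (W w + r)).
Proof.
move=> r0 df bf.
have d0 (x : R) : 0 < x -> is_derive x 1 f (f1 x) by move=> /df[].
have d1 (x : R) : 0 < x -> is_derive x 1 f1 (f2 x) by move=> /df[].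
have c0 (x : R) : 0 < x -> {for x, continuous f} by move=> /d0/is_derive1_continuous.
have c1 (x : R) : 0 < x -> {for x, continuous f1} by move=> /d1/is_derive1_continuous.
have c2 (x : R) : 0 < x -> {for x, continuous f2} by move=> /df[].
have b0 x : r <= x -> `|f x| <= K * (1 + x) by move=> /bf[].
have b1 x : r <= x -> `|f1 x| <= K * (1 + x) by move=> /bf[].
have b2 x : r <= x -> `|f2 x| <= K * (1 + x) by move=> /bf[].
have e1 := sample_form_ibp indZ SZ Mt r0 d1 c2 b1 b2.
rewrite trMS mulr0 mul0r add0r in e1.
have e2 := sample_form_ibp indZ SZ (trmx1 _ _) r0 d0 c1 b0 b1.
rewrite mul1mx in e2.
have i0 := integrable_sample_test SZ r0 c0 b0.
have i1 := integrable_sample_test SZ r0 c1 b1.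
have j0 := integrable_sample_form_test SZ r0 c0 b0 1%:M.
have j1 := integrable_sample_form_test SZ r0 c1 b1 1%:M.
have jS := integrable_sample_form_test SZ r0 c1 b1 S.
have Z1 c g : P.-integrable setT (EFin \o g) -> P.-integrable setT (EFin \o (fun w => c * g w)).
  by move=> ig; exact: (@integrableZl _ _ _ P setT measurableT c _ ig).
have qM w : q M w = b * q 1%:M w - 2 * q S w.
  rewrite /sample_form !mulr_sumr -sumrB; apply: eq_bigr => i _.
  by rewrite qformD -scaleNr -(scalemx1 _ b) !qformZ mulNr.
have e3 : \int[P]_w (q M w * f1 (W w + r)) =
    b * \int[P]_w (q 1%:M w * f1 (W w + r)) - 2 * \int[P]_w (q S w * f1 (W w + r)).
  rewrite -!RintegralZl// -RintegralB//; try exact: Z1.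
  by apply: eq_Rintegral => w _; rewrite qM; ring.
have e4 : \int[P]_w (b * f1 (W w + r) - f (W w + r)) =
    b * \int[P]_w f1 (W w + r) - \int[P]_w f (W w + r).
  by rewrite -RintegralZl// -RintegralB//; exact: Z1.
have -> : \int[P]_w (b * (W w + r) * f1 (W w + r) + (n%:R * \tr S - (W w + r)) * f (W w + r)) =
    b * \int[P]_w (q 1%:M w * f1 (W w + r)) + r * b * \int[P]_w f1 (W w + r) +
    (n%:R * \tr S * \int[P]_w f (W w + r) -
      (\int[P]_w (q 1%:M w * f (W w + r)) + r * \int[P]_w f (W w + r))).
  have iA := Z1 b _ j1; have iB := Z1 (r * b) _ i1; have iC := Z1 (n%:R * \tr S) _ i0.
  have iE := Z1 r _ i0.
  have iAB := integrableD measurableT iA iB; have iDE := integrableD measurableT j0 iE.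
  have iCDE := integrableB measurableT iC iDE.
  transitivity (\int[P]_w ((b * (q 1%:M w * f1 (W w + r)) + r * b * f1 (W w + r)) +
      (n%:R * \tr S * f (W w + r) - (q 1%:M w * f (W w + r) + r * f (W w + r))))).
    by apply: eq_Rintegral => w _; rewrite sample_form1; ring.
  by rewrite RintegralD// RintegralD// RintegralB// RintegralD// !RintegralZl.
rewrite e4 -e1 e3 e2; ring.
Qed.

Lemma stein_residual_bound1 (f2 : R -> R) r B : 0 < r -> 0 <= m1 ->
  (forall x : R, 0 < x -> {for x, continuous f2}) -> (forall x, 0 < x -> `|x * f2 x| <= B) ->
  `|\int[P]_w (q (M *m S) w * f2 (W w + r))| <= m1 * B.
Proof.
move=> r0 m10 c2 b2.
have B0 : 0 <= B by exact: le_trans (normr_ge0 _) (b2 1 ltr01).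
have Wr w : 0 < W w + r by rewrite ltr_wpDl// sample_norm_ge0.
have bf2 x : r <= x -> `|f2 x| <= B / r * (1 + x).
  move=> rx; have x0 : 0 < x by exact: lt_le_trans rx.
  apply: (@le_trans _ _ (B / r)); last by rewrite ler_peMr ?divr_ge0 ?(ltW r0)// lerDl ltW.
  have := b2 x x0; rewrite normrM (gtr0_norm x0) ler_pdivlMr// mulrC; apply: le_trans.
  by rewrite ler_wpM2l.
apply: normr_Rintegral_prob_le; first exact: (integrable_sample_form_test SZ r0 c2 bf2).
move=> w; rewrite normrM.
(* [W] is enlarged to [W + r] to match the argument of [f2]. *)
apply: (@le_trans _ _ (m1 * (W w + r) * `|f2 (W w + r)|)).
  rewrite ler_wpM2r//; apply: (le_trans (sample_form_bound w qform_MS_bound)).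
  by rewrite ler_wpM2l// lerDl ltW.
rewrite -mulrA ler_wpM2l//; apply: le_trans (b2 _ (Wr w)).
by rewrite normrM (gtr0_norm (Wr w)).
Qed.

(** For smooth test functions x f'' need not be bounded, but f'' and x f''' are. One more
    integration by parts, with the symmetric matrix M S, trades the first kind of bound for the
    other two. *)
Lemma stein_residual_bound2 (f2 f3 : R -> R) r B2 B3 : 0 < r -> 0 <= m2 ->
  (forall x : R, 0 < x -> is_derive x 1 f2 (f3 x)) ->
  (forall x : R, 0 < x -> {for x, continuous f3}) ->
  (forall x, 0 < x -> `|f2 x| <= B2) -> (forall x, 0 < x -> `|x * f3 x| <= B3) ->
  `|\int[P]_w (q (M *m S) w * f2 (W w + r))| <= n%:R * (m1 * \tr S) * B2 + 2 * (m2 * B3).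
Proof.
move=> r0 m20 d2 c3 b2 b3.
have B30 : 0 <= B3 by exact: le_trans (normr_ge0 _) (b3 1 ltr01).
have B20 : 0 <= B2 by exact: le_trans (normr_ge0 _) (b2 1 ltr01).
have Wr w : 0 < W w + r by rewrite ltr_wpDl// sample_norm_ge0.
have c2 (x : R) : 0 < x -> {for x, continuous f2} by move=> /d2/is_derive1_continuous.
pose K := B2 + B3 / r.
have K2 : B2 <= K by rewrite lerDl divr_ge0// ltW.
have K3 : B3 / r <= K by rewrite lerDr.
have bK x : r <= x -> K <= K * (1 + x).
  by move=> rx; rewrite ler_peMr// ?(le_trans B20)// lerDl (le_trans (ltW r0)).
have bf2 x : r <= x -> `|f2 x| <= K * (1 + x).
  move=> rx; apply: le_trans (bK _ rx); apply: le_trans K2; apply: b2; exact: lt_le_trans rx.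
have bf3 x : r <= x -> `|f3 x| <= K * (1 + x).
  move=> rx; have x0 : 0 < x by exact: lt_le_trans rx.
  apply: le_trans (bK _ rx); apply: le_trans K3.
  have := b3 x x0; rewrite normrM (gtr0_norm x0) ler_pdivlMr// mulrC; apply: le_trans.
  by rewrite ler_wpM2l.
rewrite (sample_form_ibp indZ SZ MSt r0 d2 c3 bf2 bf3).
apply: (le_trans (ler_normD _ _)); apply: lerD.
  rewrite !normrM ger0_norm//; apply: ler_pM => //; rewrite ?mulr_ge0//.
    by rewrite ler_wpM2l// trace_MSS_bound.
  apply: normr_Rintegral_prob_le; first exact: (integrable_sample_test SZ r0 c2 bf2).
  by move=> w; exact: b2.
rewrite normrM ger0_norm// ler_wpM2l//.
apply: normr_Rintegral_prob_le; first exact: (integrable_sample_form_test SZ r0 c3 bf3).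
move=> w; rewrite normrM.
apply: (@le_trans _ _ (m2 * (W w + r) * `|f3 (W w + r)|)).
  rewrite ler_wpM2r//; apply: (le_trans (sample_form_bound w qform_MSS_bound)).
  by rewrite ler_wpM2l// lerDl ltW.
rewrite -mulrA ler_wpM2l//; apply: le_trans (b3 _ (Wr w)).
by rewrite normrM (gtr0_norm (Wr w)).
Qed.

End stein_operator.

Section growth.
Context {R : realType}.

Lemma growth_le (f : R -> R) K : (forall x, 0 < x -> `|f x| <= K) ->
  forall x, 0 < x -> `|f x| <= K * (1 + x).
Proof.
move=> bf x x0; apply: (le_trans (bf _ x0)).
by rewrite ler_peMr ?(le_trans (normr_ge0 _) (bf _ x0))// lerDl ltW.
Qed.

(** The mean value theorem from the base point 1, since 0 lies outside the domain; the powers of 2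
    account for x < 1. *)
Lemma growth_deriv (f f1 : R -> R) L m : (forall x : R, 0 < x -> is_derive x 1 f (f1 x)) ->
  (forall x, 0 < x -> `|f1 x| <= L * (1 + x) ^+ m) ->
  forall x, 0 < x -> `|f x| <= (`|f 1| + L * 2 ^+ m) * (1 + x) ^+ m.+1.
Proof.
move=> df bf1.
have L0 : 0 <= L.
  have := le_trans (normr_ge0 _) (bf1 1 ltr01).
  by rewrite pmulr_lge0// exprn_gt0// addr_gt0.
have key x y : 0 < x -> x <= y -> `|f y - f x| <= L * (1 + y) ^+ m * (y - x).
  move=> x0 xy; have [c /andP[xc cy] ->] := MVT_pos x0 xy df.
  have c0 := lt_le_trans x0 xc.
  rewrite normrM [`|y - x|]ger0_norm ?subr_ge0// ler_wpM2r ?subr_ge0//.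
  apply: (le_trans (bf1 _ c0)); rewrite ler_wpM2l//; apply: lerXn2r; rewrite ?nnegrE; lra.
move=> x x0.
have x1 : 1 <= (1 + x) ^+ m.+1 by apply: exprn_ege1; lra.
have ft : `|f 1| <= `|f 1| * (1 + x) ^+ m.+1 by rewrite ler_peMr.
rewrite mulrDl -[f x](subrK (f 1)) addrC; apply: (le_trans (ler_normD _ _)); apply: lerD => //.
have p2 : 0 <= L * 2 ^+ m by rewrite mulr_ge0// exprn_ge0.
have [xl|xl] := leP 1 x.
  apply: (le_trans (key _ _ ltr01 xl)); rewrite -!mulrA ler_wpM2l// exprSr mulrA.
  apply: ler_pM; rewrite ?exprn_ge0//; try lra.
  rewrite ler_peMl// ?exprn_ge0//; try lra.
  by apply: exprn_ege1; lra.
rewrite distrC; apply: (le_trans (key _ _ x0 (ltW xl))).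
have -> : 1 + 1 = 2 :> R by [].
by apply: ler_pM => //; lra.
Qed.

Lemma growth_lipschitz (f f1 : R -> R) : (forall x : R, 0 < x -> is_derive x 1 f (f1 x)) ->
  (forall x, 0 < x -> `|f1 x| <= 1) ->
  forall x, 0 < x -> `|f x| <= (`|f 1| + 1) * (1 + x).
Proof.
move=> df bf x x0; have := @growth_deriv f f1 1 0 df _ x x0; rewrite expr0 expr1 mulr1; apply.
exact: bf.
Qed.

End growth.

(** * Comparison of the trace with the Gamma law of scale b *)

Section comparison.
Context dP (T : measurableType dP) (R : realType) (P : probability T R) (d n : nat).
Variables (S : 'M[R]_d) (Z : 'I_n -> {RV P >-> 'cV[R]_d}).
Hypothesis indZ : independent_RVs Z.
Hypothesis SZ : forall i, is_multinormal S (Z i).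
Hypothesis Ssym : S \is symmetricmx.
Variable lam : 'I_d -> R.
Hypothesis lamE : char_poly S = \prod_(j < d) ('X - (lam j)%:P).
Hypothesis n0 : (0 < n)%N.
Variables a b m1 m2 : R.
Hypothesis bS : b * \tr S = 2 * \tr (S *m S).
Hypothesis lam1 : forall j, `|b * lam j - 2 * lam j ^+ 2| <= m1.
Hypothesis lam2 : forall j, `|b * lam j ^+ 2 - 2 * lam j ^+ 3| <= m2.
Hypothesis a0 : 0 < a.
Hypothesis b0 : 0 < b.
Hypothesis abS : a * b = n%:R * \tr S.
Hypothesis m10 : 0 <= m1.
Hypothesis m20 : 0 <= m2.
Local Notation mu := (@lebesgue_measure R).
Hypothesis gamma1 : \int[mu]_(x in `]0%R, +oo[) gamma_pdf a b x = 1.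

Local Notation q := (sample_form Z).
Local Notation W := (sample_norm Z).
Local Notation M := (b%:M - 2 *: S).

Let Wr w r : 0 < r -> 0 < W w + r.
Proof. by move=> r0; rewrite ltr_wpDl// sample_norm_ge0. Qed.

Lemma integrable_sample_growth (phi : R -> R) r K m : 0 < r ->
  (forall x : R, 0 < x -> {for x, continuous phi}) ->
  (forall x, 0 < x -> `|phi x| <= K * (1 + x) ^+ m) ->
  P.-integrable setT (EFin \o (fun w => phi (W w + r))).
Proof.
move=> r0 cphi bphi.
have K0 : 0 <= K.
  have := le_trans (normr_ge0 _) (bphi 1 ltr01).
  by rewrite pmulr_lge0// exprn_gt0// addr_gt0.
apply: (integrable_sample_norm_bound SZ (K := K * (1 + r) ^+ m) (m := m)).
  exact: measurable_sample_test.
move=> w; apply: (le_trans (bphi _ (Wr w r0))); rewrite -mulrA ler_wpM2l// -exprMn.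
have W0 := sample_norm_ge0 Z w.
by apply: lerXn2r; rewrite ?nnegrE; nra.
Qed.

Lemma integrable_sample_norm : P.-integrable setT (EFin \o W).
Proof.
apply: (integrable_sample_norm_bound SZ (K := 1) (m := 1)); first exact: measurable_sample_norm.
by move=> w; rewrite ger0_norm ?sample_norm_ge0// mul1r expr1 lerDr.
Qed.

(** Integrating the Stein equation against the density annihilates the operator; as the density has
    mass 1, the constant left over in the equation is the mean of h. *)
Lemma gamma_mean (f f1 h : R -> R) c K K' m :
  (forall x : R, 0 < x -> is_derive x 1 f (f1 x)) ->
  (forall x : R, 0 < x -> {for x, continuous h}) ->
  (forall x, 0 < x -> `|f x| <= K * (1 + x)) -> (forall x, 0 < x -> `|h x| <= K' * (1 + x) ^+ m) ->
  (forall x, 0 < x -> b * x * f1 x + (a * b - x) * f x = h x - c) ->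
  \int[mu]_(x in `]0%R, +oo[) (h x * gamma_pdf a b x) = c.
Proof.
move=> df ch bf bh E.
have ih := integrable_gamma_growth a0 b0 ch bh.
have i1 : mu.-integrable `]0%R, +oo[ (EFin \o (fun x => cst 1 x * gamma_pdf a b x)).
  apply: (@integrable_gamma_growth _ _ _ a0 b0 _ 1 0) => x _; first exact: cvg_cst.
  by rewrite expr0 mulr1 normr1.
have i1c : mu.-integrable `]0%R, +oo[ (EFin \o (fun x => c * gamma_pdf a b x)).
  have := @integrableZl _ _ _ mu `]0 : R, +oo[%classic (measurable_itv _) c _ i1.
  by under [X in _.-integrable _ X -> _]eq_fun do rewrite /= mul1r.
have ck (x : R) : 0 < x -> {for x, continuous (fun x => h x - c)}.
  by move=> x0; apply: cvgB; [exact: ch|exact: cvg_cst].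
have ik : mu.-integrable `]0%R, +oo[ (EFin \o (fun x => (h x - c) * gamma_pdf a b x)).
  have := @integrableB _ _ _ mu `]0 : R, +oo[%classic (measurable_itv _) _ _ ih i1c.
  apply: eq_integrable => //= x _.
  by rewrite mulrBl EFinB.
have := gamma_stein a0 b0 df ck bf E ik.
under eq_Rintegral do rewrite mulrBl.
rewrite RintegralB//.
have -> : \int[mu]_(x in `]0%R, +oo[) (c * gamma_pdf a b x) = c.
  rewrite RintegralZl// ?gamma1 ?mulr1//.
  by move: i1; under [X in _.-integrable _ (_ \o X) -> _]eq_fun do rewrite /= mul1r.
by move/eqP; rewrite subr_eq0 => /eqP.
Qed.

Lemma is_derive_div (f f1 : R -> R) : (forall x : R, 0 < x -> is_derive x 1 f (f1 x)) ->
  forall x : R, 0 < x -> is_derive x 1 (fun x => f (x / b)) (f1 (x / b) / b).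
Proof.
move=> df x x0; have xb : 0 < x / b by rewrite divr_gt0.
have db : is_derive x 1 (fun x => x / b) b^-1.
  by apply: (is_derive1_eq (is_derive1M (is_derive1_id x) (is_derive1_cst x b^-1))); ring.
exact: (@is_derive1_chain R f (fun x => x / b) x _ _ (df _ xb) db).
Qed.

Lemma continuous_div (f : R -> R) : (forall x : R, 0 < x -> {for x, continuous f}) ->
  forall x : R, 0 < x -> {for x, continuous (fun x : R => f (x / b))}.
Proof.
move=> cf x x0; have xb : 0 < x / b by rewrite divr_gt0.
apply: (@continuous_comp _ _ _ (fun x : R => x / b) f); last exact: cf.
by apply: cvgM; [exact: cvg_id|exact: cvg_cst].
Qed.

Lemma is_derive_scale (f f1 : R -> R) : (forall x : R, 0 < x -> is_derive x 1 f (f1 x)) ->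
  forall x : R, 0 < x -> is_derive x 1 (fun x => f (b * x)) (b * f1 (b * x)).
Proof.
move=> df x x0; have xb : 0 < b * x by rewrite mulr_gt0.
have db : is_derive x 1 (fun x => b * x) b.
  by apply: (is_derive1_eq (is_derive1M (is_derive1_cst x b) (is_derive1_id x))); ring.
rewrite mulrC; exact: (@is_derive1_chain R f (fun x => b * x) x _ _ (df _ xb) db).
Qed.

Lemma continuous_scale (f : R -> R) : (forall x : R, 0 < x -> {for x, continuous f}) ->
  forall x : R, 0 < x -> {for x, continuous (fun x : R => f (b * x))}.
Proof.
move=> cf x x0; have xb : 0 < b * x by rewrite mulr_gt0.
apply: (@continuous_comp _ _ _ (fun x : R => b * x) f); last exact: cf.
by apply: cvgM; [exact: cvg_cst|exact: cvg_id].
Qed.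

Lemma is_deriveZ_pos (c : R) (f f1 : R -> R) : (forall x : R, 0 < x -> is_derive x 1 f (f1 x)) ->
  forall x : R, 0 < x -> is_derive x 1 (fun x => c * f x) (c * f1 x).
Proof.
move=> df x x0; apply: (is_derive1_eq (is_derive1M (is_derive1_cst x c) (df _ x0))); ring.
Qed.

Lemma stein_pair1 (h h1 : R -> R) :
  (forall x : R, 0 < x -> is_derive x 1 h (h1 x)) ->
  (forall x : R, 0 < x -> {for x, continuous h1}) ->
  (forall x, 0 < x -> `|h1 x| <= 1) ->
  exists C, forall r, 0 < r ->
    `|\int[P]_w h (W w + r) - \int[mu]_(x in `]0%R, +oo[) (h x * gamma_pdf a b x)|
      <= 4 * m1 / b + r * C.
Proof.
move=> dh ch1 bh1; have bn0 : b != 0 by rewrite gt_eqF.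
have ch (x : R) : 0 < x -> {for x, continuous h} by move=> /dh/is_derive1_continuous.
(* Reduction to scale 1: b^(-1) h(b x) again has a derivative bounded by 1, and f(x) = g(x / b)
   solves the equation of scale b. Each derivative of f gains a factor 1 / b. *)
have dhb (x : R) : 0 < x -> is_derive x 1 (fun x => b^-1 * h (b * x)) (h1 (b * x)).
  move=> x0; apply: (is_derive1_eq (is_deriveZ_pos b^-1 (is_derive_scale dh) x0)).
  by rewrite mulKf.
have bhb x : 0 < x -> `|h1 (b * x)| <= 1 by move=> x0; apply: bh1; rewrite mulr_gt0.
have [g [g1 [g2 [c [C [dg bg bg1 bg2]]]]]] :=
  stein_solution1 a0 dhb (continuous_scale ch1) bhb.
pose f x := g (x / b); pose f1 x := b^-1 * g1 (x / b); pose f2 x := (b ^+ 2)^-1 * g2 (x / b).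
have xb x : 0 < x -> 0 < x / b by move=> x0; rewrite divr_gt0.
have dg0 (x : R) : 0 < x -> is_derive x 1 g (g1 x) by move=> /dg[].
have dg1 (x : R) : 0 < x -> is_derive x 1 g1 (g2 x) by move=> /dg[].
have cg2 (x : R) : 0 < x -> {for x, continuous g2} by move=> /dg[].
have df (x : R) : 0 < x -> is_derive x 1 f (f1 x).
  by move=> x0; apply: (is_derive1_eq (is_derive_div dg0 x0)); rewrite mulrC.
have df1 (x : R) : 0 < x -> is_derive x 1 f1 (f2 x).
  move=> x0; apply: (is_derive1_eq (is_deriveZ_pos b^-1 (is_derive_div dg1) x0)).
  by rewrite /f2; field.
have cf2 (x : R) : 0 < x -> {for x, continuous f2}.
  by move=> x0; apply: cvgM; [exact: cvg_cst|exact: (continuous_div cg2)].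
have bf x : 0 < x -> `|f x| <= 1 by move=> x0; apply: bg; exact: xb.
have bf1 x : 0 < x -> `|f1 x| <= b^-1 * C.
  move=> x0; rewrite normrM gtr0_norm ?invr_gt0// ler_wpM2l ?invr_ge0 ?(ltW b0)//.
  by apply: bg1; exact: xb.
have bf2 x : 0 < x -> `|x * f2 x| <= 2 / b.
  move=> x0; have -> : x * f2 x = (x / b * g2 (x / b)) * b^-1 by rewrite /f2; field.
  by rewrite normrM [`|b^-1|]gtr0_norm ?invr_gt0// ler_wpM2r ?invr_ge0 ?(ltW b0)// bg2// xb.
have E x : 0 < x -> b * x * f1 x + (a * b - x) * f x = h x - b * c.
  move=> x0; have [_ _ _ e] := dg _ (xb _ x0).
  have -> : h x = b * (b^-1 * h (b * (x / b))) by rewrite mulVKf// mulrC divfK.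
  by rewrite -mulrBr -e /f /f1; field.
have bh x : 0 < x -> `|h x| <= (`|h 1| + 1) * (1 + x) ^+ 1 by exact: growth_lipschitz dh bh1 x.
have bfK x : 0 < x -> `|f x| <= 1 * (1 + x) by exact: growth_le.
rewrite (gamma_mean df ch bfK bh E).
exists (C + 1) => r r0.
have rx x : r <= x -> 0 < x by exact: lt_le_trans.
(* The term 2 / (b r) explodes as r --> 0; [K] guarantees the integrations by parts and does not
   enter the final estimate. *)
pose K := 1 + b^-1 * C + 2 / b / r.
have C0 : 0 <= b^-1 * C by exact: le_trans (normr_ge0 _) (bf1 1 ltr01).
have q0 : 0 <= 2 / b / r by rewrite !divr_ge0// ltW.
have bK x : r <= x -> [/\ `|f x| <= K * (1 + x), `|f1 x| <= K * (1 + x) & `|f2 x| <= K * (1 + x)].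
  move=> /[dup] rlx /rx x0.
  have KK : K <= K * (1 + x) by rewrite ler_peMr /K; lra.
  split; apply: le_trans KK.
  - by have := bf _ x0; rewrite /K; lra.
  - by have := bf1 _ x0; rewrite /K; lra.
  - apply: (@le_trans _ _ (2 / b / r)); last by rewrite /K; lra.
    rewrite ler_pdivlMr//; apply: le_trans (bf2 _ x0).
    by rewrite [`|x * _|]normrM (gtr0_norm x0) mulrC ler_wpM2r.
have := stein_residual indZ SZ Ssym bS r0 (fun x x0 => And3 (df x x0) (df1 x x0) (cf2 x x0)) bK.
have ih := integrable_sample_growth r0 ch bh.
have -> : \int[P]_w (b * (W w + r) * f1 (W w + r) + (n%:R * \tr S - (W w + r)) * f (W w + r)) =
    \int[P]_w h (W w + r) - b * c.
  rewrite -[X in _ - X](Rintegral_prob_cst P) -RintegralB//; last exact: finite_measure_integrable_cst.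
  by apply: eq_Rintegral => w _; rewrite -E ?Wr// abS.
move=> ->; apply: (le_trans (ler_normD _ _)); apply: lerD.
  rewrite normrM ger0_norm//.
  have := stein_residual_bound1 SZ Ssym lamE lam1 r0 m10 cf2 bf2.
  move=> hh; have -> : 4 * m1 / b = 2 * (m1 * (2 / b)) by field.
  by rewrite ler_wpM2l.
rewrite normrM gtr0_norm// ler_wpM2l ?(ltW r0)//.
have cf (x : R) : 0 < x -> {for x, continuous f} by move=> /df/is_derive1_continuous.
have cf1 (x : R) : 0 < x -> {for x, continuous f1} by move=> /df1/is_derive1_continuous.
apply: normr_Rintegral_prob_le.
  have i0 := integrable_sample_test SZ r0 cf (fun x xr => let: And3 h _ _ := bK x xr in h).
  have i1 := integrable_sample_test SZ r0 cf1 (fun x xr => let: And3 _ h _ := bK x xr in h).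
  exact: (integrableB measurableT (@integrableZl _ _ _ P setT measurableT b _ i1) i0).
move=> w; apply: (le_trans (ler_normB _ _)); apply: lerD; last exact: bf (Wr w r0).
rewrite normrM gtr0_norm// mulrC -ler_pdivlMr// [C / b]mulrC; exact: (bf1 _ (Wr w r0)).
Qed.

(** The alternative m1 = 0 is what remains usable when no finite bound on [C2] is available: then
    q_(M S) vanishes identically and f'' is never estimated. *)
Lemma stein_pair2 (h h1 h2 : R -> R) e :
  (forall x : R, 0 < x -> is_derive x 1 h (h1 x)) ->
  (forall x : R, 0 < x -> is_derive x 1 h1 (h2 x)) ->
  (forall x : R, 0 < x -> {for x, continuous h2}) ->
  (forall x, 0 < x -> `|h2 x| <= 1) ->
  m1 = 0 \/ (forall x, 0 < x -> C2 a x <= e) ->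
  exists C, forall r, 0 < r -> r <= 1 ->
    `|\int[P]_w h (W w + r) - \int[mu]_(x in `]0%R, +oo[) (h x * gamma_pdf a b x)|
      <= 2 * n%:R * \tr S * e * m1 / b + 8 * m2 / b + r * C.
Proof.
move=> dh dh1 ch2 bh2 eC; have bn0 : b != 0 by rewrite gt_eqF.
have ch (x : R) : 0 < x -> {for x, continuous h} by move=> /dh/is_derive1_continuous.
(* The scaling b^(-2) h(b x) preserves the bound on the second derivative; accordingly f is b times
   g(x / b). *)
have dhb (x : R) : 0 < x -> is_derive x 1 (fun x => (b ^+ 2)^-1 * h (b * x)) (b^-1 * h1 (b * x)).
  move=> x0; apply: (is_derive1_eq (is_deriveZ_pos (b ^+ 2)^-1 (is_derive_scale dh) x0)).
  by field.
have dhb1 (x : R) : 0 < x -> is_derive x 1 (fun x => b^-1 * h1 (b * x)) (h2 (b * x)).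
  move=> x0; apply: (is_derive1_eq (is_deriveZ_pos b^-1 (is_derive_scale dh1) x0)).
  by rewrite mulKf.
have bhb x : 0 < x -> `|h2 (b * x)| <= 1 by move=> x0; apply: bh2; rewrite mulr_gt0.
have [g [g1 [g2 [g3 [c [dg bg1 bg2 bg3]]]]]] :=
  stein_solution2 a0 dhb dhb1 (continuous_scale ch2) bhb.
pose f x := b * g (x / b); pose f1 x := g1 (x / b); pose f2 x := b^-1 * g2 (x / b).
pose f3 x := (b ^+ 2)^-1 * g3 (x / b).
have xb x : 0 < x -> 0 < x / b by move=> x0; rewrite divr_gt0.
have dg0 (x : R) : 0 < x -> is_derive x 1 g (g1 x) by move=> /dg[].
have dg1 (x : R) : 0 < x -> is_derive x 1 g1 (g2 x) by move=> /dg[].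
have dg2 (x : R) : 0 < x -> is_derive x 1 g2 (g3 x) by move=> /dg[].
have cg3 (x : R) : 0 < x -> {for x, continuous g3} by move=> /dg[].
have df (x : R) : 0 < x -> is_derive x 1 f (f1 x).
  move=> x0; apply: (is_derive1_eq (is_deriveZ_pos b (is_derive_div dg0) x0)).
  by rewrite /f1; field.
have df1 (x : R) : 0 < x -> is_derive x 1 f1 (f2 x).
  by move=> x0; apply: (is_derive1_eq (is_derive_div dg1 x0)); rewrite mulrC.
have df2 (x : R) : 0 < x -> is_derive x 1 f2 (f3 x).
  move=> x0; apply: (is_derive1_eq (is_deriveZ_pos b^-1 (is_derive_div dg2) x0)).
  by rewrite /f3; field.
have cf3 (x : R) : 0 < x -> {for x, continuous f3}.
  by move=> x0; apply: cvgM; [exact: cvg_cst|exact: (continuous_div cg3)].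
have bf1 x : 0 < x -> `|f1 x| <= 1 by move=> x0; apply: bg1; exact: xb.
have bf2 : (forall x, 0 < x -> C2 a x <= e) -> forall x, 0 < x -> `|f2 x| <= b^-1 * e.
  move=> eC' x x0; rewrite normrM gtr0_norm ?invr_gt0// ler_wpM2l ?invr_ge0 ?(ltW b0)//.
  by apply: le_trans (bg2 _ (xb _ x0)) (eC' _ (xb _ x0)).
have bf3 x : 0 < x -> `|x * f3 x| <= 2 / b.
  move=> x0; have -> : x * f3 x = (x / b * g3 (x / b)) * b^-1 by rewrite /f3; field.
  by rewrite normrM [`|b^-1|]gtr0_norm ?invr_gt0// ler_wpM2r ?invr_ge0 ?(ltW b0)// bg3// xb.
have E x : 0 < x -> b * x * f1 x + (a * b - x) * f x = h x - b ^+ 2 * c.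
  move=> x0; have [_ _ _ _ e0] := dg _ (xb _ x0).
  have -> : h x = b ^+ 2 * ((b ^+ 2)^-1 * h (b * (x / b))) by rewrite mulVKf ?expf_neq0// mulrC divfK.
  by rewrite -mulrBr -e0 /f /f1; field.
have bh1' x : 0 < x -> `|h1 x| <= (`|h1 1| + 1) * (1 + x) ^+ 1.
  exact: growth_lipschitz dh1 bh2 x.
have bh := growth_deriv dh bh1'.
have bfK x : 0 < x -> `|f x| <= (`|f 1| + 1) * (1 + x).
  exact: growth_lipschitz df bf1 x.
rewrite (gamma_mean df ch bfK bh E).
have iW := integrable_sample_norm.
exists (b + (`|f 1| + 1) * (2 + \int[P]_w W w)) => r r0 r1.
have rx x : r <= x -> 0 < x by exact: lt_le_trans.
pose L := 2 / b / r; have L0 : 0 <= L by rewrite !divr_ge0// ltW.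
pose K := `|f 1| + 1 + (`|f2 r| + L).
have f2r := normr_ge0 (f2 r).
(* When m1 = 0 there is no uniform bound on f''. The bound on x f''' still gives linear growth on
   [r, +oo), starting from the value at r. *)
have bf2r x : r <= x -> `|f2 x| <= `|f2 r| + L * x.
  move=> rlx; have [c0 /andP[rc cx] e1] := MVT_pos r0 rlx df2.
  rewrite -[f2 x](subrK (f2 r)) addrC; apply: (le_trans (ler_normD _ _)); rewrite lerD2l e1 normrM.
  have c00 := lt_le_trans r0 rc.
  apply: ler_pM => //; last by rewrite ger0_norm ?subr_ge0//; lra.
  rewrite /L ler_pdivlMr//; apply: le_trans (bf3 _ c00).
  by rewrite [`|c0 * _|]normrM (gtr0_norm c00) mulrC ler_wpM2r.
have f10 := normr_ge0 (f 1).
have bK x : r <= x -> [/\ `|f x| <= K * (1 + x), `|f1 x| <= K * (1 + x) & `|f2 x| <= K * (1 + x)].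
  move=> /[dup] rlx /rx x0.
  have KK : K <= K * (1 + x) by rewrite ler_peMr /K; lra.
  split.
  - by apply: (le_trans (bfK _ x0)); rewrite ler_wpM2r /K; lra.
  - by apply: le_trans KK; have := bf1 _ x0; rewrite /K; lra.
  - have := bf2r _ rlx; move: `|f2 x| => v hv; apply: (le_trans hv).
    have k1 : 0 <= (`|f 1| + 1 + L) * 1 by rewrite mulr1; lra.
    have k2 : 0 <= (`|f 1| + 1 + `|f2 r|) * x by rewrite mulr_ge0 ?(ltW x0)//; lra.
    by rewrite /K; lra.
have cf2 (x : R) : 0 < x -> {for x, continuous f2} by move=> /df2/is_derive1_continuous.
have := stein_residual indZ SZ Ssym bS r0 (fun x x0 => And3 (df x x0) (df1 x x0) (cf2 x x0)) bK.
have ih := integrable_sample_growth r0 ch bh.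
have -> : \int[P]_w (b * (W w + r) * f1 (W w + r) + (n%:R * \tr S - (W w + r)) * f (W w + r)) =
    \int[P]_w h (W w + r) - b ^+ 2 * c.
  rewrite -[X in _ - X](Rintegral_prob_cst P) -RintegralB//; last exact: finite_measure_integrable_cst.
  by apply: eq_Rintegral => w _; rewrite -E ?Wr// abS.
move=> ->; apply: (le_trans (ler_normD _ _)); apply: lerD.
  rewrite normrM ger0_norm//.
  have -> : 2 * n%:R * \tr S * e * m1 / b + 8 * m2 / b =
      2 * (n%:R * (m1 * \tr S) * (b^-1 * e) + 2 * (m2 * (2 / b))) by field.
  rewrite ler_wpM2l//; case: eC => [m1E|/bf2 bf2'].
    rewrite m1E mul0r mulr0 mul0r add0r.
    have -> : \int[P]_w (q (M *m S) w * f2 (W w + r)) = \int[P]_w (0 : R).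
      apply: eq_Rintegral => w _.
      have := sample_form_bound Z w (qform_MS_bound Ssym lamE lam1).
      by rewrite m1E mul0r normr_le0 => /eqP ->; rewrite mul0r.
    by rewrite (Rintegral_prob_cst P) normr0 mulr_ge0// mulr_ge0// divr_ge0// ltW.
  exact: (stein_residual_bound2 indZ SZ Ssym lamE n0 lam1 lam2 r0 m20 df2 cf3 bf2' bf3).
rewrite normrM gtr0_norm// ler_wpM2l ?(ltW r0)//.
have cf (x : R) : 0 < x -> {for x, continuous f} by move=> /df/is_derive1_continuous.
have cf1 (x : R) : 0 < x -> {for x, continuous f1} by move=> /df1/is_derive1_continuous.
have i0 := integrable_sample_test SZ r0 cf (fun x xr => let: And3 h _ _ := bK x xr in h).
have i1 := integrable_sample_test SZ r0 cf1 (fun x xr => let: And3 _ h _ := bK x xr in h).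
have i2 := finite_measure_integrable_cst P 2 measurableT.
have i2W := integrableD measurableT i2 iW.
have iKW := @integrableZl _ _ _ P setT measurableT (`|f 1| + 1) _ i2W.
have ib := finite_measure_integrable_cst P b measurableT.
have -> : b + (`|f 1| + 1) * (2 + \int[P]_w W w) =
    \int[P]_w (b + (`|f 1| + 1) * (2 + W w)).
  rewrite RintegralD// RintegralZl// RintegralD//.
  by rewrite (Rintegral_prob_cst P b) (Rintegral_prob_cst P 2).
apply: normr_Rintegral_le.
- exact: (integrableB measurableT (@integrableZl _ _ _ P setT measurableT b _ i1) i0).
- exact: (integrableD measurableT ib iKW).
move=> w; apply: (le_trans (ler_normB _ _)); apply: lerD.
  by rewrite normrM gtr0_norm// -[leRHS]mulr1 ler_wpM2l ?(ltW b0)// bf1// Wr.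
apply: (le_trans (bfK _ (Wr w r0))); rewrite ler_wpM2l ?addr_ge0//.
by move: (W w) => W0; lra.
Qed.

End comparison.

(** * Expectations over the positive half-line and removal of the shift *)

Section positive_support.
Context {R : realType}.
Local Notation pos := (`]0 : R, +oo[%classic).

Lemma patch_pos (h : R -> R) x : 0 < x -> (h \_ pos) x = h x.
Proof. by move=> x0; rewrite patchE mem_set//= in_itv/= x0. Qed.

Lemma patch_npos (h : R -> R) x : x <= 0 -> (h \_ pos) x = 0.
Proof. by move=> x0; rewrite patchE memNset//= in_itv/= andbT ltNge x0. Qed.

Lemma measurable_patch_pos (h : R -> R) : (forall x : R, 0 < x -> {for x, continuous h}) ->
  measurable_fun setT (h \_ pos).
Proof.
by move=> ch; apply/(measurable_restrictT _ (measurable_itv _)); exact: measurable_pos.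
Qed.

Lemma patch_pos_growth (h : R -> R) K m : (forall x, 0 < x -> `|h x| <= K * (1 + x) ^+ m) ->
  forall x, 0 <= x -> `|(h \_ pos) x| <= K * (1 + x) ^+ m.
Proof.
move=> bh x; rewrite le_eqVlt => /orP[/eqP <-|x0]; last by rewrite patch_pos// bh.
rewrite patch_npos// normr0 addr0 expr1n mulr1.
have := le_trans (normr_ge0 _) (bh 1 ltr01).
by rewrite pmulr_lge0// exprn_gt0// addr_gt0.
Qed.

Lemma EposE d (T : measurableType d) (P : probability T R) (X : {RV P >-> R}) (h : R -> R) :
  Epos X h = (\int[P]_w ((h \_ pos) (X w))%:E)%E.
Proof.
rewrite /Epos integral_mkcond; apply: eq_integral => w _.
have [x0|x0] := ltP 0 (X w).
  by rewrite patch_pos// patchE mem_set//= in_itv/= x0.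
by rewrite patch_npos// patchE memNset//= in_itv/= andbT ltNge x0.
Qed.

End positive_support.

Lemma measurable_npos d (T : measurableType d) (R : realType) (f : T -> R) :
  measurable_fun setT f -> measurable [set w | f w <= 0].
Proof.
move=> /(_ measurableT `]-oo, 0 : R]%classic (measurable_itv _)).
by rewrite setTI; congr measurable; apply/seteqP; split => z; rewrite /= in_itv.
Qed.

Section gamma_law.
Context d (T : measurableType d) (R : realType) (Q : probability T R) (U : {RV Q >-> R}).
Variables a b : R.
Hypothesis a0 : 0 < a.
Hypothesis b0 : 0 < b.
Hypothesis Ugamma : is_gamma a b U.
Local Notation mu := (@lebesgue_measure R).
Local Notation p := (gamma_pdf a b).
Local Notation pos := (`]0 : R, +oo[%classic).

Let mU : measurable_fun setT (U : T -> measurableTypeR R).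
Proof. by apply: measurable_toR; exact: measurable_funP. Qed.

Let Uf := isMeasurableFun.Build _ _ _ _ (U : T -> measurableTypeR R) mU.
Let U' : {mfun T >-> measurableTypeR R} := HB.pack (U : T -> measurableTypeR R) Uf.
Let nu : {measure set (measurableTypeR R) -> \bar R} := distribution Q U'.

Let nuE A : measurable A -> nu A = (\int[mu]_(x in A) (p x)%:E)%E.
Proof. by move=> mA; exact: Ugamma. Qed.

Lemma gamma_law_integral (f : R -> R) : measurable_fun setT f ->
  mu.-integrable setT (EFin \o (fun x => f x * p x)) ->
  Q.-integrable setT (EFin \o (fun w => f (U w))) /\
  \int[Q]_w f (U w) = \int[mu]_x (f x * p x).
Proof.
move=> mf ifp.
have p0 x : 0 <= p x by exact: gamma_pdf_ge0.
have mp : measurable_fun setT p by exact: measurable_gamma_pdf.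
have /integrableP[_ i1] := @integrable_density _ _ R mu nu p mp p0 nuE f mf ifp.
have mf' : measurable_fun setT (f : measurableTypeR R -> R) by move=> _ B mB; exact: mf.
have mEf : measurable_fun setT (fun x : measurableTypeR R => (f x)%:E) by exact/measurable_EFinP.
split; last first.
  rewrite -(@Rintegral_density _ _ R mu nu p mp p0 nuE f mf ifp) /Rintegral.
  by rewrite (integral_distr U' mEf).
apply/integrableP; split.
  by apply/measurable_EFinP; apply: measurableT_comp => //; exact: measurable_funP.
have mabs : measurable_fun setT (fun x : measurableTypeR R => `|(f x)%:E|%E).
  exact: measurableT_comp.
by have <- := integral_distr U' mabs.
Qed.

(** The mass is read off the law of [U], which is a probability, instead of being computed by a
    change of scale. *)
Lemma gamma_pdf_total : \int[mu]_(x in pos) p x = 1.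
Proof.
have i1 : mu.-integrable setT (EFin \o (fun x => cst 1 x * p x)).
  apply/integrableP; split.
    by apply/measurable_EFinP; apply: measurable_funM => //; exact: measurable_gamma_pdf.
  have e : (\int[mu]_x `|(EFin \o (fun x => (cst 1 x * p x)%R)) x| = nu setT)%E.
    rewrite nuE//; apply: eq_integral => x _ /=.
    by rewrite mul1r ger0_norm// gamma_pdf_ge0.
  rewrite e; have -> : nu setT = 1%E by exact: probability_setT.
  by rewrite ltry.
have [_ e] := gamma_law_integral (measurable_cst _) i1.
rewrite Rintegral_prob_cst in e; rewrite [RHS]e Rintegral_mkcond.
apply: eq_Rintegral => x _; rewrite mul1r; have [x0|x0] := ltP 0 x; first by rewrite patch_pos.
by rewrite patch_npos// /gamma_pdf ltNge x0.
Qed.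

Lemma gamma_law_Epos (h : R -> R) K m :
  (forall x : R, 0 < x -> {for x, continuous h}) ->
  (forall x, 0 < x -> `|h x| <= K * (1 + x) ^+ m) ->
  Epos U h = (\int[mu]_(x in pos) (h x * p x))%:E.
Proof.
move=> ch bh; have mh := measurable_patch_pos ch.
have E x : (h \_ pos) x * p x = ((fun x => h x * p x) \_ pos) x.
  have [x0|x0] := ltP 0 x; first by rewrite !patch_pos.
  by rewrite !patch_npos// mul0r.
have ih : mu.-integrable setT (EFin \o (fun x => (h \_ pos) x * p x)).
  have := integrable_gamma_growth a0 b0 ch bh; rewrite integrable_mkcond// => h1.
  by apply: eq_integrable h1 => // x _; rewrite /= E restrict_EFin.
have [iU e] := gamma_law_integral mh ih.
rewrite EposE -[LHS]fineK; last exact: (integrable_fin_num measurableT iU).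
congr EFin; transitivity (\int[mu]_x ((h \_ pos) x * p x)); first exact: e.
by rewrite [RHS]Rintegral_mkcond; apply: eq_Rintegral => x _; exact: E.
Qed.

End gamma_law.

Section wishart_law.
Context dP (T : measurableType dP) (R : realType) (P : probability T R) (d n : nat).
Variables (S : 'M[R]_d) (Z : 'I_n -> {RV P >-> 'cV[R]_d}).
Hypothesis SZ : forall i, is_multinormal S (Z i).
Local Notation W := (sample_norm Z).
Local Notation pos := (`]0 : R, +oo[%classic).

Lemma mxtrace_outer (z : 'cV[R]_d) : \tr (z *m z^T) = sqn z.
Proof. by rewrite mxtrace_mulC trace_mx11 mxE; apply: eq_bigr => i _; rewrite mxE. Qed.

Lemma measurable_wishart : measurable_fun setT (fun w => \sum_(i < n) Z i w *m (Z i w)^T).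
Proof.
have mZ i j : measurable_fun setT (fun w => Z i w j 0).
  by apply: measurable_coordinates; exact: measurable_funP.
apply: measurable_mx => j k.
have -> : (fun w => (\sum_(i < n) Z i w *m (Z i w)^T) j k) =
    (fun w => \sum_(i < n) Z i w j 0 * Z i w k 0).
  apply/funext => w; rewrite summxE; apply: eq_bigr => i _.
  by rewrite mxE big_ord1 mxE.
by apply: measurable_sum => i; exact: measurable_funM.
Qed.

Lemma mxtrace_wishart w : \tr (\sum_(i < n) Z i w *m (Z i w)^T) = W w.
Proof. by rewrite raddf_sum; apply: eq_bigr => i _; exact: mxtrace_outer. Qed.

Section transfer.
Context d' (T' : measurableType d') (P' : probability T' R) (X : {RV P' >-> 'M[R]_d}).
Hypothesis lawX : same_law (distribution P' X)
  (pushforward P (fun w => \sum_(i < n) Z i w *m (Z i w)^T)).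
Let Xn : {RV P' >-> R} := @mxtrace R d \o X.

Lemma wishart_trace_integral (f : R -> \bar R) : measurable_fun setT f ->
  (\int[P']_w f (Xn w) = \int[P]_w f (W w))%E.
Proof.
move=> mf; have mft : measurable_fun setT (fun M : 'M[R]_d => f (\tr M)).
  by apply: measurableT_comp => //; exact: measurable_mxtrace.
have := integral_law measurable_wishart mft lawX.
rewrite (integral_distr X mft) => ->.
by apply: eq_integral => w _; rewrite mxtrace_wishart.
Qed.

End transfer.

Hypothesis Spd : posdefmx S.
Hypothesis d0 : (0 < d)%N.
Hypothesis n0 : (0 < n)%N.

Lemma multinormal_root_unit (A : 'M[R]_d) : A *m A^T = S -> A \in unitmx.
Proof.
move=> AS; have : S \in unitmx.
  rewrite unitmxE unitfE; apply/negP => /det0P[v v0 vS].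
  have v0' : v^T != 0 by rewrite trmx_eq0.
  by have := Spd v0'; rewrite trmxK vS mul0mx mxE ltxx.
by rewrite -AS unitmx_mul => /andP[].
Qed.

(** With Z = A G and A invertible, Z = 0 forces G = 0, and already one coordinate of G avoids 0
    almost surely by absolute continuity. *)
Lemma multinormal_null i : P [set w | sqn (Z i w) <= 0] = 0.
Proof.
have [A [AS [dQ [T' [Q [G [indG lawG lawZ]]]]]]] := SZ i.
have uA := multinormal_root_unit AS.
have mN : measurable [set z : 'cV[R]_d | sqn z <= 0].
  exact: (measurable_npos (@measurable_sqn R d)).
have := lawZ _ mN; rewrite /distribution /pushforward => e.
transitivity (Q ((fun w => A *m \col_i G i w) @^-1` [set z | sqn z <= 0])); first exact: e.
have k := Ordinal d0.
apply/eqP; rewrite eq_le measure_ge0 andbT.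
have m0 : measurable [set 0 : R] by exact: measurable_set1.
have mG : measurable (G k @^-1` [set 0]).
  by rewrite -[X in measurable X]setTI; exact: measurable_funP.
apply: (@le_trans _ _ (Q (G k @^-1` [set 0]))); last first.
  rewrite le_eqVlt; apply/orP; left; apply/eqP.
  transitivity (normal_prob 0 1 [set 0 : R]); first exact: lawG.
  have [h _] := null_content_dominatesP (normal_prob 0 1) (@lebesgue_measure R).
  apply: (h (normal_prob_dominates 0 1)) => //; exact: lebesgue_measure_set1.
apply: le_measure; rewrite ?inE//.
  have := measurable_gvec G; have mA : measurable_fun setT (fun g : 'cV[R]_d => A *m g).
    apply: measurable_mx => j l; under eq_fun do rewrite mxE.
    by apply: measurable_sum => t; apply: measurable_funM => //; exact: measurable_coord.
  move=> mg; have := measurableT_comp mA mg => /(_ measurableT _ mN).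
  by rewrite setTI.
move=> w /= h; have h0 : A *m (\col_i G i w) = 0.
  apply/matrixP => j l; rewrite ord1 [RHS]mxE; apply/eqP; rewrite -sqrf_eq0 eq_le sqr_ge0 andbT.
  apply: le_trans h; rewrite /sqn (bigD1 j)//= lerDl sumr_ge0// => t _; exact: sqr_ge0.
have : \col_i G i w = 0 by rewrite -(mulKmx uA (\col_i G i w)) h0 mulmx0.
by move/matrixP/(_ k 0); rewrite !mxE.
Qed.

Let mW : measurable_fun setT W.
Proof. exact: measurable_sample_norm. Qed.

Lemma measurable_sample_npos : measurable [set w | W w <= 0].
Proof.
exact: measurable_npos.
Qed.

Lemma sample_norm_null : P [set w | W w <= 0] = 0.
Proof.
have i := Ordinal n0.
apply/eqP; rewrite eq_le measure_ge0 andbT -(multinormal_null i).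
apply: le_measure; rewrite ?inE; first exact: measurable_sample_npos.
  have ms : measurable_fun setT (fun w => sqn (Z i w)).
    by apply: (measurableT_comp (@measurable_sqn R d)); exact: measurable_funP.
  exact: measurable_npos.
move=> w /=; apply: le_trans; rewrite /sample_norm (bigD1 i)//= lerDl sumr_ge0// => j _.
exact: sqn_ge0.
Qed.

Lemma integrable_sample_pos (h : R -> R) K m :
  (forall x : R, 0 < x -> {for x, continuous h}) ->
  (forall x, 0 < x -> `|h x| <= K * (1 + x) ^+ m) ->
  P.-integrable setT (EFin \o (fun w => (h \_ pos) (W w))).
Proof.
move=> ch bh; apply: (integrable_sample_norm_bound SZ (K := K) (m := m)).
  by apply: measurableT_comp => //; exact: measurable_patch_pos.
by move=> w; apply: patch_pos_growth => //; exact: sample_norm_ge0.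
Qed.

(** Off the null event W <= 0 the mean value theorem between W and W + r bounds the increment by r L
    (2 + W), which is integrable. *)
Lemma sample_shift (h h1 : R -> R) L :
  (forall x : R, 0 < x -> is_derive x 1 h (h1 x)) ->
  (forall x, 0 < x -> `|h1 x| <= L * (1 + x)) ->
  exists C, forall r, 0 < r -> r <= 1 ->
    `|\int[P]_w (h \_ pos) (W w) - \int[P]_w h (W w + r)| <= r * C.
Proof.
move=> dh bh1.
have ch (x : R) : 0 < x -> {for x, continuous h} by move=> /dh/is_derive1_continuous.
have L0 : 0 <= L.
  by have := le_trans (normr_ge0 _) (bh1 1 ltr01); rewrite pmulr_lge0// addr_gt0.
have bh := @growth_deriv _ h h1 L 1 dh bh1.
have i2 := finite_measure_integrable_cst P 2 measurableT.
have i2W := integrableD measurableT i2 (integrable_sample_norm SZ).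
exists (L * \int[P]_w (2 + W w)) => r r0 r1.
have ih := integrable_sample_pos ch bh.
have ihr := integrable_sample_growth SZ r0 ch bh.
have iB := integrableB measurableT ih ihr.
pose N := [set w | W w <= 0].
have mN : measurable N by exact: measurable_sample_npos.
have mNC : measurable (setT `\` N) by exact: measurableD.
have Z1 c g : P.-integrable setT (EFin \o g) -> P.-integrable setT (EFin \o (fun w => c * g w)).
  by move=> ig; exact: (@integrableZl _ _ _ P setT measurableT c _ ig).
have iLW : P.-integrable setT (EFin \o (fun w => r * (L * (2 + W w)))).
  exact: (Z1 _ _ (Z1 _ _ i2W)).
rewrite -RintegralB//.
have -> : \int[P]_w ((h \_ pos) (W w) - h (W w + r)) =
    \int[P]_(w in setT `\` N) ((h \_ pos) (W w) - h (W w + r)).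
  by rewrite /Rintegral (@negligible_integral _ _ _ P setT N)//; exact: sample_norm_null.
apply: (le_trans (le_normr_Rintegral mNC (integrableS measurableT mNC _ iB))) => //.
have -> : r * (L * \int[P]_w (2 + W w)) = \int[P]_w (r * (L * (2 + W w))).
  rewrite !RintegralZl//; exact: (Z1 _ _ i2W).
have -> : \int[P]_w (r * (L * (2 + W w))) = \int[P]_(w in setT `\` N) (r * (L * (2 + W w))).
  by rewrite /Rintegral (@negligible_integral _ _ _ P setT N)//; exact: sample_norm_null.
apply: le_Rintegral => //.
- exact: integrable_abse (integrableS measurableT mNC (@subsetT _ _) iB).
- exact: integrableS measurableT mNC (@subsetT _ _) iLW.
move=> w [_ /negP]; rewrite -ltNge => W0; rewrite patch_pos// distrC.
have [c /andP[c1 c2] ->] := MVT_pos W0 (ltW (ltr_pwDr r0 (lexx (W w)))) dh.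
have -> : W w + r - W w = r by ring.
have c0 := lt_le_trans W0 c1.
rewrite normrM (gtr0_norm r0) mulrC ler_wpM2l ?(ltW r0)//.
by apply: (le_trans (bh1 _ c0)); rewrite ler_wpM2l//; lra.
Qed.

End wishart_law.

Lemma le_of_shift (R : realType) (x B C : R) :
  (forall r, 0 < r -> r <= 1 -> x <= B + r * C) -> x <= B.
Proof.
move=> h; apply/ler_addgt0Pr => e e0.
have C1 : 0 < `|C| + 1 by rewrite ltr_wpDl.
pose r := Num.min 1 (e / (`|C| + 1)).
have r0 : 0 < r by rewrite lt_min ltr01 divr_gt0.
apply: (le_trans (h r r0 _)); first by rewrite ge_min lexx.
rewrite lerD2l; apply: (@le_trans _ _ (r * (`|C| + 1))).
  by rewrite ler_wpM2l ?(ltW r0)// (le_trans (ler_norm C))// lerDl.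
by rewrite -ler_pdivlMr// ge_min lexx orbT.
Qed.

(** * Robbins' lower bound for the Gamma function *)

Section robbins.
Context {R : realType}.
Implicit Types x y u v A : R.
Local Notation mu := (@lebesgue_measure R).

(** The remainder g of the second-order expansion at 1 has derivative (z - 1)^2 / z. It is
    nonnegative right of 1; left of 1 the restriction z >= 1/2 bounds 1 / z by the constant 2. *)
Lemma ln1D_lower v : - (1 / 2) <= v -> v - v ^+ 2 / 2 - 2 * `|v| ^+ 3 <= ln (1 + v).
Proof.
move=> v2.
pose g v := ln v - (v - 1) + (v - 1) * (v - 1) / 2.
have dg (z : R) : 0 < z -> is_derive z 1 g ((z - 1) ^+ 2 / z).
  move=> z0; have d1 : is_derive z 1 (fun z => z - 1) 1.
    by apply: (is_derive1_eq (is_derive1B (is_derive1_id z) (is_derive1_cst z 1))); rewrite subr0.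
  have h := is_derive1D (is_derive1B (is_derive1_ln z0) d1)
    (is_derive1M (is_derive1M d1 d1) (is_derive1_cst z 2^-1)).
  apply: (is_derive1_eq h).
  by field; rewrite gt_eqF.
have g1 : g 1 = 0 by rewrite /g ln1 subrr !mul0r subrr addr0.
have gE : ln (1 + v) = g (1 + v) + v - v ^+ 2 / 2.
  rewrite /g (_ : 1 + v - 1 = v); [ring|by ring].
have w0 : 0 < 1 + v by lra.
suff : - (2 * `|v| ^+ 3) <= g (1 + v) by rewrite gE; lra.
have [vp|vn] := leP 0 v.
  have v1 : 1 <= 1 + v by lra.
  have [c /andP[c1 c2] e] := MVT_pos ltr01 v1 dg.
  rewrite g1 subr0 in e; rewrite e; apply: (@le_trans _ _ 0).
    by rewrite oppr_le0 mulr_ge0// exprn_ge0.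
  by rewrite mulr_ge0 ?divr_ge0 ?sqr_ge0//; lra.
have v1 : 1 + v <= 1 by lra.
have [c /andP[c1 c2] e] := MVT_pos w0 v1 dg.
have -> : g (1 + v) = - ((c - 1) ^+ 2 / c * - v) by rewrite -[LHS]opprK -[- g _]add0r -g1 e; ring.
rewrite lerN2 ltr0_norm//.
have -> : 2 * (- v) ^+ 3 = 2 * (- v) ^+ 2 * - v by ring.
have c0 : 0 < c by lra.
rewrite ler_wpM2r ?oppr_ge0 ?(ltW vn)// ler_pdivrMr//.
have h1 : (c - 1) ^+ 2 <= (- v) ^+ 2.
  by rewrite -[leLHS]sqrrN; apply: lerXn2r; rewrite ?nnegrE; lra.
apply: (le_trans h1); rewrite mulrAC ler_peMl ?sqr_ge0//; lra.
Qed.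

(** Stirling's approximation of Gamma(y + 1) divided by Gamma(y + 1), with powers written as
    exponentials so that y --> y + 1 acts on the exponent. *)
Definition stirling_ratio y : R :=
  Num.sqrt (2 * pi) * expR ((y + 1 / 2) * ln y - y) / Gamma_fun (y + 1).

(** The Gamma Stein identity for f = 1 says that the Gamma law of shape a and scale 1 has mean a;
    the mean is also Gamma(a + 1) / Gamma(a). *)
Lemma Gamma_funS (a : R) : 0 < a -> Gamma_fun (a + 1) = a * Gamma_fun a.
Proof.
move=> a0; have G0 := Gamma_fun_gt0 a0.
pose k x : R := a * 1 - x.
have ck (x : R) : 0 < x -> {for x, continuous k}.
  by move=> _; apply: cvgB; [exact: cvg_cst|exact: cvg_id].
have bk x : 0 < x -> `|k x| <= (a + 1) * (1 + x) ^+ 1.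
  by move=> x0; apply: (le_trans (ler_normB _ _)); rewrite mulr1 !gtr0_norm//; nra.
have ik := integrable_gamma_growth a0 ltr01 ck bk.
have d1 (x : R) : 0 < x -> is_derive x 1 (fun=> 1 : R) (0 : R).
  by move=> _; exact: is_derive1_cst.
have b1 x : 0 < x -> `|1| <= 1 * (1 + x) by move=> x0; rewrite normr1 mul1r lerDl ltW.
have E x : 0 < x -> 1 * x * 0 + (a * 1 - x) * 1 = k x by move=> _; rewrite /k; ring.
have := gamma_stein a0 ltr01 d1 ck b1 E ik.
have cid (x : R) : 0 < x -> {for x, continuous (fun x : R => x)} by move=> _; exact: cvg_id.
have bid x : 0 < x -> `|x| <= 1 * (1 + x) ^+ 1 by move=> x0; rewrite gtr0_norm// mul1r; lra.
have ip := integrable_gamma_pdf1 a0.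
have ix := integrable_gamma_growth a0 ltr01 cid bid.
rewrite /k; under eq_Rintegral do rewrite mulr1 mulrBl.
rewrite RintegralB//; last by apply: (@integrableZl _ _ _ mu _ _ a _ ip).
rewrite RintegralZl// Rintegral_gamma_pdf1// mulr1 => /eqP; rewrite subr_eq0 => /eqP e.
have e2 : \int[mu]_(x in `]0%R, +oo[) (x * gamma_pdf a 1 x) =
    (Gamma_fun a)^-1 * Gamma_fun (a + 1).
  rewrite /Gamma_fun -RintegralZl//; last first.
    have := @integrable_gamma_kernel R (a + 1) 1 (addr_gt0 a0 ltr01) ltr01.
    by under [X in _.-integrable _ (_ \o X) -> _]eq_fun do rewrite divr1.
  apply: eq_Rintegral => x; rewrite inE/= in_itv/= andbT => x0.
  rewrite mul_gamma_pdf// powR1 mulr1 divr1 addrK//.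
by rewrite [X in _ = X * _]e e2 mulrAC mulVf ?mul1r// gt_eqF.
Qed.

Lemma stirling_ratioS x : 0 < x ->
  stirling_ratio (x + 1) = stirling_ratio x * expR ((x + 1 / 2) * ln (1 + x^-1) - 1).
Proof.
move=> x0; have x1 : 0 < x + 1 by rewrite addr_gt0.
have G0 := Gamma_fun_gt0 x1.
rewrite /stirling_ratio Gamma_funS//.
have -> : 1 + x^-1 = (x + 1) / x by field; rewrite gt_eqF.
rewrite ln_div ?posrE//.
have -> : (x + 1 + 1 / 2) * ln (x + 1) - (x + 1) =
    ((x + 1 / 2) * ln x - x) + ((x + 1 / 2) * (ln (x + 1) - ln x) - 1) + ln (x + 1) by ring.
rewrite 2!expRD lnK ?posrE//; field.
by rewrite !gt_eqF.
Qed.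

(** The left side is 12 / [D], so the claim is (x + 1/2) [E] >= 0. [E] is nonincreasing, and its
    value at y is at least -13 / y; letting y grow gives E >= 0. *)
Lemma robbins_increment x : 0 < x ->
  (12 * x + 1)^-1 - (12 * (x + 1) + 1)^-1 <= (x + 1 / 2) * ln (1 + x^-1) - 1.
Proof.
pose D x : R := (12 * x + 1) * (12 * x + 13).
pose N x : R := (D x + 12) / (D x * (x + 1 / 2)).
pose E x : R := (ln (x + 1) - ln x) - N x.
pose E1 x : R := (x + 1)^-1 - x^-1 +
  (12 * (288 * x + 168) * (x + 1 / 2) + D x * (D x + 12)) / ((D x) ^+ 2 * (x + 1 / 2) ^+ 2).
have D0 z : 0 < z -> 0 < D z by move=> z0; rewrite /D mulr_gt0//; lra.
have dE (z : R) : 0 < z -> is_derive z 1 E (E1 z).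
  move=> z0; have z1 : 0 < z + 1 by lra.
  have d1 c k : is_derive z 1 (fun z => c * z + k) c.
    apply: (is_derive1_eq (is_derive1D (is_derive1M (is_derive1_cst z c) (is_derive1_id z)) (is_derive1_cst z k))).
    by ring.
  have dz1 : is_derive z 1 (fun z => z + 1) 1.
    by apply: (is_derive1_eq (is_derive1D (is_derive1_id z) (is_derive1_cst z 1))); rewrite addr0.
  have dz2 : is_derive z 1 (fun z => z + 1 / 2) 1.
    by apply: (is_derive1_eq (is_derive1D (is_derive1_id z) (is_derive1_cst z (1 / 2)))); rewrite addr0.
  have dD := is_derive1M (d1 12 1) (d1 12 13).
  have dl1 := @is_derive1_chain R (@ln R) (fun z => z + 1) z _ _ (is_derive1_ln z1) dz1.
  have dN0 : D z * (z + 1 / 2) != 0 by rewrite gt_eqF// mulr_gt0 ?D0//; lra.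
  have dV := @is_derive1V R (fun z => D z * (z + 1 / 2)) z _ dN0 (is_derive1M dD dz2).
  have h := is_derive1B (is_derive1B dl1 (is_derive1_ln z0))
    (is_derive1M (is_derive1D dD (is_derive1_cst z 12)) dV).
  apply: (is_derive1_eq h); rewrite /E1 /D; field.
  by rewrite !gt_eqF//; lra.
have E1n z : 0 < z -> E1 z <= 0.
  (* In the numerator the term -72 z is compensated by 720 (z - 1/20)^2. *)
  move=> z0; have -> : E1 z = - (1152 * z ^+ 3 + 1068 * z ^+ 2 - 72 * z + 169 / 4) /
      (z * (z + 1) * D z ^+ 2 * (z + 1 / 2) ^+ 2).
    rewrite /E1 /D; field; rewrite !gt_eqF//; lra.
  rewrite mulNr oppr_le0; apply: divr_ge0.
    have := exprn_ge0 3 (ltW z0); have := sqr_ge0 (z - 1 / 20); rewrite !expr2; lra.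
  have z1 : 0 <= z + 1 by lra.
  by do 2 (apply: mulr_ge0; last exact: sqr_ge0); apply: mulr_ge0 => //; exact: ltW.
move=> x0.
have Ex0 : 0 <= E x.
  have Ey y : x <= y -> - (13 / y) <= E x.
    move=> xy; have y0 := lt_le_trans x0 xy.
    have [c /andP[c1 _] e] := MVT_pos x0 xy dE.
    have h1 : E1 c * (y - x) <= 0 by rewrite mulr_le0_ge0 ?E1n ?subr_ge0//; exact: lt_le_trans c1.
    have lny : ln y <= ln (y + 1) by rewrite ler_ln ?posrE//; lra.
    have Ny : N y <= 13 / y.
      have Dy : 1 <= D y by rewrite /D; nra.
      have Dp := D0 _ y0.
      have y2 : 0 < y + 1 / 2 by lra.
      rewrite /N; move: (D y) Dy Dp => q q1 q0; rewrite ler_pdivrMr ?mulr_gt0//.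
      have -> : 13 / y * (q * (y + 1 / 2)) = 13 * q + 13 / 2 * q / y by field; rewrite gt_eqF.
      have : 0 <= 13 / 2 * q / y by rewrite divr_ge0 ?mulr_ge0// ltW.
      lra.
    by rewrite -e in h1; rewrite /E in h1 *; lra.
  rewrite leNgt; apply/negP => En.
  (* Beyond 26 / |E x| the lower bound -13 / y exceeds half of E x, a contradiction. *)
  pose y := Num.max x (26 / - E x).
  have yx : x <= y by rewrite le_max lexx.
  have y0 := lt_le_trans x0 yx.
  have h := Ey _ yx.
  have : 26 / - E x <= y by rewrite le_max lexx orbT.
  rewrite ler_pdivrMr ?oppr_gt0// => h2.
  have : 13 / y * y = 13 by rewrite divfK// gt_eqF.
  move: (13 / y) h => q hq qy; nra.
have x2 : 0 < x + 1 / 2 by lra.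
have -> : 1 + x^-1 = (x + 1) / x by field; rewrite gt_eqF.
rewrite ln_div ?posrE//; last by lra.
have : 0 <= (x + 1 / 2) * E x by rewrite mulr_ge0// ltW.
have -> : (12 * x + 1)^-1 - (12 * (x + 1) + 1)^-1 = (x + 1 / 2) * N x - 1.
  by rewrite /N /D; field; rewrite !gt_eqF//; lra.
rewrite /E; lra.
Qed.

(** Chebyshev's inequality; the second moment 1 comes from integration by parts with F(x) = x. *)
Lemma normal_prob_itv A : 0 < A -> 1 - A ^- 2 <= fine (normal_prob 0 1 `[- A, A]%classic).
Proof.
move=> A0; pose N := normal_prob (0 : R) 1.
have [] := @normal_ibp R (fun x => x) (fun=> 1) 1 1.
- by move=> x; exact: cvg_cst.
- by move=> x; rewrite mul1r expr1; have := normr_ge0 x; rewrite -real_normK ?num_real//; nra.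
- by move=> x; rewrite mul1r expr1 normr1 lerDl sqr_ge0.
move=> i2 i1 e.
have e1 : \int[N]_x (1 : R) = 1 by exact: Rintegral_prob_cst.
have iz : N.-integrable setT (EFin \o (fun x => A ^- 2 * (x * x))).
  exact: (@integrableZl _ _ _ N setT measurableT (A ^- 2) _ i2).
have -> : 1 - A ^- 2 = \int[N]_x (1 - A ^- 2 * (x * x)).
  by rewrite RintegralB// RintegralZl// e e1 mulr1.
have iI : N.-integrable setT (EFin \o \1_(`[- A, A]%classic)).
  apply: integrable_indic; exact: measurable_itv.
have -> : fine (N `[- A, A]%classic) = \int[N]_x \1_(`[- A, A]%classic) x.
  by rewrite /Rintegral integral_indic// setIT.
apply: le_Rintegral => //; first exact: (integrableB measurableT i1 iz).
move=> x _; rewrite indicE; case: (boolP (x \in _)) => [_|]/=.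
  by rewrite gerBl mulr_ge0// ?invr_ge0 ?sqr_ge0// -expr2 sqr_ge0.
rewrite notin_setE/= in_itv/= => /negP; rewrite negb_and -!ltNge => h.
rewrite subr_le0 mulrC ler_pdivlMr ?exprn_gt0// mul1r expr2.
case/orP: h => h; nra.
Qed.

(** A one-sided Laplace method. In the variable u with x = y + u sqrt y, the Gamma density of shape
    y + 1 dominates c times the standard normal density on [-A, A], by [ln1D_lower]; its mass is at
    most 1. The condition 2 A <= sqrt y ensures u / sqrt y >= -1/2. *)
Lemma stirling_ratio_bound y A : 0 < A -> 2 * A <= Num.sqrt y ->
  stirling_ratio y * expR (- (2 * A ^+ 3 / Num.sqrt y)) * (1 - A ^- 2) <= 1.
Proof.
move=> A0 yA; set s := Num.sqrt y in yA *.
have s0 : 0 < s by lra.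
have y0 : 0 < y by move: s0; rewrite /s sqrtr_gt0.
have y1 : 0 < y + 1 by lra.
have sy : s * s = y by rewrite -expr2 sqr_sqrtr// ltW.
have arg u : - A <= u <= A -> 0 < y + s * u by move=> /andP[uA _]; rewrite -sy; nra.
pose F u := Plow (y + 1) (y + s * u).
pose f u := gamma_pdf (y + 1) 1 (y + s * u) * s.
have dl u : is_derive u 1 (fun u => y + s * u) s.
  apply: (is_derive1_eq (is_derive1D (is_derive1_cst u y) (is_derive1M (is_derive1_cst u s) (is_derive1_id u)))).
  by ring.
have dF u : - A <= u <= A -> is_derive u 1 F (f u).
  move=> uA; exact: (@is_derive1_chain R (Plow (y + 1)) (fun u => y + s * u) u _ _ (is_derive_Plow y1 (arg _ uA)) (dl u)).
have cf u : - A <= u <= A -> {for u, continuous f}.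
  move=> uA; apply: cvgM; last exact: cvg_cst.
  apply: (@continuous_comp _ _ _ (fun u : R => y + s * u) (gamma_pdf (y + 1) 1)).
    exact: is_derive1_continuous (dl u).
  by apply: continuous_gamma_pdf; exact: arg.
have AA : - A < A by lra.
have FTC := FTC_segment AA dF cf.
pose c := stirling_ratio y * expR (- (2 * A ^+ 3 / s)).
have c0 : 0 <= c.
  by rewrite mulr_ge0 ?expR_ge0// /stirling_ratio !mulr_ge0 ?expR_ge0// invr_ge0 ltW// Gamma_fun_gt0.
have fc u : - A <= u <= A -> c * normal_pdf 0 1 u <= f u.
  move=> uA; have xu := arg _ uA.
  have w0 : 0 < 1 + u / s.
    have -> : 1 + u / s = (s + u) / s by field; rewrite gt_eqF.
    by rewrite divr_gt0//; move/andP: uA => [uA _]; lra.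
  have wE : y + s * u = y * (1 + u / s).
    by rewrite -sy; field; rewrite gt_eqF.
  have nE : normal_pdf 0 1 u = (Num.sqrt (2 * pi))^-1 * expR (- (u ^+ 2 / 2)).
    rewrite normal_pdfE ?oner_eq0// /normal_peak /normal_fun expr1n mul1r subr0 mulr_natl.
    by rewrite mulNr.
  have sE : s = expR (1 / 2 * ln y).
    by rewrite /s -powR12_sqrt ?(ltW y0)// /powR gt_eqF// mul1r.
  have pi0 : Num.sqrt (2 * pi) != 0 :> R by rewrite gt_eqF// sqrtr_gt0 mulr_gt0// pi_gt0.
  have G0 := Gamma_fun_gt0 y1.
  have -> : c * normal_pdf 0 1 u =
      (Gamma_fun (y + 1))^-1 * expR ((y + 1 / 2) * ln y - y + - (2 * A ^+ 3 / s) + - (u ^+ 2 / 2)).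
    by rewrite nE /c /stirling_ratio [in RHS]expRD [in RHS]expRD; field; rewrite pi0 gt_eqF.
  have -> : f u = (Gamma_fun (y + 1))^-1 * expR (y * ln (y + s * u) + - (y + s * u) + 1 / 2 * ln y).
    rewrite /f gamma_pdfE// powR1 mulr1 addrK divr1 /powR gt_eqF// 2!expRD -sE; ring.
  have lnw : ln (y + s * u) = ln y + ln (1 + u / s) by rewrite wE lnM ?posrE.
  rewrite ler_wpM2l ?invr_ge0 ?(ltW G0)// ler_expR lnw.
  have nu : `|u| <= A by rewrite ler_norml.
  have v2 : - (1 / 2) <= u / s by rewrite ler_pdivlMr//; move/andP: uA => [uA _]; lra.
  have hl := ln1D_lower v2.
  have e1 : y * (u / s - (u / s) ^+ 2 / 2 - 2 * `|u / s| ^+ 3) = s * u - u ^+ 2 / 2 - 2 * `|u| ^+ 3 / s.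
    by rewrite normrM normfV (gtr0_norm s0) -sy; field; rewrite gt_eqF.
  have h3 : 2 * `|u| ^+ 3 / s <= 2 * A ^+ 3 / s.
    rewrite ler_wpM2r ?invr_ge0 ?(ltW s0)// ler_wpM2l//.
    by apply: lerXn2r; rewrite ?nnegrE// ltW.
  have : y * (u / s - (u / s) ^+ 2 / 2 - 2 * `|u / s| ^+ 3) <= y * ln (1 + u / s).
    by rewrite ler_wpM2l ?(ltW y0).
  rewrite e1; lra.
apply: (@le_trans _ _ (c * fine (normal_prob 0 1 `[- A, A]%classic))).
  by rewrite ler_wpM2l// normal_prob_itv.
have Nfin : normal_prob 0 1 `[- A, A]%classic \is a fin_num by exact: fin_num_measure.
rewrite -lee_fin EFinM fineK// /normal_prob.
have l2 : (\int[mu]_(u in `[(- A)%R, A]) (f u)%:E <= 1)%E.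
  rewrite FTC lee_fin lerBlDr (le_trans (Plow_le1 y1 (arg _ _)))//; first by lra.
  by rewrite lerDl Plow_ge0.
apply: le_trans l2; rewrite -ge0_integralZl//=; last 2 first.
- by apply/measurable_EFinP; apply: measurable_funTS; exact: measurable_normal_pdf.
- by move=> x _; rewrite lee_fin normal_pdf_ge0.
apply: ge0_le_integral => //.
- by move=> x _; rewrite lee_fin mulr_ge0// normal_pdf_ge0.
- apply/measurable_EFinP; apply: measurable_funM => //.
  by apply: measurable_funTS; exact: measurable_normal_pdf.
- apply/measurable_EFinP; apply: subspace_continuous_measurable_fun => //.
  by apply: within_cont => u; rewrite /= in_itv/=; exact: cf.
Qed.

(** The function [t] does not decrease when its argument grows by 1, by [robbins_increment], and
    along x + n its upper limit is at most 1, by [stirling_ratio_bound]. *)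
Lemma stirling_ratio_robbins x : 0 < x -> stirling_ratio x * expR (12 * x + 1)^-1 <= 1.
Proof.
move=> x0; pose t y := stirling_ratio y * expR (12 * y + 1)^-1.
have st0 y : 0 < y -> 0 <= stirling_ratio y.
  move=> y0; rewrite /stirling_ratio !mulr_ge0 ?expR_ge0// invr_ge0 ltW// Gamma_fun_gt0//; lra.
have tS y : 0 < y -> t y <= t (y + 1).
  move=> y0; rewrite /t stirling_ratioS// -mulrA ler_wpM2l ?st0// -expRD ler_expR.
  by have := robbins_increment y0; lra.
have tN n : t x <= t (x + n%:R).
  elim: n => [|n IH]; first by rewrite addr0.
  apply: (le_trans IH); rewrite -natr1 addrA; apply: tS.
  by rewrite ltr_wpDr.
have key e : 0 < e -> e < 1 -> t x * ((1 - e) * (1 - e)) <= 1.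
  (* With A = 1 / e the loss of normal mass is e^2 <= e. [B] is chosen so that sqrt y >= B makes the
     exponents 1 / (12 y + 1) + 2 A^3 / sqrt y at most e. *)
  move=> e0 e1; pose A := 1 / e.
  have A0 : 0 < A by rewrite divr_gt0.
  pose B := 2 * A + (1 + 2 * A ^+ 3) / e + 1.
  have A30 : 0 < A ^+ 3 by rewrite exprn_gt0.
  have q0 : 0 < (1 + 2 * A ^+ 3) / e by rewrite divr_gt0//; lra.
  have B1 : 1 <= B by rewrite /B; lra.
  have [n hn] := lt_bound_nat (B ^+ 2).
  set y := x + n%:R.
  have By : B ^+ 2 <= y by rewrite /y; lra.
  have y0 : 0 < y by rewrite (lt_le_trans _ By)// exprn_gt0//; lra.
  pose s := Num.sqrt y.
  have Bs : B <= s by rewrite -[B]ger0_norm ?(le_trans ler01)// -sqrtr_sqr ler_wsqrtr.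
  have s0 : 0 < s by lra.
  have sy : s * s = y by rewrite -expr2 sqr_sqrtr// ltW.
  have As : 2 * A <= s by rewrite (le_trans _ Bs)// /B; lra.
  have h := stirling_ratio_bound A0 As.
  have AE : A ^- 2 = e * e by rewrite /A; field; rewrite gt_eqF.
  have th1 : (12 * y + 1)^-1 <= s^-1 by rewrite lef_pV2 ?posrE//; nra.
  have th2 : (1 + 2 * A ^+ 3) / s <= e.
    have q1 : (1 + 2 * A ^+ 3) / e * e = 1 + 2 * A ^+ 3 by rewrite divfK// gt_eqF.
    have q2 : (1 + 2 * A ^+ 3) / e <= s by apply: le_trans Bs; rewrite /B; lra.
    by rewrite ler_pdivrMr// -[leLHS]q1 mulrC ler_wpM2l// ltW.
  have th : (12 * y + 1)^-1 + 2 * A ^+ 3 / s <= e.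
    have th2E : (1 + 2 * A ^+ 3) / s = s^-1 + 2 * A ^+ 3 / s by rewrite [LHS]mulrDl mul1r.
    by rewrite th2E in th2; apply: le_trans th2; rewrite lerD2r.
  have ty : stirling_ratio y * expR (- (2 * A ^+ 3 / s)) =
      t y * expR (- ((12 * y + 1)^-1 + 2 * A ^+ 3 / s)).
    have -> : t y * expR (- ((12 * y + 1)^-1 + 2 * A ^+ 3 / s)) = stirling_ratio y *
        (expR (12 * y + 1)^-1 * expR (- ((12 * y + 1)^-1 + 2 * A ^+ 3 / s))) by rewrite mulrA.
    rewrite -expRD; congr (stirling_ratio y * expR _); ring.
  rewrite ty AE in h; apply: le_trans h.
  have tx0 : 0 <= t x by rewrite mulr_ge0 ?expR_ge0 ?st0.
  have p2 : 0 <= 1 - e by lra.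
  have p1 : 0 <= t x * (1 - e) by exact: mulr_ge0.
  rewrite mulrA; apply: ler_pM => //; last by nra.
  apply: ler_pM => //; first exact: tN.
  apply: le_trans (expR_ge1Dx _); lra.
rewrite -/(t x) leNgt; apply/negP => T1.
have T0 : 0 < t x by lra.
(* This e makes t (1 - e)^2 at least t - 2 t e = t - (t - 1) / 2, which exceeds 1 when t > 1. *)
have e0 : 0 < (t x - 1) / (4 * t x) by rewrite divr_gt0//; lra.
have e1 : (t x - 1) / (4 * t x) < 1 by rewrite ltr_pdivrMr//; lra.
have := key _ e0 e1.
have : (t x - 1) / (4 * t x) * t x = (t x - 1) / 4 by field; rewrite gt_eqF.
move: ((t x - 1) / (4 * t x)) e0 => q q0 E h; nra.
Qed.

(** The density peaks at b (a - 1); the value there is bounded by Robbins' inequality at a - 1,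
    whose correction 12 (a - 1) + 1 = 12 a - 11 is the one in [r_const]. *)
Lemma gamma_pdf_sup (a b x : R) : 1 < a -> 0 < b ->
  gamma_pdf a b x <= (b * (Num.sqrt (2 * pi * (a - 1)) * r_const a))^-1.
Proof.
move=> a1 b0; pose s := a - 1; have s0 : 0 < s by rewrite /s; lra.
have r0 : 0 < r_const a by exact: expR_gt0.
have pi0 := @pi_gt0 R.
have q0 : 0 < Num.sqrt (2 * pi * s) by rewrite sqrtr_gt0 !mulr_gt0.
have [xp|xn] := ltP 0 x; last by rewrite /gamma_pdf ltNge xn /= invr_ge0 !mulr_ge0// ltW.
have G0 : 0 < Gamma_fun a by apply: Gamma_fun_gt0; lra.
have bs0 : 0 < b * s by rewrite mulr_gt0.
(* Maximality at the mode is the inequality ln v <= v - 1 for v = x / (b s). *)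
have lnx : s * ln x - x / b <= s * ln b + s * ln s - s.
  have h : ln (1 + (x / (b * s) - 1)) <= x / (b * s) - 1.
    have q1 : 0 < x / (b * s) by rewrite divr_gt0.
    by apply: le_ln1Dx; lra.
  have e1 : 1 + (x / (b * s) - 1) = x / (b * s) by ring.
  rewrite e1 ln_div ?posrE// lnM ?posrE// in h.
  have : s * (ln x - (ln b + ln s)) <= s * (x / (b * s) - 1) by rewrite ler_wpM2l ?(ltW s0).
  have -> : s * (x / (b * s) - 1) = x / b - s by field; rewrite !gt_eqF.
  lra.
have m1 : gamma_pdf a b x <= (Gamma_fun a)^-1 * expR (s * ln s - s) / b.
  rewrite gamma_pdfE// /powR !gt_eqF// -/s mulNr -expRD.
  have -> : a * ln b = s * ln b + ln b by rewrite /s; ring.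
  have -> : expR (s * ln b + ln b) = expR (s * ln b) * b by rewrite expRD lnK ?posrE.
  have E0 := expR_gt0 (s * ln b).
  have -> : (Gamma_fun a)^-1 * expR (s * ln s - s) / b =
      (Gamma_fun a * (expR (s * ln b) * b))^-1 * (expR (s * ln b) * expR (s * ln s - s)).
    by field; rewrite !gt_eqF.
  rewrite ler_wpM2l ?invr_ge0 ?mulr_ge0 ?(ltW G0) ?(ltW E0) ?(ltW b0)//.
  by rewrite -expRD ler_expR; lra.
have := stirling_ratio_robbins s0.
have -> : stirling_ratio s * expR (12 * s + 1)^-1 =
    (Num.sqrt (2 * pi * s) * r_const a) * ((Gamma_fun a)^-1 * expR (s * ln s - s)).
  rewrite /stirling_ratio /r_const.
  have -> : s + 1 = a by rewrite /s; ring.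
  have -> : 12 * s + 1 = 12 * a - 11 by rewrite /s; ring.
  have -> : (s + 1 / 2) * ln s - s = 1 / 2 * ln s + (s * ln s - s) by ring.
  rewrite expRD; have -> : expR (1 / 2 * ln s) = Num.sqrt s.
    by rewrite -powR12_sqrt ?(ltW s0)// /powR gt_eqF// mul1r.
  by rewrite [in RHS]sqrtrM ?mulr_ge0 ?(ltW pi0)//; ring.
rewrite mulrC -ler_pdivlMr ?mulr_gt0// mul1r => h.
apply: (le_trans m1); rewrite invfM mulrC ler_wpM2l ?invr_ge0 ?(ltW b0)//.
Qed.

End robbins.

(** * Smoothed half-line indicators *)

Section ramp.
Context {R : realType}.
Implicit Types x y : R.
Local Notation mu := (@lebesgue_measure R).

(** Handles powers of [pospart] at the kink, where the two one-sided formulas meet. *)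
Lemma is_derive_flat0 (f : R -> R) : (forall h, `|h| <= 1 -> `|f h| <= h ^+ 2) ->
  is_derive (0 : R) 1 f 0.
Proof.
move=> hf; have f0 : f 0 = 0.
  by have := hf 0; rewrite normr0 expr0n/= normr_le0 => /(_ ler01)/eqP.
have c : h^-1 *: ((f \o shift (0 : R)) (h *: 1) - f 0) @[h --> 0^'] --> (0 : R).
  apply/norm_cvg0P; apply: (@squeeze_cvgr _ _ _ _ (fun=> 0) (fun h : R => `|h|)).
  - near=> h; have h0 : h != 0 by near: h; exact: nbhs_dnbhs_neq.
    have h1 : `|h| <= 1 by near: h; exact: dnbhs0_le.
    rewrite normr_ge0/= f0 subr0 /shift/= addr0 [_ *: 1]mulr1 normrM normfV.
    by rewrite mulrC ler_pdivrMr ?normr_gt0// -expr2 real_normK ?num_real ?hf.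
  - exact: cvg_cst.
  - rewrite -[X in _ --> X](@normr0 _ R).
    by apply: cvg_norm; exact: cvg_within.
apply: DeriveDef; first by apply/cvg_ex; exists 0.
exact: cvg_lim.
Unshelve. all: by end_near. Qed.

Lemma is_derive1_X n x : is_derive x 1 (fun y : R => y ^+ n.+1) (n.+1%:R * x ^+ n).
Proof.
elim: n => [|n IH]; first by rewrite expr0 mulr1; exact: is_derive1_id.
have -> : (fun y : R => y ^+ n.+2) = (fun y => y * y ^+ n.+1) by apply/funext => y; rewrite exprS.
apply: (is_derive1_eq (is_derive1M (is_derive1_id x) IH)).
by rewrite [n.+2%:R]mulrS exprS; ring.
Qed.

Definition pospart x : R := Num.max x 0.

Lemma pospart_pos x : 0 <= x -> pospart x = x.
Proof. by move=> x0; rewrite /pospart; apply/max_idPl. Qed.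

Lemma pospart_neg x : x <= 0 -> pospart x = 0.
Proof. by move=> x0; rewrite /pospart; apply/max_idPr. Qed.

Lemma continuous_pospart x : {for x, continuous pospart}.
Proof.
have -> : pospart = (fun x => (x + `|x|) / 2).
  apply/funext => y; have [y0|y0] := leP 0 y.
    by rewrite pospart_pos// ger0_norm//; field.
  by rewrite pospart_neg ?(ltW y0)// ltr0_norm// subrr mul0r.
by apply: cvgM; [apply: cvgD; [exact: cvg_id|exact: norm_continuous]|exact: cvg_cst].
Qed.

Lemma is_derive_pospartX k x :
  is_derive x 1 (fun y => pospart y ^+ k.+2) (k.+2%:R * pospart x ^+ k.+1).
Proof.
have [x0|x0|->] := ltgtP x 0.
- rewrite [pospart x]pospart_neg ?(ltW x0)// expr0n/= mulr0.
  apply: (@near_is_derive1 _ (fun=> 0)).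
  near=> y; rewrite pospart_neg ?expr0n//; apply: ltW; near: y.
  exact: lt_nbhsl.
- rewrite [pospart x]pospart_pos ?(ltW x0)//.
  apply: (@near_is_derive1 _ (fun y => y ^+ k.+2)); last exact: is_derive1_X.
  by near=> y; rewrite pospart_pos//; apply: ltW; near: y; exact: near_pos.
- rewrite [pospart 0]pospart_pos// expr0n/= mulr0; apply: is_derive_flat0 => h h1.
  have [h0|h0] := leP 0 h; last by rewrite pospart_neg ?(ltW h0)// expr0n/= normr0 sqr_ge0.
  rewrite pospart_pos// ger0_norm ?exprn_ge0//.
  rewrite -addn2 exprD ler_piMl ?sqr_ge0// exprn_ile1//.
  by rewrite ger0_norm in h1.
Unshelve. all: by end_near. Qed.

Variables e l : R.
Hypothesis e0 : 0 < e.
Hypothesis l0 : 0 < l.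

(* The integral of a trapezoidal bump of height [1 / e], plateau [l, e] (when
   [l <= e]) and support [0, e + l]: a continuously differentiable version of
   the piecewise linear ramp, which is the limit [l --> 0]. *)
Definition ramp x : R := 1 - (2 * e * l)^-1 *
  (pospart x ^+ 2 - pospart (x - l) ^+ 2 - (pospart (x - e) ^+ 2 - pospart (x - e - l) ^+ 2)).

Definition ramp1 x : R := - ((e * l)^-1 *
  (pospart x - pospart (x - l) - (pospart (x - e) - pospart (x - e - l)))).

Let is_derive_shift (f f1 : R -> R) c x : (forall y, is_derive y 1 f (f1 y)) ->
  is_derive x 1 (fun y => f (y - c)) (f1 (x - c)).
Proof.
move=> df; have d1 : is_derive x 1 (fun y => y - c) 1.
  by apply: (is_derive1_eq (is_derive1B (is_derive1_id x) (is_derive1_cst x c))); rewrite subr0.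
rewrite -[f1 _]mulr1; exact: (@is_derive1_chain R f (fun y => y - c) x _ _ (df _) d1).
Qed.

Lemma is_derive_ramp x : is_derive x 1 ramp (ramp1 x).
Proof.
have d2 := is_derive_pospartX 0.
have dl := is_derive_shift l x d2.
have de := is_derive_shift e x d2.
have del := is_derive_shift e x (fun y => is_derive_shift l y d2).
apply: (is_derive1_eq (is_derive1B (is_derive1_cst x 1) (is_derive1M (is_derive1_cst x (2 * e * l)^-1)
  (is_derive1B (is_derive1B (d2 x) dl) (is_derive1B de del))))).
rewrite /ramp1 !expr1; field; rewrite !gt_eqF//.
Qed.

Lemma continuous_ramp1 x : {for x, continuous ramp1}.
Proof.
have cs c y : {for y, continuous (fun y => pospart (y - c))}.
  apply: (@continuous_comp _ _ _ (fun y => y - c) pospart); last exact: continuous_pospart.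
  by apply: cvgB; [exact: cvg_id|exact: cvg_cst].
have cel : {for x, continuous (fun y => pospart (y - e - l))}.
  apply: (@continuous_comp _ _ _ (fun y => y - e) (fun y => pospart (y - l))); last exact: cs.
  by apply: cvgB; [exact: cvg_id|exact: cvg_cst].
apply: cvgN; apply: cvgM; first exact: cvg_cst.
apply: cvgB; apply: cvgB; [exact: continuous_pospart|exact: cs|exact: cs|exact: cel].
Qed.

(** The trapezoid before normalisation: it is piecewise linear, and the signs at its four kinks
    exhaust the cases. *)
Let bump x : 0 <= pospart x - pospart (x - l) - (pospart (x - e) - pospart (x - e - l)) <= l.
Proof.
rewrite /pospart; have e1 := e0; have l1 := l0.
case: (leP x 0) => h1; case: (leP (x - l) 0) => h2; case: (leP (x - e) 0) => h3;
  case: (leP (x - e - l) 0) => h4; apply/andP; split; lra.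
Qed.

Lemma ramp1_bound x : - e^-1 <= ramp1 x <= 0.
Proof.
have /andP[b1 b2] := bump x; have el := mulr_gt0 e0 l0.
rewrite /ramp1 lerN2 oppr_le0 mulr_ge0 ?invr_ge0 ?(ltW el)// andbT.
rewrite mulrC ler_pdivrMr//; apply: (le_trans b2).
by rewrite mulrA mulVf ?mul1r// gt_eqF.
Qed.

Lemma ramp_left x : x <= 0 -> ramp x = 1.
Proof.
have e1 := e0; have l1 := l0.
by move=> x0; rewrite /ramp !pospart_neg; try lra; rewrite expr0n/= !subr0 mulr0 subr0.
Qed.

Lemma ramp_right x : e + l <= x -> ramp x = 0.
Proof.
have e1 := e0; have l1 := l0.
move=> x0; rewrite /ramp !pospart_pos; try lra.
by field; rewrite !gt_eqF.
Qed.

Lemma ramp_nincr x y : x <= y -> ramp y <= ramp x.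
Proof.
rewrite le_eqVlt => /orP[/eqP->//|xy].
have [z _ h] := @MVT R ramp ramp1 x y xy (fun z _ => is_derive_ramp z)
  (within_cont (fun z _ => is_derive1_continuous (is_derive_ramp z))).
rewrite -subr_le0 h mulr_le0_ge0 ?subr_ge0 ?(ltW xy)//.
by have /andP[] := ramp1_bound z.
Qed.

Lemma ramp_ge0 x : 0 <= ramp x.
Proof.
have [h|h] := leP (e + l) x; first by rewrite ramp_right.
by rewrite -(ramp_right (lexx _)) ramp_nincr// ltW.
Qed.

Lemma ramp_le1 x : ramp x <= 1.
Proof.
have [h|h] := leP x 0; first by rewrite ramp_left.
by rewrite -(ramp_left (lexx _)) ramp_nincr// ltW.
Qed.

(** By symmetry of the bump about (e + l) / 2 the ramp has half the area of its window; cubes of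
    positive parts give the antiderivative. *)
Lemma ramp_primitive : exists2 F : R -> R, (forall x, is_derive x 1 F (ramp x)) &
  F (e + l) - F 0 = (e + l) / 2.
Proof.
pose F x : R := x - (6 * e * l)^-1 *
  (pospart x ^+ 3 - pospart (x - l) ^+ 3 - (pospart (x - e) ^+ 3 - pospart (x - e - l) ^+ 3)).
have d3 := is_derive_pospartX 1.
have dF x : is_derive x 1 F (ramp x).
  have dl := is_derive_shift l x d3.
  have de := is_derive_shift e x d3.
  have del := is_derive_shift e x (fun y => is_derive_shift l y d3).
  apply: (is_derive1_eq (is_derive1B (is_derive1_id x) (is_derive1M (is_derive1_cst x (6 * e * l)^-1)
    (is_derive1B (is_derive1B (d3 x) dl) (is_derive1B de del))))).
  rewrite /ramp; field; rewrite !gt_eqF//.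
exists F => //; have e1 := e0; have l1 := l0.
rewrite /F [pospart 0]pospart_pos// !(@pospart_neg (0 - _)); try lra.
rewrite (@pospart_neg (0 - e - l)); last by lra.
rewrite (@pospart_pos (e + l)); last by lra.
rewrite (@pospart_pos (e + l - l)); last by lra.
rewrite (@pospart_pos (e + l - e)); last by lra.
rewrite (@pospart_pos (e + l - e - l)); last by lra.
by field; rewrite !gt_eqF.
Qed.

Let ramp_window c (f G : R -> R) : (forall x, is_derive x 1 G (f x)) ->
  (forall x, {for x, continuous f}) ->
  (\int[mu]_(x in `[c, (c + (e + l))%R]) (f (x - c))%:E = (G (e + l) - G 0)%:E)%E.
Proof.
move=> dG cf; have cw : c < c + (e + l) by rewrite ltrDl addr_gt0.
have dFc x : c <= x <= c + (e + l) -> is_derive x 1 (fun x => G (x - c)) (f (x - c)).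
  by move=> _; exact: is_derive_shift.
have cFc x : c <= x <= c + (e + l) -> {for x, continuous (fun x => f (x - c))}.
  move=> _; apply: (@continuous_comp _ _ _ (fun y : R => y - c) f); last exact: cf.
  by apply: cvgB; [exact: cvg_id|exact: cvg_cst].
by rewrite (FTC_segment cw dFc cFc) subrr addrAC subrr add0r.
Qed.

Let continuous_ramp x : {for x, continuous ramp}.
Proof. exact: is_derive1_continuous (is_derive_ramp x). Qed.

Lemma integral_ramp c :
  (\int[mu]_(x in `[c, (c + (e + l))%R]) (ramp (x - c))%:E = ((e + l) / 2)%:E)%E.
Proof. by have [F dF <-] := ramp_primitive; exact: ramp_window. Qed.

Lemma integral_onem_ramp c :
  (\int[mu]_(x in `[c, (c + (e + l))%R]) (1 - ramp (x - c))%:E = ((e + l) / 2)%:E)%E.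
Proof.
have [F dF FE] := ramp_primitive.
have dG x : is_derive x 1 (fun x => x - F x) (1 - ramp x).
  exact: is_derive1B (is_derive1_id x) (dF x).
have cf x : {for x, continuous (fun x => 1 - ramp x)}.
  by apply: cvgB; [exact: cvg_cst|exact: continuous_ramp].
rewrite (@ramp_window c (fun x => 1 - ramp x) (fun x => x - F x) dG cf); congr EFin; lra.
Qed.

End ramp.

Lemma probability_indic d (T : measurableType d) (R : realType) (P : probability T R)
    (X : T -> R) (A : set R) : measurable_fun setT X -> measurable A ->
  P (X @^-1` A) = (\int[P]_w (\1_A (X w))%:E)%E.
Proof.
move=> mX mA; have mXA : measurable (X @^-1` A).
  by rewrite -[X in measurable X]setTI; exact: mX.
by have := integral_indic P measurableT mXA; rewrite setIT => <-.
Qed.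

(** * Bounds for the three distances *)

Section distances.
Context dP (T : measurableType dP) (R : realType) (P : probability T R) (d n : nat).
Variables (S : 'M[R]_d) (Z : 'I_n -> {RV P >-> 'cV[R]_d}).
Hypothesis indZ : independent_RVs Z.
Hypothesis SZ : forall i, is_multinormal S (Z i).
Hypothesis Ssym : S \is symmetricmx.
Hypothesis Spd : posdefmx S.
Hypothesis d0 : (0 < d)%N.
Variable lam : 'I_d -> R.
Hypothesis lamE : char_poly S = \prod_(j < d) ('X - (lam j)%:P).
Hypothesis n0 : (0 < n)%N.
Variables a b m1 m2 : R.
Hypothesis bS : b * \tr S = 2 * \tr (S *m S).
Hypothesis lam1 : forall j, `|b * lam j - 2 * lam j ^+ 2| <= m1.
Hypothesis lam2 : forall j, `|b * lam j ^+ 2 - 2 * lam j ^+ 3| <= m2.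
Hypothesis a0 : 0 < a.
Hypothesis b0 : 0 < b.
Hypothesis abS : a * b = n%:R * \tr S.
Hypothesis m10 : 0 <= m1.
Hypothesis m20 : 0 <= m2.
Context dX (TX : measurableType dX) (PX : probability TX R) (X : {RV PX >-> 'M[R]_d}).
Hypothesis lawX : same_law (distribution PX X)
  (pushforward P (fun w => \sum_(i < n) Z i w *m (Z i w)^T)).
Context dU (TU : measurableType dU) (Q : probability TU R) (U : {RV Q >-> R}).
Hypothesis Ugamma : is_gamma a b U.

Let Xn : {RV PX >-> R} := @mxtrace R d \o X.
Local Notation mu := (@lebesgue_measure R).
Local Notation W := (sample_norm Z).
Local Notation p := (gamma_pdf a b).
Local Notation pos := (`]0 : R, +oo[%classic).

Let p1 : \int[mu]_(x in `]0%R, +oo[) p x = 1.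
Proof. exact: gamma_pdf_total Ugamma. Qed.

Let p0 x : 0 <= p x.
Proof. exact: gamma_pdf_ge0. Qed.

Lemma wishart_test1 (h h1 : R -> R) :
  (forall x : R, 0 < x -> is_derive x 1 h (h1 x)) ->
  (forall x : R, 0 < x -> {for x, continuous h1}) ->
  (forall x, 0 < x -> `|h1 x| <= 1) ->
  `|\int[P]_w (h \_ pos) (W w) - \int[mu]_(x in pos) (h x * p x)| <= 4 * m1 / b.
Proof.
move=> dh ch1 bh1.
have [C hC] := stein_pair1 indZ SZ Ssym lamE bS lam1 a0 b0 abS m10 p1 dh ch1 bh1.
have [C' hC'] := sample_shift SZ Spd d0 n0 dh (growth_le bh1).
apply: (@le_of_shift _ _ _ (C + C')) => r r0 r1.
apply: (le_trans (ler_distD (\int[P]_w h (W w + r)) _ _)).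
apply: (le_trans (lerD (hC' r r0 r1) (hC r r0))).
by rewrite le_eqVlt; apply/orP; left; apply/eqP; ring.
Qed.

Lemma wishart_test2 (h h1 h2 : R -> R) e :
  (forall x : R, 0 < x -> is_derive x 1 h (h1 x)) ->
  (forall x : R, 0 < x -> is_derive x 1 h1 (h2 x)) ->
  (forall x : R, 0 < x -> {for x, continuous h2}) ->
  (forall x, 0 < x -> `|h2 x| <= 1) ->
  m1 = 0 \/ (forall x, 0 < x -> C2 a x <= e) ->
  `|\int[P]_w (h \_ pos) (W w) - \int[mu]_(x in pos) (h x * p x)| <=
    2 * n%:R * \tr S * e * m1 / b + 8 * m2 / b.
Proof.
move=> dh dh1 ch2 bh2 eC.
have [C hC] := stein_pair2 indZ SZ Ssym lamE n0 bS lam1 lam2 a0 b0 abS m20 p1 dh dh1 ch2 bh2 eC.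
have [C' hC'] := sample_shift SZ Spd d0 n0 dh (growth_lipschitz dh1 bh2).
apply: (@le_of_shift _ _ _ (C + C')) => r r0 r1.
apply: (le_trans (ler_distD (\int[P]_w h (W w + r)) _ _)).
apply: (le_trans (lerD (hC' r r0 r1) (hC r r0 r1))).
by rewrite le_eqVlt; apply/orP; left; apply/eqP; ring.
Qed.

Lemma wishart_Epos (h : R -> R) K m : (forall x : R, 0 < x -> {for x, continuous h}) ->
  (forall x, 0 < x -> `|h x| <= K * (1 + x) ^+ m) ->
  Epos Xn h = (\int[P]_w (h \_ pos) (W w))%:E.
Proof.
move=> ch bh; have mh := measurable_patch_pos ch.
have mEh : measurable_fun setT (fun x => ((h \_ pos) x)%:E) by exact/measurable_EFinP.
rewrite EposE (wishart_trace_integral lawX mEh) /Rintegral fineK//.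
exact: (integrable_fin_num measurableT (integrable_sample_pos SZ ch bh)).
Qed.

Lemma wishart_dist1 : (dist1 Xn U <= (4 * m1 / b)%:E)%E.
Proof.
apply: ge_ereal_sup => _ [h hZ <-].
have dh (x : R) : 0 < x -> is_derive x 1 h (h^`() x).
  by move=> /hZ[+ _ _]; exact: derivable_is_derive1.
have ch1 (x : R) : 0 < x -> {for x, continuous h^`()} by move=> /hZ[].
have bh1 x : 0 < x -> `|h^`() x| <= 1 by move=> /hZ[].
have ch (x : R) : 0 < x -> {for x, continuous h} by move=> /dh/is_derive1_continuous.
have bh x : 0 < x -> `|h x| <= (`|h 1| + 1) * (1 + x) ^+ 1 by exact: growth_lipschitz dh bh1 x.
rewrite (wishart_Epos ch bh) (gamma_law_Epos a0 b0 Ugamma ch bh) -EFinB lee_fin.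
exact: wishart_test1.
Qed.

Lemma wishart_dist2 e : m1 = 0 \/ (forall x, 0 < x -> C2 a x <= e) ->
  (dist2 Xn U <= (2 * n%:R * \tr S * e * m1 / b + 8 * m2 / b)%:E)%E.
Proof.
move=> eC; apply: ge_ereal_sup => _ [h hZ <-].
have dh (x : R) : 0 < x -> is_derive x 1 h (h^`() x).
  by move=> /hZ[+ _ _ _]; exact: derivable_is_derive1.
have dh1 (x : R) : 0 < x -> is_derive x 1 h^`() (h^`(2) x).
  by move=> /hZ[_ + _ _]; exact: derivable_is_derive1.
have ch2 (x : R) : 0 < x -> {for x, continuous h^`(2)} by move=> /hZ[].
have bh2 x : 0 < x -> `|h^`(2) x| <= 1 by move=> /hZ[].
have ch (x : R) : 0 < x -> {for x, continuous h} by move=> /dh/is_derive1_continuous.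
have bh := growth_deriv dh (fun x x0 => growth_lipschitz dh1 bh2 x0 : _ <= _ * (1 + x) ^+ 1).
rewrite (wishart_Epos ch bh) (gamma_law_Epos a0 b0 Ugamma ch bh) -EFinB lee_fin.
exact: wishart_test2 dh1 _ _ _.
Qed.

Lemma sample_patch_pos (f : R -> R) : P.-integrable setT (EFin \o (fun w => f (W w))) ->
  \int[P]_w f (W w) = \int[P]_w (f \_ pos) (W w).
Proof.
move=> fi; pose N := [set w | W w <= 0].
have mN : measurable N by apply: measurable_npos; exact: measurable_sample_norm.
rewrite {1}/Rintegral (@negligible_integral _ _ _ P setT N)//; last first.
  exact: (sample_norm_null SZ Spd d0 n0).
rewrite -/(Rintegral P (setT `\` N) (fun w => f (W w))) Rintegral_mkcond.
apply: eq_Rintegral => w _; have [w0|w0] := ltP 0 (W w).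
  by rewrite patch_pos// patchE mem_set//; split=> //= /(lt_le_trans w0); rewrite ltxx.
by rewrite patch_npos// patchE memNset// => -[_]; apply.
Qed.

Lemma integrable_gamma_bounded (f : R -> R) : measurable_fun setT f ->
  (forall x, `|f x| <= 1) -> mu.-integrable setT (EFin \o (fun x => f x * p x)).
Proof.
move=> mf bf.
have i1 : mu.-integrable pos (EFin \o (fun x => cst 1 x * p x)).
  apply: (@integrable_gamma_growth _ _ _ a0 b0 _ 1 0) => x _; first exact: cvg_cst.
  by rewrite expr0 mulr1 normr1.
rewrite integrable_mkcond// in i1; apply: le_integrable i1 => //.
  by apply/measurable_EFinP; apply: measurable_funM => //; exact: measurable_gamma_pdf.
move=> x _; have [x0|x0] := ltP 0 x.
  rewrite patchE mem_set/= ?in_itv/= ?x0// lee_fin mul1r normrM [leRHS]ger0_norm//.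
  by rewrite [`|p x|]ger0_norm// ler_piMl.
by rewrite patchE memNset/= ?in_itv/= ?andbT ?ltNge ?x0// /gamma_pdf ltNge x0/= mulr0 normr0.
Qed.

Section kolmogorov.
Variable M : R.
Hypothesis pM : forall x, p x <= M.
Let M0 : 0 <= M. Proof. exact: le_trans (p0 0) (pM 0). Qed.

Let I z (x : R) : R := \1_(`]-oo, z]%classic) x.

Let mI z : measurable_fun setT (I z).
Proof. by apply: measurable_indic; exact: measurable_itv. Qed.

Let I01 z x : 0 <= I z x <= 1.
Proof. by rewrite /I indicE; case: (_ \in _); rewrite /= ?lexx ler01. Qed.

Let IE z x : I z x = if x <= z then 1 else 0.
Proof.
rewrite /I indicE; have -> : (x \in `]-oo, z]%classic) = (x <= z); last by case: ifP.
apply/idP/idP => [|h]; first by rewrite inE/= in_itv.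
by rewrite inE/= in_itv.
Qed.

Lemma integrable_sample_bounded (f : R -> R) : measurable_fun setT f ->
  (forall x, 0 <= f x <= 1) -> P.-integrable setT (EFin \o (fun w => f (W w))).
Proof.
move=> mf bf; apply: (integrable_sample_norm_bound SZ (K := 1) (m := 0)).
  by apply: measurableT_comp => //; exact: measurable_sample_norm.
by move=> w; have /andP[f0 f1] := bf (W w); rewrite expr0 mulr1 ger0_norm.
Qed.

Lemma wishart_cdf z : cdf Xn z = (\int[P]_w I z (W w))%:E.
Proof.
have mEI : measurable_fun setT (fun x => (I z x)%:E) by exact/measurable_EFinP.
rewrite /cdf /distribution /pushforward (probability_indic PX)//.
rewrite (wishart_trace_integral lawX mEI) /Rintegral fineK//.
exact: (integrable_fin_num measurableT (integrable_sample_bounded (mI z) (I01 z))).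
Qed.

Lemma gamma_cdf z : cdf U z = (\int[mu]_x (I z x * p x))%:E.
Proof.
have iI := @integrable_gamma_bounded (I z) (mI z)
  (fun x => let: conj h0 h1 := andP (I01 z x) in eq_ind_r (fun v => v <= 1) h1 (ger0_norm h0)).
have [iU <-] := gamma_law_integral a0 b0 Ugamma (mI z) iI.
rewrite /cdf /distribution /pushforward (probability_indic Q)// /Rintegral fineK//.
exact: (integrable_fin_num measurableT iU).
Qed.

Section one_ramp.
Variables e l : R.
Hypothesis e0 : 0 < e.
Hypothesis l0 : 0 < l.
Local Notation w := (e + l).
Local Notation r c := (fun x : R => ramp e l (x - c)).

Let dr c (x : R) : is_derive x 1 (r c) (ramp1 e l (x - c)).
Proof.
have d1 : is_derive x 1 (fun y => y - c) 1.
  by apply: (is_derive1_eq (is_derive1B (is_derive1_id x) (is_derive1_cst x c))); rewrite subr0.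
rewrite -[ramp1 _ _ _]mulr1.
exact: (@is_derive1_chain R (ramp e l) (fun y => y - c) x _ _ (is_derive_ramp e0 l0 _) d1).
Qed.

Let r01 c x : 0 <= r c x <= 1.
Proof. by rewrite ramp_ge0// ramp_le1. Qed.

Let cr c (x : R) : {for x, continuous (r c)}.
Proof. exact: is_derive1_continuous (dr c x). Qed.

Let mr c : measurable_fun setT (r c).
Proof. by apply: continuous_measurable_fun => x; exact: cr. Qed.

Let ir c : mu.-integrable setT (EFin \o (fun x => r c x * p x)).
Proof.
apply: integrable_gamma_bounded => // x; have /andP[h0 h1] := r01 c x.
by rewrite ger0_norm.
Qed.

Let iI z : mu.-integrable setT (EFin \o (fun x => I z x * p x)).
Proof.
apply: integrable_gamma_bounded => // x; have /andP[h0 h1] := I01 z x.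
by rewrite ger0_norm.
Qed.

(** The multiple e times the ramp has slope at most 1 in modulus, so the bound for [Zclass1] applies
    and is divided by e. *)
Lemma ramp_test c : `|\int[P]_w r c (W w) - \int[mu]_x (r c x * p x)| <= 4 * m1 / b / e.
Proof.
pose h x := e * r c x.
have dh (x : R) : 0 < x -> is_derive x 1 h (e * ramp1 e l (x - c)).
  move=> _; apply: (is_derive1_eq (is_derive1M (is_derive1_cst x e) (dr c x))); ring.
have ch1 (x : R) : 0 < x -> {for x, continuous (fun x : R => e * ramp1 e l (x - c))}.
  move=> _; apply: cvgM; first exact: cvg_cst.
  apply: (@continuous_comp _ _ _ (fun y : R => y - c) (ramp1 e l)); last exact: continuous_ramp1.
  by apply: cvgB; [exact: cvg_id|exact: cvg_cst].
have bh1 x : 0 < x -> `|e * ramp1 e l (x - c)| <= 1.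
  move=> _; have /andP[h1 h2] := ramp1_bound e0 l0 (x - c).
  rewrite normrM gtr0_norm// ler0_norm// -(mulfV (lt0r_neq0 e0)) ler_wpM2l ?(ltW e0)//; lra.
have := wishart_test1 dh ch1 bh1.
have irW := integrable_sample_bounded (mr c) (r01 c).
have -> : \int[P]_w (h \_ pos) (W w) = e * \int[P]_w r c (W w).
  rewrite -sample_patch_pos; first by rewrite RintegralZl.
  exact: (@integrableZl _ _ _ P setT measurableT e _ irW).
have -> : \int[mu]_(x in pos) (h x * p x) = e * \int[mu]_x (r c x * p x).
  rewrite Rintegral_mkcond -RintegralZl//; apply: eq_Rintegral => x _.
  have [x0|x0] := ltP 0 x; first by rewrite patch_pos// mulrA.
  by rewrite patch_npos// /gamma_pdf ltNge x0/= !mulr0.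
by rewrite -mulrBr normrM gtr0_norm// mulrC -ler_pdivlMr.
Qed.

(** A function that vanishes outside the window is integrated against a density at most M, so its
    mean is at most M times the area of a majorant. *)
Let window c (f g : R -> R) V : measurable_fun setT f -> measurable_fun setT g ->
  (forall x, 0 <= f x <= g x) ->
  (forall x, ~~ (c <= x <= c + w) -> f x = 0) ->
  mu.-integrable setT (EFin \o (fun x => f x * p x)) ->
  (\int[mu]_(x in `[c, (c + w)%R]) (g x)%:E = V%:E)%E ->
  \int[mu]_x (f x * p x) <= M * V.
Proof.
move=> mf mg fg fc ifp fV.
have f0 x : 0 <= f x by have /andP[] := fg x.
have g0 x : 0 <= g x by have /andP[] := fg x; exact: le_trans.
have mIcw : measurable `[c, c + w]%classic by exact: measurable_itv.
rewrite -lee_fin /Rintegral fineK; last exact: (integrable_fin_num measurableT ifp).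
rewrite EFinM -fV -ge0_integralZl//=; last 2 first.
- by apply/measurable_EFinP; exact: measurable_funTS.
- by move=> x _; rewrite lee_fin.
rewrite [leRHS]integral_mkcond; apply: ge0_le_integral => //.
- by move=> x _; rewrite lee_fin mulr_ge0.
- by apply/measurable_EFinP; apply: measurable_funM => //; exact: measurable_gamma_pdf.
- apply/(measurable_restrictT _ mIcw); apply: measurable_funTS.
  by apply: emeasurable_funM => //; exact/measurable_EFinP.
move=> x _; rewrite patchE; case: ifPn => [_|].
  by rewrite -EFinM lee_fin mulrC; apply: ler_pM => //; have /andP[] := fg x.
by rewrite notin_setE/= in_itv/= => /negP/fc ->; rewrite mul0r.
Qed.

Lemma ramp_gamma_up c : \int[mu]_x (r c x * p x) - \int[mu]_x (I c x * p x) <= M * (w / 2).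
Proof.
rewrite -RintegralB//.
have -> : \int[mu]_x (r c x * p x - I c x * p x) = \int[mu]_x ((r c x - I c x) * p x).
  by apply: eq_Rintegral => x _; rewrite [in RHS]mulrBl.
have rI x : 0 <= r c x - I c x <= r c x.
  have /andP[h0 h1] := r01 c x; rewrite IE; case: ifPn => xc; last by rewrite subr0 h0 lexx.
  by rewrite ramp_left// ?subr_le0// subrr lexx ler01.
apply: (window (c := c) (g := r c)) => //.
- exact: measurable_funB.
- move=> x; rewrite negb_and -!ltNge => /orP[xc|xc]; rewrite IE.
    by rewrite (ltW xc) ramp_left ?subr_le0 ?(ltW xc)// subrr.
  rewrite ramp_right//; last by rewrite lerBrDl ltW.
  by rewrite leNgt (lt_trans _ xc) ?subr0// ltrDl addr_gt0.
- apply: integrable_gamma_bounded; first exact: measurable_funB.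
  by move=> x; have /andP[h0 h1] := rI x; rewrite ger0_norm// (le_trans h1)//; have /andP[] := r01 c x.
- exact: integral_ramp.
Qed.

Lemma ramp_gamma_down c :
  \int[mu]_x (I (c + w) x * p x) - \int[mu]_x (r c x * p x) <= M * (w / 2).
Proof.
rewrite -RintegralB//.
have -> : \int[mu]_x (I (c + w) x * p x - r c x * p x) = \int[mu]_x ((I (c + w) x - r c x) * p x).
  by apply: eq_Rintegral => x _; rewrite [in RHS]mulrBl.
have rI x : 0 <= I (c + w) x - r c x <= 1 - r c x.
  have /andP[h0 h1] := r01 c x; rewrite IE; case: ifPn => xc; first by rewrite subr_ge0 h1 lexx.
  rewrite -ltNge in xc; rewrite ramp_right// ?subrr ?subr0 ?lexx ?ler01//.
  by rewrite lerBrDl ltW.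
apply: (window (c := c) (g := fun x => 1 - r c x)) => //.
- exact: measurable_funB.
- exact: measurable_funB.
- move=> x; rewrite negb_and -!ltNge => /orP[xc|xc]; rewrite IE.
    rewrite ramp_left ?subr_le0 ?(ltW xc)// ifT ?subrr// (le_trans (ltW xc))// lerDl.
    by rewrite addr_ge0 ?(ltW e0) ?(ltW l0).
  rewrite ramp_right//; last by rewrite lerBrDl ltW.
  by rewrite subr0 leNgt xc.
- apply: integrable_gamma_bounded; first exact: measurable_funB.
  move=> x; have /andP[h0 h1] := rI x; rewrite ger0_norm// (le_trans h1)//.
  by rewrite gerBl; have /andP[] := r01 c x.
- exact: integral_onem_ramp.
Qed.

Lemma ramp_sample c :
  (\int[P]_t I c (W t)) <= (\int[P]_t r c (W t)) <= (\int[P]_t I (c + w) (W t)).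
Proof.
have i1 z := integrable_sample_bounded (mI z) (I01 z).
have i2 := integrable_sample_bounded (mr c) (r01 c).
apply/andP; split; apply: le_Rintegral => // t _; rewrite IE; case: ifPn => h.
- by rewrite ramp_left ?subr_le0.
- by have /andP[] := r01 c (W t).
- by have /andP[] := r01 c (W t).
- by rewrite -ltNge in h; rewrite ramp_right// lerBrDl ltW.
Qed.

(** The ramp that starts at z lies above the indicator, the one that ends at z below it. For the
    sample these inequalities are used as they stand; under the Gamma law replacing the indicator
    costs M times half the window. *)
Lemma kolmogorov_ramp z : `|\int[P]_w I z (W w) - \int[mu]_x (I z x * p x)| <=
  4 * m1 / b / e + M * (w / 2).
Proof.
have /andP[s1 _] := ramp_sample z.
have /andP[_ s2] := ramp_sample (z - w); rewrite subrK in s2.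
have u1 := ramp_gamma_up z.
have u2 := ramp_gamma_down (z - w); rewrite subrK in u2.
have t1 := ramp_test z; have t2 := ramp_test (z - w).
move: t1 t2; rewrite !ler_norml => /andP[t1 t1'] /andP[t2 t2'].
apply/andP; split; lra.
Qed.

End one_ramp.

Lemma wishart_kolmogorov : 0 < M -> (dist_Kol Xn U <= (Num.sqrt (8 * m1 / b * M))%:E)%E.
Proof.
move=> Mp; apply: ge_ereal_sup => _ [z _ <-].
rewrite wishart_cdf gamma_cdf -EFinB lee_fin; set D := `|_ - _|.
pose B := 4 * m1 / b; have B0 : 0 <= B by rewrite divr_ge0 ?mulr_ge0// ltW.
have bound e : 0 < e -> D <= B / e + M * (e / 2).
  move=> e0; apply/ler_addgt0Pr => k k0.
  (* A smoothing width l = 2 k / M adds exactly k to the bound. *)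
  have l0 : 0 < 2 * k / M by rewrite divr_gt0// mulr_gt0.
  apply: (le_trans (kolmogorov_ramp e0 l0 z)); rewrite -addrA lerD2l.
  by rewrite le_eqVlt; apply/orP; left; apply/eqP; field; rewrite gt_eqF.
have -> : 8 * m1 / b * M = 2 * B * M by rewrite /B; ring.
have [Bn|Bp] := leP B 0.
  have -> : B = 0 by apply/eqP; rewrite eq_le Bn.
  rewrite mulr0 mul0r sqrtr0; apply/ler_addgt0Pr => k k0; rewrite add0r.
  have l0 : 0 < 2 * k / M by rewrite divr_gt0// mulr_gt0.
  have := bound _ l0; have -> : B = 0 by apply/eqP; rewrite eq_le Bn.
  rewrite mul0r add0r => /le_trans; apply.
  by rewrite le_eqVlt; apply/orP; left; apply/eqP; field; rewrite gt_eqF.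
(* The width e = s / M = sqrt(2 B / M) balances B / e and M e / 2; both equal s / 2. *)
pose s := Num.sqrt (2 * B * M); have s0 : 0 < s by rewrite sqrtr_gt0; do 2 apply: mulr_gt0 => //.
have ss : s * s = 2 * B * M by rewrite -expr2 sqr_sqrtr// ltW//; do 2 apply: mulr_gt0 => //.
have := bound (s / M); rewrite divr_gt0// => /(_ isT)/le_trans; apply.
rewrite -/s le_eqVlt; apply/orP; left; apply/eqP.
have -> : B / (s / M) = s * s / (2 * s) by rewrite ss; field; rewrite !gt_eqF.
by field; rewrite !gt_eqF.
Qed.

End kolmogorov.
End distances.

(** * Proof of the corollary *)

(** The determinant of X - c A is c^d times that of X / c - A, which is the characteristic
    polynomial of A composed with X / c. *)
Lemma char_polyZ (F : fieldType) (d : nat) (A : 'M[F]_d) (c : F) (lam : 'I_d -> F) : c != 0 ->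
  char_poly A = \prod_(j < d) ('X - (lam j)%:P) ->
  char_poly (c *: A) = \prod_(j < d) ('X - (c * lam j)%:P).
Proof.
move=> c0 AE; have cE : c%:P * (c^-1 *: 'X) = 'X :> {poly F}.
  by rewrite mul_polyC scalerA mulfV// scale1r.
have -> : char_poly (c *: A) = c%:P ^+ d * (char_poly A \Po (c^-1 *: 'X)).
  rewrite /char_poly -(@det_map_mx _ _ (comp_poly (c^-1 *: 'X))) -detZ; congr (\det _).
  apply/matrixP => i j; rewrite !mxE rmorphB/= rmorphMn/= comp_polyX comp_polyC mulrBr.
  by rewrite mulrnAr cE -polyCM.
rewrite AE rmorph_prod -[X in _ ^+ X](card_ord d) -prodr_const -big_split/=.
apply: eq_bigr => j _; rewrite rmorphB/= comp_polyX comp_polyC mulrBr cE -polyCM.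
by [].
Qed.

Section positive_definite.
Context (R : realType) (d : nat).
Variable A : 'M[R]_d.
Hypothesis Asym : A \is symmetricmx.
Hypothesis Apd : posdefmx A.

Lemma posdefmx_diag i : 0 < A i i.
Proof.
have e0 : delta_mx i 0 != 0 :> 'cV[R]_d.
  by apply/eqP => /matrixP/(_ i 0)/eqP; rewrite !mxE !eqxx/= oner_eq0.
by have := Apd e0; rewrite trmx_delta -rowE -colE !mxE.
Qed.

Lemma posdefmx_trace : (0 < d)%N -> 0 < \tr A.
Proof.
move=> d0; rewrite /mxtrace (bigD1 (Ordinal d0))//= ltr_pwDl ?posdefmx_diag// sumr_ge0// => i _.
exact/ltW/posdefmx_diag.
Qed.

Lemma posdefmx_trace_sqr : (0 < d)%N -> 0 < \tr (A *m A).
Proof.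
move=> d0; have As := symmetricmx_tr Asym.
have E i : (A *m A) i i = \sum_j A i j ^+ 2.
  by rewrite mxE; apply: eq_bigr => j _; rewrite expr2 {2}As mxE.
rewrite /mxtrace (bigD1 (Ordinal d0))//= ltr_pwDl//; last first.
  by apply: sumr_ge0 => i _; rewrite E sumr_ge0// => j _; exact: sqr_ge0.
rewrite E (bigD1 (Ordinal d0))//= ltr_pwDl ?exprn_gt0 ?posdefmx_diag// sumr_ge0// => j _.
exact: sqr_ge0.
Qed.

(** On an eigenvector the positive quadratic form is the eigenvalue times a squared norm. *)
Lemma posdefmx_eigenvalue (lam : 'I_d -> R) j :
  char_poly A = \prod_(k < d) ('X - (lam k)%:P) -> 0 < lam j.
Proof.
move=> AE; have : root (char_poly A) (lam j).
  by rewrite AE rootE horner_prod (bigD1 j)//= hornerXsubC subrr mul0r.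
rewrite -eigenvalue_root_char => /eigenvalueP[v vA v0].
have vt0 : v^T != 0 by rewrite trmx_eq0.
have := Apd vt0; rewrite trmxK vA -scalemxAl mxE.
have N0 : 0 <= (v *m v^T) 0 0.
  by rewrite mxE; apply: sumr_ge0 => i _; rewrite mxE -expr2 sqr_ge0.
by move=> h; rewrite ltNge; apply/negP => l0; move: h; rewrite ltNge mulr_le0_ge0.
Qed.

End positive_definite.

Lemma Delta_ge (R : realType) (k n : nat) (S : 'M[R]_k) (lam : 'I_k -> R) (r : nat) j :
  `|lam j * \tr S / \tr (S *m S) - 1| * (lam j / n%:R) ^+ r <= Delta n S lam r.
Proof.
exact: (le_bigmax _ (fun j => `|lam j * \tr S / \tr (S *m S) - 1| * (lam j / n%:R) ^+ r)).
Qed.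

Lemma Delta_ge0 (R : realType) (k n : nat) (S : 'M[R]_k) (lam : 'I_k -> R) (r : nat) :
  0 <= Delta n S lam r.
Proof. exact: bigmax_ge_id. Qed.

Theorem corollary3p5 (R : realType) (n d : nat) (n_ge1 : (1 <= n)%N)
    (d_ge1 : (1 <= d)%N)
    (Sigma : 'M[R]_d) (Sigma_sym : Sigma \is symmetricmx)
    (Sigma_pd : posdefmx Sigma)
    (lambda : 'I_d -> R)
    (lambda_eig : char_poly Sigma = \prod_(j < d) ('X - (lambda j)%:P))
    (dT : measure_display) (T : measurableType dT) (P : probability T R)
    (W : {RV P >-> 'M[R]_d}) (W_wishart : is_wishart n (n%:R^-1 *: Sigma) W)
    (dT' : measure_display) (T' : measurableType dT') (Q : probability T' R)
    (U : {RV Q >-> R})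
    (U_gamma : is_gamma (nu_eff n Sigma / 2) (2 * \tr Sigma / nu_eff n Sigma) U) :
  let Wn : {RV P >-> R} := @mxtrace R d \o W in
  let nun := nu_eff n Sigma in
  let Delta1 := Delta n Sigma lambda 1 in
  let Delta2 := Delta n Sigma lambda 2 in
  [/\ (dist1 Wn U <= (4 * Delta1)%:E)%E,
      (dist2 Wn U <= (8 * Delta2)%:E
                     + (2 * \tr Sigma)%:E * e_const (nun / 2) * Delta1%:E)%E &
      2 < nun ->
      (dist_Kol Wn U <=
         (2 * Num.sqrt (\tr Sigma / \tr (Sigma *m Sigma) *
                (n%:R * Delta1 /
                  (Num.sqrt (2 * pi * (nun / 2 - 1)) * r_const (nun / 2)))))%:E)%E].
Proof.
move=> Wn nun Delta1 Delta2.
have [dZ [TZ [PZ [Z [indZ SZ lawW]]]]] := W_wishart.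
have n0 : 0 < n%:R :> R by rewrite ltr0n.
have nn0 : n%:R != 0 :> R by rewrite gt_eqF.
pose t := \tr Sigma; pose q := \tr (Sigma *m Sigma).
have t0 : 0 < t by exact: posdefmx_trace.
have q0 : 0 < q by exact: posdefmx_trace_sqr.
have tn0 : t != 0 by rewrite gt_eqF.
have qn0 : q != 0 by rewrite gt_eqF.
have lam0 j : 0 < lambda j by exact: (posdefmx_eigenvalue Sigma_pd j lambda_eig).
pose S := n%:R^-1 *: Sigma; pose s j := n%:R^-1 * lambda j.
have Ssym : S \is symmetricmx.
  apply/is_hermitianmxP; rewrite expr0 scale1r; apply/matrixP => i j.
  by rewrite !mxE/= [in LHS](symmetricmx_tr Sigma_sym) mxE.
have Spd : posdefmx S.
  by move=> u u0; rewrite -scalemxAr -scalemxAl mxE mulr_gt0 ?invr_gt0// Sigma_pd.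
have SE : char_poly S = \prod_(j < d) ('X - (s j)%:P).
  by apply: char_polyZ => //; rewrite invr_neq0.
have trS : \tr S = t / n%:R by rewrite mxtraceZ mulrC.
have trSS : \tr (S *m S) = q / n%:R ^+ 2.
  by rewrite -scalemxAl -scalemxAr scalerA mxtraceZ; field.
pose a := nun / 2; pose b := 2 * t / nun.
have nuE : nun = n%:R * (t ^+ 2 / q) by [].
have nu0 : 0 < nun by rewrite nuE mulr_gt0// divr_gt0// exprn_gt0.
have nun0 : nun != 0 by rewrite gt_eqF.
have a0 : 0 < a by rewrite divr_gt0.
have b0 : 0 < b by rewrite divr_gt0// mulr_gt0.
(* In terms of Sigma this is the variance condition behind [bS]. *)
have bE : b = 2 * q / (n%:R * t) by rewrite /b nuE; field; rewrite nn0 tn0 qn0.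
have abS : a * b = n%:R * \tr S by rewrite /a /b trS; field; rewrite nn0 nun0.
have bS : b * \tr S = 2 * \tr (S *m S) by rewrite bE trS trSS; field; rewrite nn0 tn0.
have D10 : 0 <= Delta1 by exact: Delta_ge0.
have D20 : 0 <= Delta2 by exact: Delta_ge0.
have m10 : 0 <= b * Delta1 by rewrite mulr_ge0// ltW.
have m20 : 0 <= b * Delta2 by rewrite mulr_ge0// ltW.
(* Since 2 / b = n t / q, the expression factors as b s^r (1 - lambda t / q), whose modulus is b
   times the quantity maximised in [Delta]. Hence m1 = b Delta1 and m2 = b Delta2 below. *)
have Dr (r : nat) j :
    `|b * s j ^+ r - 2 * s j ^+ r.+1| = b * (`|lambda j * t / q - 1| * (lambda j / n%:R) ^+ r).
  have s0 : 0 <= s j by rewrite mulr_ge0 ?invr_ge0// ltW.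
  have -> : b * s j ^+ r - 2 * s j ^+ r.+1 = - (b * ((lambda j * t / q - 1) * s j ^+ r)).
    by rewrite exprS bE /s; field; rewrite nn0 tn0 qn0.
  rewrite normrN normrM gtr0_norm// normrM [`|s j ^+ r|]ger0_norm ?exprn_ge0//.
  by rewrite /s [n%:R^-1 * _]mulrC.
have lam1 j : `|b * s j - 2 * s j ^+ 2| <= b * Delta1.
  by have := Dr 1%N j; rewrite {1}expr1 => ->; rewrite ler_pM2l//; exact: (Delta_ge n Sigma lambda 1).
have lam2 j : `|b * s j ^+ 2 - 2 * s j ^+ 3| <= b * Delta2.
  by rewrite Dr ler_pM2l//; exact: (Delta_ge n Sigma lambda 2).
have bn0 : b != 0 by rewrite gt_eqF.
split.
- have := wishart_dist1 indZ SZ Ssym Spd d_ge1 SE n_ge1 bS lam1 a0 b0 abS m10 lawW U_gamma.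
  by have -> : 4 * (b * Delta1) / b = 4 * Delta1 by field.
- have d2 := wishart_dist2 indZ SZ Ssym Spd d_ge1 SE n_ge1 bS lam1 lam2 a0 b0 abS m20 lawW U_gamma.
  have C2e z : 0 < z -> ((C2 a z)%:E <= e_const a)%E.
    by move=> z0; apply: ereal_sup_ubound; exists z => //=; rewrite in_itv/= z0.
  (* When Delta1 = 0 its product with [e_const] is 0 even if the latter is infinite, so this case
     must do without a bound on [C2]; the witness e = 0 is arbitrary. *)
  have [D1z|D1p] := eqVneq Delta1 0.
    rewrite D1z mule0 adde0.
    have := d2 0 (or_introl _); rewrite D1z mulr0 => /(_ erefl).
    by have -> : 2 * n%:R * \tr S * 0 * 0 / b + 8 * (b * Delta2) / b = 8 * Delta2 by field.
  have D1g : 0 < Delta1 by rewrite lt_neqAle eq_sym D1p.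
  case eE : (e_const a) => [e| |].
  + have eC x : 0 < x -> C2 a x <= e by move=> /C2e; rewrite eE lee_fin.
    have := d2 e (or_intror eC).
    have -> : 2 * n%:R * \tr S * e * (b * Delta1) / b + 8 * (b * Delta2) / b =
        8 * Delta2 + 2 * t * e * Delta1 by rewrite trS; field; rewrite bn0 nn0.
    by rewrite EFinD !EFinM.
  (* With Delta1 > 0 an infinite constant makes the bound trivial; -oo is excluded because [C2]
     takes real values. *)
  + have -> : ((8 * Delta2)%:E + (2 * \tr Sigma)%:E * +oo * Delta1%:E = +oo)%E.
      rewrite gt0_muley ?lte_fin ?mulr_gt0// gt0_mulye ?lte_fin//.
    exact: leey.
  + by have := C2e 1 ltr01; rewrite eE.
move=> nu2; pose rho := Num.sqrt (2 * pi * (nun / 2 - 1)) * r_const (nun / 2).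
have a1 : 1 < a by rewrite /a ltr_pdivlMr// mul1r.
have rho0 : 0 < rho.
  rewrite mulr_gt0 ?expR_gt0// sqrtr_gt0 mulr_gt0 ?mulr_gt0 ?pi_gt0//.
  by rewrite subr_gt0.
have M0 : 0 < (b * rho)^-1 by rewrite invr_gt0 mulr_gt0.
have := wishart_kolmogorov indZ SZ Ssym Spd d_ge1 SE n_ge1 bS lam1 a0 b0 abS m10 lawW U_gamma
  (fun x => gamma_pdf_sup x a1 b0) M0.
have rhon0 : rho != 0 by rewrite gt_eqF.
(* Inserting b = 2 q / (n t) isolates the factor 4, which leaves the root as the leading 2. *)
have -> : 8 * (b * Delta1) / b * (b * rho)^-1 = 2 ^+ 2 * (t / q * (n%:R * Delta1 / rho)).
  by rewrite bE; field; rewrite rhon0 nn0 tn0 qn0.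
by rewrite sqrtrM ?sqr_ge0// sqrtr_sqr ger0_norm.
Qed.
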